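(* There are absolute constants $C_0,C>0$ such that the following holds. In the setting described in the context, suppose $\mathcal A\subseteq\{A\in\mathbb R^{d_1\times d_2}:\|A\|_{\mathrm{op}}\le1\}$, $|\langle\Theta^*,A\rangle|\le R_{\max}$ for all $A\in\mathcal A$, $\delta\in(0,1)$, and $$n_0\ \ge\ C_0\, r^2B(Q)\Big(\frac{\sigma+R_{\max}}{\sigma}\Big)^2\ln\frac{2d}{\delta}.$$ Then the output $\hat\Theta$ of Warm-LowPopArt satisfies, with probability at least $1-\delta$, $\operatorname{rank}(\hat\Theta)\le r$ and $$\|\hat\Theta-\Theta^*\|_{\mathrm{op}}\le C\,\sigma\sqrt{\frac{2B(Q)}{n_0}\ln\frac{2d}{\delta}} .$$
   Context: Notation: $d=\max(d_1,d_2)$; $\langle A,B\rangle=\operatorname{tr}(A^\top B)$; $\|\cdot\|_{\mathrm{op}}$ is the largest singular value; $\operatorname{vec}$ stacks the columns of a $d_1\times d_2$ matrix into a vector of $\mathbb R^{d_1d_2}$ and $\operatorname{reshape}$ is its inverse. Data: $\mathcal A\subset\mathbb R^{d_1\times d_2}$ spans $\mathbb R^{d_1\times d_2}$, $\pi$ is a probability distribution on $\mathcal A$ whose covariance $Q=Q(\pi)=\mathbb E_{a\sim\pi}[\operatorname{vec}(a)\operatorname{vec}(a)^\top]$ is invertible and known. $\Theta^*\in\mathbb R^{d_1\times d_2}$ is unknown with rank at most $r$ ($r\ge1$). The samples $(X_i,Y_i)_{i=1}^{n_0}$ ($n_0$ even) are i.i.d. with $X_i\sim\pi$, $Y_i=\langle\Theta^*,X_i\rangle+\eta_i$,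 where $\eta_i$ is zero-mean $\sigma$-subgaussian ($\mathbb E e^{s\eta_i}\le e^{s^2\sigma^2/2}$ for all $s\in\mathbb R$, $\sigma>0$) and independent of $X_i$. Definition of $B(Q)$: for $i\in[d_2]$, let $D_i^{(\mathrm{col})}$ be the $d_1\times d_1$ principal submatrix of $Q^{-1}$ with row and column indices $\{(i-1)d_1+1,\dots,i d_1\}$; for $i\in[d_1]$, let $D_i^{(\mathrm{row})}$ be the $d_2\times d_2$ principal submatrix of $Q^{-1}$ with indices $\{i+d_1(\ell-1):\ell\in[d_2]\}$. Then $B(Q)=\max\big(\lambda_{\max}(\sum_{i=1}^{d_2}D_i^{(\mathrm{col})}),\ \lambda_{\max}(\sum_{i=1}^{d_1}D_i^{(\mathrm{row})})\big)$. Matrix functions: $\phi_0(x)=\log(1+x+x^2/2)$ for $x>0$ and $\phi_0(x)=-\log(1-x+x^2/2)$ otherwise; for symmetric $M=U\operatorname{diag}(\lambda_j)U^\top$, $\phi(M)=U\operatorname{diag}(\phi_0(\lambda_j))U^\top$. The dilation of $A\in\mathbb R^{d_1\times d_2}$ is $\mathcal H(A)=\begin{bmatrix} 0 & A \\ A^\top & 0 \end{bmatrix}$, and for $M\in\mathbb R^{(d_1+d_2)\times(d_1+d_2)}$, $(M)_{\mathsf{ht}}$ is the block with rows $1,\dots,d_1$ and columns $d_1+1,\dots,d_1+d_2$. LowPopArt (inputs: samples $(X_i,Y_i)_{i=1}^{m}$, $m$, $Q$, pilot estimator $\Theta_0$, pilot error bound $R_0$, failure rate $\delta'$): (1) $\tilde\Theta_i=Q^{-1}(Y_i-\langle\Theta_0,X_i\rangle)\operatorname{vec}(X_i)$.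 (2) $\Theta_1=\Theta_0+\Big(\frac1{m\nu}\sum_{i=1}^{m}\phi\big(\nu\,\mathcal H(\operatorname{reshape}(\tilde\Theta_i))\big)\Big)_{\mathsf{ht}}$ with $\nu=\frac1{\sigma+R_0}\sqrt{\frac{2}{B(Q)m}\ln\frac{2d}{\delta'}}$. (3) Take an SVD $\Theta_1=U_1\Sigma_1V_1^\top$ and let $\tilde\Sigma_1$ be $\Sigma_1$ with all diagonal entries that are at most $2(R_0+\sigma)\sqrt{B(Q)\ln(2d/\delta')/m}$ replaced by $0$; output $U_1\tilde\Sigma_1V_1^\top$. Warm-LowPopArt (inputs: samples, $n_0$, $Q$, $\delta$): first run LowPopArt on the first $n_0/2$ samples with pilot estimator $0_{d_1\times d_2}$, pilot error bound $R_{\max}$ and failure rate $\delta/2$, obtaining $\Theta_0$; then run LowPopArt on the last $n_0/2$ samples with pilot estimator $\Theta_0$, pilot error bound $\sigma$ and failure rate $\delta/2$, and output the result $\hat\Theta$. *)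

(* Defs.v *)
From mathcomp Require Import all_boot all_order all_algebra.
From mathcomp Require Import all_classical all_reals all_analysis.

Set Implicit Arguments.
Unset Strict Implicit.
Unset Printing Implicit Defensive.

Import Order.TTheory GRing.Theory Num.Theory.
Import numFieldNormedType.Exports.

Local Open Scope classical_set_scope.
Local Open Scope ring_scope.

Section Matrices.
Variable R : realType.

Definition inner (m n : nat) (A B : 'M[R]_(m, n)) : R := \tr (A^T *m B).

(* Only meant for symmetric [M] of positive size: the spectrum is then finite,
   real and nonempty, and the supremum is a maximum. *)
Definition lambda_max (n : nat) (M : 'M[R]_n) : R := sup [set a | eigenvalue M a].

Definition singular_values (m n : nat) (A : 'M[R]_(m, n)) : set R :=
  [set Num.sqrt a | a in [set a | eigenvalue (A^T *m A) a]].

(* The largest singular value, for [0 < n]. *)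
Definition opnorm (m n : nat) (A : 'M[R]_(m, n)) : R := sup (singular_values A).

Definition orthogonal_mx (n : nat) (U : 'M[R]_n) : Prop := U^T *m U = 1%:M.

Definition phi0 (x : R) : R :=
  if 0 < x then ln (1 + x + x ^+ 2 / 2) else - ln (1 - x + x ^+ 2 / 2).

(* [phi M = U diag(phi0 lam) U^T] for any orthogonal diagonalization
   [M = U diag(lam) U^T]; for symmetric [M] one exists and the result does not
   depend on it, so the choice made by [get] is immaterial. *)
Definition phi (n : nat) (M : 'M[R]_n) : 'M[R]_n :=
  get [set N : 'M[R]_n | exists (U : 'M[R]_n) (lam : 'rV[R]_n),
    [/\ orthogonal_mx U, M = U *m diag_mx lam *m U^T
      & N = U *m diag_mx (map_mx phi0 lam) *m U^T]].

Definition is_svd (m n : nat) (A : 'M[R]_(m, n))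
    (U : 'M[R]_m) (S : 'M[R]_(m, n)) (V : 'M[R]_n) : Prop :=
  [/\ orthogonal_mx U, orthogonal_mx V,
      (forall (i : 'I_m) (j : 'I_n), (i : nat) <> j -> S i j = 0),
      (forall i j, 0 <= S i j)
    & A = U *m S *m V^T].

(* Acts on the diagonal only: the other entries of [S] are already [0]. *)
Definition threshold (t : R) (m n : nat) (S : 'M[R]_(m, n)) : 'M[R]_(m, n) :=
  map_mx (fun x => if x <= t then 0 else x) S.

Definition spans (m n : nat) (A : set 'M[R]_(m, n)) : Prop :=
  forall M : 'M[R]_(m, n), exists s : seq 'M[R]_(m, n),
    (forall a, a \in s -> A a) /\ M \in << s >>%VS.

End Matrices.

Section LowPopArt.
Variables (R : realType) (d1 d2 : nat).

(* [mxvec] is row-major, so stacking columns is [mxvec] of the transpose. Entry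
   [(a, b)] of a [d1 x d2] matrix is coordinate [mxvec_index b a], that is
   [b * d1 + a] counting from [0]. *)
Definition vec (A : 'M[R]_(d1, d2)) : 'cV[R]_(d2 * d1) := (mxvec A^T)^T.
Definition reshape (v : 'cV[R]_(d2 * d1)) : 'M[R]_(d1, d2) := (vec_mx v^T)^T.

Definition Dcol (Q : 'M[R]_(d2 * d1)) (i : 'I_d2) : 'M[R]_d1 :=
  \matrix_(a, b) invmx Q (mxvec_index i a) (mxvec_index i b).

Definition Drow (Q : 'M[R]_(d2 * d1)) (i : 'I_d1) : 'M[R]_d2 :=
  \matrix_(k, l) invmx Q (mxvec_index k i) (mxvec_index l i).

Definition BQ (Q : 'M[R]_(d2 * d1)) : R :=
  Num.max (lambda_max (\sum_i Dcol Q i)) (lambda_max (\sum_i Drow Q i)).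

Definition dilation (A : 'M[R]_(d1, d2)) : 'M[R]_(d1 + d2) := block_mx 0 A A^T 0.

Definition ht (M : 'M[R]_(d1 + d2)) : 'M[R]_(d1, d2) := ursubmx M.

(* [ln (2 d / delta)] with [d = max(d1, d2)] *)
Definition logterm (delta : R) : R := ln (2 * (maxn d1 d2)%:R / delta).

Definition one_sample (Q : 'M[R]_(d2 * d1)) (Theta0 : 'M[R]_(d1, d2))
    (z : 'M[R]_(d1, d2) * R) : 'cV[R]_(d2 * d1) :=
  (z.2 - inner Theta0 z.1) *: (invmx Q *m vec z.1).

Definition lowpopart_nu (sigma R0 delta : R) (Q : 'M[R]_(d2 * d1)) (m : nat) : R :=
  (sigma + R0)^-1 * Num.sqrt (2 / (BQ Q * m%:R) * logterm delta).

Definition lowpopart_Theta1 (sigma : R) (s : seq ('M[R]_(d1, d2) * R))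
    (Q : 'M[R]_(d2 * d1)) (Theta0 : 'M[R]_(d1, d2)) (R0 delta : R) :
    'M[R]_(d1, d2) :=
  let m := size s in
  let nu := lowpopart_nu sigma R0 delta Q m in
  Theta0 + ht ((m%:R * nu)^-1 *:
    \sum_(z <- s) phi (nu *: dilation (reshape (one_sample Q Theta0 z)))).

Definition lowpopart_threshold (sigma R0 delta : R) (Q : 'M[R]_(d2 * d1))
    (m : nat) : R :=
  2 * (R0 + sigma) * Num.sqrt (BQ Q * logterm delta / m%:R).

(* [Theta] is an output of LowPopArt; a relation, since any SVD may be taken. *)
Definition lowpopart (sigma : R) (s : seq ('M[R]_(d1, d2) * R))
    (Q : 'M[R]_(d2 * d1)) (Theta0 : 'M[R]_(d1, d2)) (R0 delta : R)
    (Theta : 'M[R]_(d1, d2)) : Prop :=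
  exists U S V,
    is_svd (lowpopart_Theta1 sigma s Q Theta0 R0 delta) U S V /\
    Theta = U *m threshold (lowpopart_threshold sigma R0 delta Q (size s)) S *m V^T.

Definition warm_lowpopart (sigma Rmax : R) (s : seq ('M[R]_(d1, d2) * R))
    (Q : 'M[R]_(d2 * d1)) (delta : R) (Theta : 'M[R]_(d1, d2)) : Prop :=
  exists Theta0,
    lowpopart sigma (take (size s)./2 s) Q 0 Rmax (delta / 2) Theta0 /\
    lowpopart sigma (drop (size s)./2 s) Q Theta0 sigma (delta / 2) Theta.

End LowPopArt.

(* Real matrices with their Borel sigma-algebra. *)
Definition borel_mx (R : realType) (m n : nat) :=
  g_sigma_algebraType (@open 'M[R]_(m, n)).

Definition covmx (R : realType) (d1 d2 : nat)
    (pi : probability (borel_mx R d1 d2) R) : 'M[R]_(d2 * d1) :=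
  \matrix_(i, j) fine 'E_pi[fun a : borel_mx R d1 d2 => (vec a i 0 * vec a j 0)%R]%E.

(* [pi] is a distribution on [A]. When [A] is measurable this is [pi A = 1];
   quantifying over measurable supersets avoids assuming [A] measurable. *)
Definition carried_by (d : measure_display) (T : measurableType d) (R : realType)
    (pi : probability T R) (A : set T) : Prop :=
  forall B : set T, measurable B -> A `<=` B -> pi B = 1%E.

Section Independence.
Context (d : measure_display) (T : measurableType d) (R : realType).
Variable P : probability T R.

Definition independent_pair (d1 d2 : measure_display)
    (T1 : measurableType d1) (T2 : measurableType d2)
    (X1 : T -> T1) (X2 : T -> T2) : Prop :=
  forall (B1 : set T1) (B2 : set T2), measurable B1 -> measurable B2 ->
    P (X1 @^-1` B1 `&` X2 @^-1` B2) = (P (X1 @^-1` B1) * P (X2 @^-1` B2))%E.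

Definition independent_family (I : finType) (d' : measure_display)
    (T' : measurableType d') (Z : I -> T -> T') : Prop :=
  forall (J : {set I}) (B : I -> set T'), (forall i, measurable (B i)) ->
    P (\bigcap_(i in [set` J]) (Z i @^-1` B i)) = (\prod_(i in J) P (Z i @^-1` B i))%E.

Definition identically_distributed (I : Type) (d' : measure_display)
    (T' : measurableType d') (Z : I -> T -> T') : Prop :=
  forall (i j : I) (B : set T'), measurable B -> P (Z i @^-1` B) = P (Z j @^-1` B).

Definition iid (I : finType) (d' : measure_display)
    (T' : measurableType d') (Z : I -> T -> T') : Prop :=
  independent_family Z /\ identically_distributed Z.

Definition subgaussian (sigma : R) (eta : T -> R) : Prop :=
  forall s : R, ('M_P eta s <= (expR (s ^+ 2 * sigma ^+ 2 / 2))%:E)%E.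

End Independence.

(* Main.v *)
(* For one run with pilot Theta0, let Z be the dilation of the one-sample estimator
   reshape (Q^-1 (Y - <Theta0, X>) vec X). As
     -ln(1-x+x^2/2) <= phi0 x <= ln(1+x+x^2/2),
   joint convexity of the relative entropy tr(X ln X - X ln W - X + W) gives
     E tr exp(H + phi(nu Z)) <= tr exp(H + nu E Z + (nu^2/2) E Z^2),
   where E Z is the dilation of Theta - Theta0 and E Z^2 <= (R0 + sigma)^2 B(Q).
   Compensating each step by the matrix on the right makes tr exp of the centred
   sum a supermartingale, and Markov's inequality bounds its largest eigenvalue.
   As phi is odd, the centred sum is a dilation up to a scalar matrix, so one side
   suffices for the operator norm. Thresholding at the error level keeps the rank
   at most r and at most doubles the error. After the first run the error has rank
   at most 2r and operator norm at most 2 tau1, so its inner product with an action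
   is at most 4 r tau1 <= sigma, which makes sigma a valid pilot error bound for
   the second run. Both runs form a single chain driven by the samples, whose
   pilot component is replaced at half time. *)
From Pilot Require Import Defs.
From HB Require Import structures.
From mathcomp Require Import all_boot all_order all_algebra.
From mathcomp Require Import all_classical all_reals all_analysis.
From mathcomp Require Import measurable_realfun complex.
From mathcomp Require Import ring lra.
Set Implicit Arguments.
Unset Strict Implicit.
Unset Printing Implicit Defensive.
Import Order.TTheory GRing.Theory Num.Theory.
Import numFieldNormedType.Exports.
Local Open Scope classical_set_scope.
Local Open Scope ring_scope.


(** * Spectral theorem and matrix functions *)

(** The algorithm may take any SVD, so its output is not a prescribed measurable function of the
    samples. The chain is therefore built from choice-free objects: matrix functions, measurable as
    limits of Lipschitz maps, and a spectral projection in place of the thresholded SVD. The good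
    event is expressed through the chain alone; on it every admissible output is controlled
    deterministically.

    No conditional expectation occurs. The current state is independent of the next sample, so a
    joint integral becomes an iterated one and a bound for each frozen state suffices. The price is
    that this bound must hold for all states, also for those never reached.

    Relative entropy is convenient because its convexity reduces to scalar inequalities: in the
    eigenbases of two noncommuting matrices, traces become double sums with nonnegative weights.
    Finite sums in place of an integral over the segment keep the averaging step linear.

    The truncation [phi0] grows logarithmically, so its exponential is at most quadratic. Hence two
    moments of the one-sample estimator are enough, although that estimator is unbounded. *)

Section Spectral.
Variable R : realType.

(** A real symmetric matrix is Hermitian over the complex numbers, where the spectral theorem yields
    a real diagonal. Being an eigenvalue is a root condition on the characteristic polynomial, and
    this descends to [R]. *)
Lemma symmetric_eigenvalue (n : nat) (A : 'M[R]_n) :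
  (0 < n)%N -> A^T = A -> exists a, eigenvalue A a.
Proof.
move=> n0 sA.
pose C : numClosedFieldType := complex R.
pose f : {rmorphism R -> C} := real_complex R.
have sB : map_mx f A \is symmetricmx.
  by apply/is_hermitianmxP; rewrite expr0 scale1r map_mx_id // map_trmx sA.
have rB : map_mx f A \is a mxOver Num.real.
  apply/mxOverP => i j; rewrite !mxE; by rewrite complex_real.
have hB := realsym_hermsym sB rB.
have /mxOverP rD := hermitian_spectral_diag_real hB.
have /orthomx_spectralP := hermitian_normalmx hB.
have := spectral_unit (map_mx f A).
move: (spectralmx _) (spectral_diag _) rD => Q D rD uQ eA.
pose i : 'I_n := Ordinal n0.
have [x xE] : exists x : R, D 0 i = f x.
  exists (complex.Re (D 0 i)); apply/esym/RRe_real; exact: rD.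
exists x; rewrite eigenvalue_root_char -(fmorph_root f) map_char_poly.
rewrite -xE -eigenvalue_root_char; apply/eigenvalueP; exists (row i Q).
  rewrite -row_mul {1}eA !mulmxA mulmxV // mul1mx.
  by apply/rowP => k; rewrite mul_diag_mx !mxE.
apply/negP => /eqP r0; move: uQ; rewrite -row_free_unit => /row_freeP [B QB].
have /matrixP/(_ i i) : Q *m B = 1%:M by [].
rewrite !mxE eqxx; under eq_bigr => j _.
  have -> : Q i j = 0 by move/rowP: r0 => /(_ j); rewrite !mxE.
  rewrite mul0r; over.
by rewrite big1 // => /eqP; rewrite eq_sym oner_eq0.
Qed.

Definition dot (n : nat) (u v : 'cV[R]_n) : R := (u^T *m v) 0 0.

Lemma dotE n (u v : 'cV[R]_n) : dot u v = \sum_i u i 0 * v i 0.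
Proof. by rewrite /dot mxE; apply: eq_bigr => i _; rewrite mxE. Qed.

Lemma dot_mx n (u v : 'cV[R]_n) : u^T *m v = (dot u v)%:M.
Proof. by rewrite [LHS]mx11_scalar. Qed.

Lemma dotC n (u v : 'cV[R]_n) : dot u v = dot v u.
Proof. by rewrite !dotE; apply: eq_bigr => i _; rewrite mulrC. Qed.

Lemma dotDl n (u v w : 'cV[R]_n) : dot (u + v) w = dot u w + dot v w.
Proof. by rewrite /dot linearD mulmxDl mxE. Qed.

Lemma dotDr n (u v w : 'cV[R]_n) : dot w (u + v) = dot w u + dot w v.
Proof. by rewrite dotC dotDl !(dotC w). Qed.

Lemma dotZl n a (u v : 'cV[R]_n) : dot (a *: u) v = a * dot u v.
Proof. by rewrite /dot linearZ -scalemxAl mxE. Qed.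

Lemma dotZr n a (u v : 'cV[R]_n) : dot u (a *: v) = a * dot u v.
Proof. by rewrite dotC dotZl dotC. Qed.

Lemma dotBl n (u v w : 'cV[R]_n) : dot (u - v) w = dot u w - dot v w.
Proof. by rewrite -scaleN1r dotDl dotZl mulN1r. Qed.

Lemma dotBr n (u v w : 'cV[R]_n) : dot w (u - v) = dot w u - dot w v.
Proof. by rewrite dotC dotBl !(dotC w). Qed.

Lemma dot_mull m n (A : 'M[R]_(m, n)) u v : dot (A *m u) v = dot u (A^T *m v).
Proof. by rewrite /dot trmx_mul mulmxA. Qed.

Lemma dotvv_ge0 n (u : 'cV[R]_n) : 0 <= dot u u.
Proof. by rewrite dotE sumr_ge0 // => i _; rewrite -expr2 sqr_ge0. Qed.

Lemma dotvv_eq0 n (u : 'cV[R]_n) : dot u u = 0 -> u = 0.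
Proof.
rewrite dotE => /eqP; rewrite psumr_eq0 => [|i _]; last by rewrite -expr2 sqr_ge0.
move=> /allP h; apply/colP => i; rewrite mxE; apply/eqP.
by have := h i (mem_index_enum i); rewrite mulf_eq0 orbb.
Qed.

Lemma dotvv_gt0 n (u : 'cV[R]_n) : u != 0 -> 0 < dot u u.
Proof.
move=> u0; rewrite lt_def dotvv_ge0 andbT; apply: contra u0 => /eqP h.
by apply/eqP/dotvv_eq0.
Qed.

Lemma orthogonal_mxC n (U : 'M[R]_n) : orthogonal_mx U -> U *m U^T = 1%:M.
Proof. by move=> /mulmx1C. Qed.

Lemma orthogonal_mx_tr n (U : 'M[R]_n) : orthogonal_mx U -> orthogonal_mx U^T.
Proof. by move=> /mulmx1C; rewrite /orthogonal_mx trmxK. Qed.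

Lemma orthogonal_mxM n (U V : 'M[R]_n) :
  orthogonal_mx U -> orthogonal_mx V -> orthogonal_mx (U *m V).
Proof.
by rewrite /orthogonal_mx => u v; rewrite trmx_mul mulmxA -(mulmxA V^T) u mulmx1.
Qed.

(** The deflation tool of [spectral]: it carries the first coordinate axis to an eigenvector. *)
Lemma householder n (e c : 'cV[R]_n) : dot e e = 1 -> dot c c = 1 ->
  exists H : 'M[R]_n, [/\ orthogonal_mx H, H *m e = c & H *m c = e].
Proof.
move=> e1 c1; have [->|ec] := eqVneq c e.
  by exists 1%:M; rewrite /orthogonal_mx trmx1 !mul1mx.
pose w := c - e; have w0 : 0 < dot w w by rewrite dotvv_gt0 // subr_eq0.
have wE : dot w w = 2 - 2 * dot c e.
  by rewrite /w !dotBr !dotBl e1 c1 (dotC e c); ring.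
(* [H] is the Householder reflection along [c - e]. *)
pose b := 2 / dot w w.
pose H := 1%:M - b *: (w *m w^T).
have HE u : H *m u = u - (b * dot w u) *: w.
  rewrite mulmxBl mul1mx -scalemxAl -mulmxA dot_mx mul_mx_scalar.
  by rewrite scalerA.
have Ht : H^T = H by rewrite /H linearB linearZ /= trmx_mul trmxK trmx1.
have He : H *m e = c.
  rewrite HE (_ : dot w e = dot c e - 1); last by rewrite dotBl e1.
  rewrite /b.
  suff -> : 2 / dot w w * (dot c e - 1) = -1 by rewrite scaleN1r opprK /w addrC subrK.
  by rewrite mulrAC; apply: canLR (mulfK _) _; rewrite ?gt_eqF// wE; ring.
have HH : H *m H = 1%:M.
  rewrite {2}/H mulmxBr mulmx1 -scalemxAr mulmxA HE.
  have -> : b * dot w w = 2 by rewrite /b divfK // gt_eqF.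
  have -> : w - 2 *: w = - w by rewrite scaler_nat mulr2n opprD addrA subrr sub0r.
  by rewrite mulNmx scalerN opprK /H subrK.
exists H; split => //; first by rewrite /orthogonal_mx Ht.
by rewrite -He mulmxA HH mul1mx.
Qed.

(** A complex unitary diagonalization does not directly provide real orthogonal eigenvectors, so
    only an eigenvalue is taken from it; a real eigenvector is split off and the induction treats
    its complement. *)
Theorem spectral n (A : 'M[R]_n) : A^T = A -> exists (U : 'M[R]_n) (l : 'rV[R]_n),
  orthogonal_mx U /\ A = U *m diag_mx l *m U^T.
Proof.
elim: n A => [|n IH] A sA.
  by exists 1%:M, 0; split; [rewrite /orthogonal_mx trmx1 mulmx1 | apply/matrixP => -[]].
have [a /eigenvalueP [v vA v0]] := symmetric_eigenvalue (ltn0Sn n) sA.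
have vt0 : v^T != 0 by rewrite trmx_eq0.
have nv := dotvv_gt0 vt0.
pose c := (Num.sqrt (dot v^T v^T))^-1 *: v^T.
have c1 : dot c c = 1.
  rewrite dotZl dotZr mulrA -invfM -expr2 sqr_sqrtr ?ltW // mulVf // gt_eqF //.
have Ac : A *m c = a *: c.
  by rewrite -scalemxAr -{1}sA -trmx_mul vA linearZ /= !scalerA mulrC.
pose e : 'cV[R]_(1 + n) := delta_mx 0 0.
have e1 : dot e e = 1.
  by rewrite /dot trmx_delta mul_delta_mx mxE.
have [H [oH He Hc]] := householder e1 c1.
pose B : 'M[R]_(1 + n) := H^T *m A *m H.
have sB : B^T = B by rewrite /B !trmx_mul trmxK sA mulmxA.
have Be : B *m e = a *: e.
  by rewrite -!mulmxA He Ac -scalemxAr -He (mulmxA H^T) oH mul1mx.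
have AE : A = H *m B *m H^T.
  by rewrite /B !mulmxA (orthogonal_mxC oH) mul1mx -mulmxA (orthogonal_mxC oH) mulmx1.
clearbody B.
have Bi0 i : B i 0 = a * (i == 0)%:R.
  have /colP/(_ i) := Be; rewrite -colE !mxE => ->.
  by rewrite andbT.
(* The first column is known from [Be]; symmetry then clears the rest of the first row. *)
have BE : B = block_mx a%:M 0 0 (drsubmx B).
  rewrite -[LHS]submxK; congr block_mx.
  - apply/matrixP => i j; rewrite !ord1 !mxE.
    by rewrite (_ : lshift n 0 = 0) ?Bi0; [rewrite !eqxx mulr1n mulr1|exact/val_inj].
  - apply/matrixP => i j; rewrite !ord1 !mxE -sB mxE.
    by rewrite (_ : lshift n 0 = 0) ?Bi0; [exact: mulr0|exact/val_inj].
  - apply/matrixP => i j; rewrite !ord1 !mxE.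
    by rewrite (_ : lshift n 0 = 0) ?Bi0; [exact: mulr0|exact/val_inj].
have sD : (drsubmx B)^T = drsubmx B by rewrite trmx_drsub sB.
have [U [l [oU DE]]] := IH _ sD.
pose V : 'M[R]_(1 + n) := block_mx 1%:M 0 0 U.
have oV : orthogonal_mx V.
  rewrite /orthogonal_mx /V tr_block_mx mulmx_block !trmx0 !mulmx0 !mul0mx trmx1.
  by rewrite mulmx1 !addr0 add0r oU -scalar_mx_block.
have key : B = V *m diag_mx (row_mx a%:M l) *m V^T.
  rewrite BE DE /V tr_block_mx diag_mx_row !mulmx_block !trmx0 !mulmx0 !mul0mx.
  rewrite trmx1 !mulmx1 !mul1mx ?mul0mx !addr0 !add0r ?mulmxA; congr block_mx; rewrite ?mul0mx //.
  by apply/matrixP => i j; rewrite !ord1 !mxE.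
exists (H *m V), (row_mx a%:M l); split; first exact: orthogonal_mxM.
by rewrite AE key trmx_mul !mulmxA.
Qed.

End Spectral.

Section MatrixFunctions.
Variable R : realType.
Implicit Types (n : nat) (f g : R -> R).

(** The body copies that of [phi], so that [phi] is convertible to [mxfun] at [phi0] and the
    calculus below applies to the algorithm as it stands. *)
Definition mxfun f n (M : 'M[R]_n) : 'M[R]_n :=
  get [set N : 'M[R]_n | exists (U : 'M[R]_n) (lam : 'rV[R]_n),
    [/\ orthogonal_mx U, M = U *m diag_mx lam *m U^T
      & N = U *m diag_mx (map_mx f lam) *m U^T]].

(** With [Q = U^T *m V] the hypothesis reads [(l i - g j) Q i j = 0]. Wherever [Q i j] is nonzero
    the two eigenvalues agree, so [f] may be applied on both sides. *)
Lemma mxfun_unique f n (U V : 'M[R]_n) (l g : 'rV[R]_n) :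
  orthogonal_mx U -> orthogonal_mx V ->
  U *m diag_mx l *m U^T = V *m diag_mx g *m V^T ->
  U *m diag_mx (map_mx f l) *m U^T = V *m diag_mx (map_mx f g) *m V^T.
Proof.
move=> oU oV E; pose Q := U^T *m V.
have QE : diag_mx l *m Q = Q *m diag_mx g.
  have := congr1 (fun X => U^T *m X *m V) E.
  by rewrite /Q !mulmxA oU mul1mx -!mulmxA oV mulmx1.
have QfE : diag_mx (map_mx f l) *m Q = Q *m diag_mx (map_mx f g).
  apply/matrixP => i j; move/matrixP/(_ i j): QE.
  rewrite !mul_diag_mx !mul_mx_diag !mxE mulrC => /eqP.
  rewrite -subr_eq0 -mulrBr mulf_eq0 => /orP[/eqP ->|].
    by rewrite mulr0 mul0r.
  by rewrite subr_eq0 => /eqP ->; rewrite mulrC.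
have := congr1 (fun X => U *m X *m V^T) QfE.
rewrite /Q !mulmxA (orthogonal_mxC oU) mul1mx => <-.
by rewrite -!mulmxA (orthogonal_mxC oV) mulmx1.
Qed.

Lemma mxfunE f n (A U : 'M[R]_n) (l : 'rV[R]_n) :
  orthogonal_mx U -> A = U *m diag_mx l *m U^T ->
  mxfun f A = U *m diag_mx (map_mx f l) *m U^T.
Proof.
move=> oU AE; rewrite /mxfun.
case: xgetP => [N _ [V [g [oV AE' ->]]]|/(_ (U *m diag_mx (map_mx f l) *m U^T))].
  by apply: mxfun_unique => //; rewrite -AE -AE'.
by case; exists U, l.
Qed.

Lemma diag_sym n (U : 'M[R]_n) (l : 'rV[R]_n) :
  (U *m diag_mx l *m U^T)^T = U *m diag_mx l *m U^T.
Proof. by rewrite !trmx_mul trmxK tr_diag_mx mulmxA. Qed.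

Lemma diag_mulmx n (U : 'M[R]_n) (l k : 'rV[R]_n) : orthogonal_mx U ->
  (U *m diag_mx l *m U^T) *m (U *m diag_mx k *m U^T) =
  U *m diag_mx (\row_i (l 0 i * k 0 i)) *m U^T.
Proof.
move=> oU; rewrite !mulmxA -(mulmxA _ U^T U) oU mulmx1 -(mulmxA U).
congr (_ *m _ *m _); apply/matrixP => i j; rewrite mul_diag_mx !mxE.
by case: eqP => [->|_]; rewrite ?mulr1n // !mulr0n mulr0.
Qed.

Lemma eigenvalue_diag n (A U : 'M[R]_n) (l : 'rV[R]_n) a :
  orthogonal_mx U -> A = U *m diag_mx l *m U^T ->
  eigenvalue A a <-> exists i, a = l 0 i.
Proof.
move=> oU AE; split => [/eigenvalueP [v vA v0]|[i ->]].
  have vU0 : v *m U != 0.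
    apply: contra v0 => /eqP h; rewrite -[v]mulmx1 -(orthogonal_mxC oU) mulmxA h.
    by rewrite mul0mx.
  have /rV0Pn [i hi] := vU0.
  exists i; have := congr1 (fun X => (X *m U) 0 i) vA.
  rewrite AE !mulmxA -(mulmxA _ U^T U) oU mulmx1 mul_mx_diag -scalemxAl !mxE.
  by move: hi; rewrite mxE mulrC => hi /(mulIf hi).
apply/eigenvalueP; exists (row i U^T).
  rewrite AE -row_mul !mulmxA oU mul1mx; apply/rowP => j.
  by rewrite mul_diag_mx !mxE.
apply/eqP => /(congr1 (fun X => X *m U)); rewrite -row_mul oU mul0mx.
by move/rowP/(_ i)/eqP; rewrite !mxE eqxx oner_eq0.
Qed.

Section Calculus.
Variables (n : nat) (A : 'M[R]_n).
Hypothesis sA : A^T = A.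

Lemma mxfun_sym f : (mxfun f A)^T = mxfun f A.
Proof.
by have [U [l [oU AE]]] := spectral sA; rewrite (mxfunE f oU AE) diag_sym.
Qed.

Lemma eq_mxfun f g : (forall a, eigenvalue A a -> f a = g a) -> mxfun f A = mxfun g A.
Proof.
have [U [l [oU AE]]] := spectral sA; rewrite (mxfunE f oU AE) (mxfunE g oU AE) => fg.
congr (_ *m diag_mx _ *m _); apply/rowP => i; rewrite !mxE fg //.
by apply/(eigenvalue_diag _ oU AE); exists i.
Qed.

Lemma mxfun_id : mxfun id A = A.
Proof.
have [U [l [oU AE]]] := spectral sA; rewrite (mxfunE _ oU AE) [RHS]AE.
by congr (_ *m diag_mx _ *m _); apply/rowP => i; rewrite !mxE.
Qed.

Lemma mxfun_cst c : mxfun (fun=> c) A = c%:M.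
Proof.
have [U [l [oU AE]]] := spectral sA; rewrite (mxfunE _ oU AE).
rewrite (_ : map_mx _ l = const_mx c); last by apply/rowP => i; rewrite !mxE.
by rewrite diag_const_mx mul_mx_scalar -scalemxAl (orthogonal_mxC oU) scalemx1.
Qed.

Lemma mxfunD f g : mxfun f A + mxfun g A = mxfun (fun x => f x + g x) A.
Proof.
have [U [l [oU AE]]] := spectral sA; rewrite !(mxfunE _ oU AE) -mulmxDl -mulmxDr.
by congr (_ *m _ *m _); rewrite -linearD; congr diag_mx; apply/rowP => i; rewrite !mxE.
Qed.

Lemma mxfunZ c f : c *: mxfun f A = mxfun (fun x => c * f x) A.
Proof.
have [U [l [oU AE]]] := spectral sA; rewrite !(mxfunE _ oU AE) scalemxAl scalemxAr.
by congr (_ *m _ *m _); rewrite -linearZ; congr diag_mx; apply/rowP => i; rewrite !mxE.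
Qed.

Lemma mxfunM f g : mxfun f A *m mxfun g A = mxfun (fun x => f x * g x) A.
Proof.
have [U [l [oU AE]]] := spectral sA; rewrite !(mxfunE _ oU AE) diag_mulmx //.
by congr (_ *m diag_mx _ *m _); apply/rowP => i; rewrite !mxE.
Qed.

Lemma mxfun_comp f g : mxfun f (mxfun g A) = mxfun (f \o g) A.
Proof.
have [U [l [oU AE]]] := spectral sA; rewrite (mxfunE (f \o g) oU AE).
rewrite (mxfunE f oU (mxfunE g oU AE)).
by congr (_ *m diag_mx _ *m _); apply/rowP => i; rewrite !mxE.
Qed.

Lemma eigenvalue_mxfun f a :
  eigenvalue (mxfun f A) a <-> exists2 b, eigenvalue A b & a = f b.
Proof.
have [U [l [oU AE]]] := spectral sA.
rewrite (eigenvalue_diag _ oU (mxfunE f oU AE)); split => [[k]|[b]].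
  rewrite mxE => ->; exists (l 0 k) => //.
  by apply/(eigenvalue_diag _ oU AE); exists k.
by rewrite (eigenvalue_diag _ oU AE) => -[i ->] ->; exists i; rewrite mxE.
Qed.

Lemma mxfun_conj f (J : 'M[R]_n) : orthogonal_mx J ->
  mxfun f (J *m A *m J^T) = J *m mxfun f A *m J^T.
Proof.
move=> oJ; have [U [l [oU AE]]] := spectral sA; rewrite (mxfunE _ oU AE).
rewrite (@mxfunE f _ _ (J *m U) l) //; first by rewrite trmx_mul !mulmxA.
  exact: orthogonal_mxM.
by rewrite AE trmx_mul !mulmxA.
Qed.

Lemma mxfunN f : mxfun f (- A) = mxfun (fun x => f (- x)) A.
Proof.
rewrite -[in LHS]mxfun_id -scaleN1r mxfunZ mxfun_comp; apply: eq_mxfun => a _ /=.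
by rewrite mulN1r.
Qed.

End Calculus.

Lemma dot_diag n (U : 'M[R]_n) (l : 'rV[R]_n) u :
  dot u (U *m diag_mx l *m U^T *m u) = \sum_i l 0 i * ((U^T *m u) i 0) ^+ 2.
Proof.
rewrite -!mulmxA -[X in dot u (X *m _)](trmxK U) -dot_mull dotE.
by apply: eq_bigr => i _; rewrite mul_diag_mx !mxE expr2 mulrCA.
Qed.

Lemma dot_orthogonal n (U : 'M[R]_n) u v : orthogonal_mx U ->
  dot (U *m u) (U *m v) = dot u v.
Proof. by move=> oU; rewrite dot_mull mulmxA oU mul1mx. Qed.

(** The Loewner order. Through quadratic forms it makes sense without carrying symmetry along. *)
Definition lmx n (A B : 'M[R]_n) := forall u, dot u (A *m u) <= dot u (B *m u).

Lemma mxfun_le n (A : 'M[R]_n) f g : A^T = A ->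
  (forall a, eigenvalue A a -> f a <= g a) -> lmx (mxfun f A) (mxfun g A).
Proof.
move=> sA fg u; have [U [l [oU AE]]] := spectral sA.
rewrite !(mxfunE _ oU AE) !dot_diag ler_sum // => i _; rewrite ler_wpM2r ?sqr_ge0 //.
by rewrite !mxE fg //; apply/(eigenvalue_diag _ oU AE); exists i.
Qed.

Lemma eigenvector n (A : 'M[R]_n) a : A^T = A -> eigenvalue A a ->
  exists2 u : 'cV[R]_n, dot u u != 0 & A *m u = a *: u.
Proof.
move=> sA /eigenvalueP [v vA v0]; exists v^T.
  by rewrite gt_eqF // dotvv_gt0 // trmx_eq0.
by rewrite -[in LHS]sA -trmx_mul vA linearZ.
Qed.

Lemma lmx_eigenvalue_ge n (A : 'M[R]_n) c a : A^T = A -> lmx c%:M A -> eigenvalue A a -> c <= a.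
Proof.
move=> sA cA /(eigenvector sA) [u u0 uE].
have := cA u; rewrite uE dotZr mul_scalar_mx dotZr ler_pM2r //.
by rewrite lt_def u0 dotvv_ge0.
Qed.

Lemma lmx_eigenvalue_le n (A : 'M[R]_n) c a : A^T = A -> lmx A c%:M -> eigenvalue A a -> a <= c.
Proof.
move=> sA cA /(eigenvector sA) [u u0 uE].
have := cA u; rewrite uE dotZr mul_scalar_mx dotZr ler_pM2r //.
by rewrite lt_def u0 dotvv_ge0.
Qed.

Lemma eigenvalue_le_lmx n (A : 'M[R]_n) c : A^T = A ->
  (forall a, eigenvalue A a -> a <= c) -> lmx A c%:M.
Proof.
by move=> sA h; rewrite -[A](mxfun_id sA) -(mxfun_cst sA c); apply: mxfun_le.
Qed.

(** The weights are the squared overlaps of the two eigenbases. Their nonnegativity is what lets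
    scalar inequalities pass to matrices that do not commute. *)
Lemma tr_mxfun_mul n (A B U V : 'M[R]_n) (l g : 'rV[R]_n) f h :
  orthogonal_mx U -> A = U *m diag_mx l *m U^T ->
  orthogonal_mx V -> B = V *m diag_mx g *m V^T ->
  \tr (mxfun f A *m mxfun h B) =
  \sum_i \sum_j ((U^T *m V) i j) ^+ 2 * (f (l 0 i) * h (g 0 j)).
Proof.
move=> oU AE oV BE; rewrite (mxfunE _ oU AE) (mxfunE _ oV BE) -!mulmxA (mxtrace_mulC U).
set D := diag_mx _; set G := diag_mx _.
have -> : D *m (U^T *m (V *m (G *m V^T))) *m U =
    D *m ((U^T *m V) *m (G *m (U^T *m V)^T)) by rewrite trmx_mul trmxK !mulmxA.
rewrite /mxtrace.
apply: eq_bigr => i _; rewrite mul_diag_mx !mxE mulr_sumr; apply: eq_bigr => j _.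
by rewrite mul_diag_mx !mxE; ring.
Qed.

(** Klein's inequality: after expansion in the two eigenbases, each pair of eigenvalues contributes
    the scalar expression times a nonnegative weight. *)
Lemma klein n (I : finType) (f h : I -> R -> R) (A B : 'M[R]_n) :
  A^T = A -> B^T = B ->
  (forall x y, eigenvalue A x -> eigenvalue B y -> 0 <= \sum_k f k x * h k y) ->
  0 <= \sum_k \tr (mxfun (f k) A *m mxfun (h k) B).
Proof.
move=> sA sB H.
have [U [l [oU AE]]] := spectral sA; have [V [g [oV BE]]] := spectral sB.
under eq_bigr do rewrite (tr_mxfun_mul _ _ oU AE oV BE).
rewrite exchange_big /=; apply: sumr_ge0 => i _.
rewrite exchange_big /=; apply: sumr_ge0 => j _.
rewrite -mulr_sumr mulr_ge0 ?sqr_ge0 //; apply: H.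
  by apply/(eigenvalue_diag _ oU AE); exists i.
by apply/(eigenvalue_diag _ oV BE); exists j.
Qed.

Lemma tr_mxfun_lmx n (A B C : 'M[R]_n) f : A^T = A ->
  (forall a, eigenvalue A a -> 0 <= f a) -> lmx B C ->
  \tr (mxfun f A *m B) <= \tr (mxfun f A *m C).
Proof.
move=> sA f0 BC; have [U [l [oU AE]]] := spectral sA.
have E D : \tr (mxfun f A *m D) =
    \sum_i f (l 0 i) * dot (col i U) (D *m col i U).
  rewrite (mxfunE _ oU AE) -!mulmxA (mxtrace_mulC U) -!mulmxA /mxtrace.
  apply: eq_bigr => i _; rewrite mul_diag_mx !mxE; congr (_ * _).
  rewrite dotE; apply: eq_bigr => j _; rewrite !mxE; congr (_ * _).
  by apply: eq_bigr => k _; rewrite !mxE.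
rewrite !E ler_sum // => i _; rewrite ler_wpM2l //.
by apply: f0; apply/(eigenvalue_diag _ oU AE); exists i.
Qed.

End MatrixFunctions.

(** * Convexity of the matrix relative entropy *)

Section TraceInequalities.
Variable R : realType.
Implicit Types (n : nat).

Lemma ln_le_subr1 (t : R) : 0 < t -> ln t <= t - 1.
Proof. by move=> t0; rewrite -{1}(subrK 1 t) addrC le_ln1Dx // ltrBrDr addNr. Qed.

Lemma ln_ratio_le (x y : R) : 0 < x -> 0 < y -> ln x - ln y <= (x - y) / y.
Proof.
move=> x0 y0; rewrite -ln_div ?posrE // mulrBl divff ?gt_eqF //.
by rewrite ln_le_subr1 // divr_gt0.
Qed.

(** This is [1 + t <= expR t] at [t = b - ln x], multiplied by [x]; at [x = 0] the left side
    vanishes. *)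
Lemma gibbs_scalar (x b : R) : 0 <= x -> x + x * (b - ln x) <= expR b.
Proof.
rewrite le0r => /orP[/eqP ->|x0]; first by rewrite mul0r addr0 expR_ge0.
have -> : expR b = x * expR (b - ln x).
  by rewrite expRB lnK ?posrE // mulrCA divff ?gt_eqF // mulr1.
by rewrite -[X in X + _]mulr1 -mulrDr ler_wpM2l ?expR_ge1Dx // ltW.
Qed.

Definition xlnx (x : R) : R := x * ln x.

(** The Gibbs variational principle: the left side, as a function of [X], is maximal at
    [X = exp B]. *)
Lemma gibbs n (X B : 'M[R]_n) : X^T = X -> B^T = B ->
  (forall a, eigenvalue X a -> 0 <= a) ->
  \tr X + \tr (X *m B) - \tr (mxfun xlnx X) <= \tr (mxfun expR B).
Proof.
move=> sX sB X0.
(* The four products encode [expR y - x - x y + x ln x], with the variables separated. *)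
have := @klein R n 'I_4 (fun k => nth id [:: fun=> 1; id; id; xlnx] k)
  (fun k => nth id [:: expR; fun=> -1; -%R; fun=> 1] k) X B sX sB.
rewrite !big_ord_recl big_ord0 /= !mxfun_cst // !mxfun_id //.
rewrite (_ : mxfun -%R B = - B); last first.
  by rewrite -[in RHS](mxfun_id sB) -scaleN1r mxfunZ //; apply: eq_mxfun => // a _; rewrite mulN1r.
rewrite mul1mx mulmxN !mul_mx_scalar scaleN1r scale1r !linearN /= => h.
rewrite -subr_ge0; apply: le_trans (h _) _; last by rewrite le_eqVlt; apply/orP; left; apply/eqP; ring.
move=> x y xX yB; rewrite !big_ord_recl big_ord0 /=.
by have := gibbs_scalar y (X0 _ xX); rewrite /xlnx; lra.
Qed.

(** The exponential is not monotone for the Loewner order, but its trace is: in [gibbs] for [C], the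
    choice [X = exp B] leaves the nonnegative remainder [tr (exp B (C - B))]. *)
Lemma tr_exp_le n (B C : 'M[R]_n) : B^T = B -> C^T = C -> lmx B C ->
  \tr (mxfun expR B) <= \tr (mxfun expR C).
Proof.
move=> sB sC BC.
have e0 a : eigenvalue (mxfun expR B) a -> 0 <= a.
  by move=> /(eigenvalue_mxfun sB) [b _ ->]; exact: expR_ge0.
have := gibbs (mxfun_sym sB expR) sC e0.
have -> : mxfun xlnx (mxfun expR B) = mxfun expR B *m B.
  rewrite mxfun_comp // -[B in RHS](mxfun_id sB) (mxfun_comp sB expR id) mxfunM //.
  by apply: eq_mxfun => // a _; rewrite /= /xlnx expRK.
have := @tr_mxfun_lmx _ _ _ _ _ expR sB (fun a _ => expR_ge0 a) BC.
lra.
Qed.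

Definition relent_scalar (x y : R) : R := xlnx x - x * ln y - x + y.

Definition node (N k : nat) : R := k%:R / N.+1%:R.

Section RelentScalar.
Variables (x y : R) (N : nat).
Hypotheses (x0 : 0 <= x) (y0 : 0 < y).

(* The relative entropy is the telescoping sum of the increments of [G] along
   the subdivision [z] of the segment from [y] to [x]; bounding each of them by
   [ln t <= t - 1] replaces the usual integral representation. *)
Let z (k : nat) : R := node N k * x + (1 - node N k) * y.
Let G (k : nat) : R := x * ln (z k) - z k.

Let z_gt0 k : (k < N.+1)%N -> 0 < z k.
Proof.
move=> kN; have k1 : node N k < 1 by rewrite /node ltr_pdivrMr // mul1r ltr_nat.
have k0 : 0 <= node N k by rewrite /node divr_ge0 // ler0n.
by rewrite /z ltr_wpDl ?mulr_ge0 // mulr_gt0 // subr_gt0.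
Qed.

Let zS k : z k.+1 - z k = (x - y) / N.+1%:R.
Proof. rewrite /z /node -natr1; field; by rewrite gt_eqF. Qed.

Let zx k : x - z k = (1 - node N k) * (x - y).
Proof. by rewrite /z; ring. Qed.

Let telescope : relent_scalar x y = \sum_(k < N.+1) (G k.+1 - G k).
Proof.
rewrite -(big_mkord xpredT (fun k => G k.+1 - G k)) telescope_sumr //.
rewrite /G /z /node mul0r divff ?gt_eqF // subrr !mul0r !mul1r add0r addr0 subr0 mul1r.
by rewrite /relent_scalar /xlnx; ring.
Qed.

(** A right-endpoint Riemann sum of [(1 - s) (x - y)^2 / (s x + (1 - s) y)], whose integral over the
    unit interval is the relative entropy and which decreases in [s]. The node [s = 1] is left out:
    there [z = x] may be [0], so the last increment is only bounded below by [0]. *)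
Lemma relent_scalar_ge :
  N.+1%:R^-1 * \sum_(k < N) (1 - node N k.+1) * (x - y) ^+ 2 /
    (node N k.+1 * x + (1 - node N k.+1) * y) <= relent_scalar x y.
Proof.
rewrite telescope big_ord_recr /= -[leLHS]addr0 lerD //; last first.
  have zN : z N.+1 = x by rewrite /z /node divff ?gt_eqF // subrr mul0r addr0 mul1r.
  rewrite /G zN.
  have := z_gt0 (ltnSn N); set w := z N => w0.
  move: x0; rewrite le0r => /orP[/eqP ->|xp]; first by rewrite !mul0r; lra.
  have := ln_ratio_le w0 xp; rewrite ler_pdivlMr //.
  nra.
rewrite mulr_sumr ler_sum // => k _.
have zk0 : 0 < z k by apply: z_gt0; rewrite ltnW // ltnS.
have zk1 : 0 < z k.+1 by apply: z_gt0; rewrite ltnS.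
rewrite /G -/(z k.+1).
have -> : N.+1%:R^-1 * ((1 - node N k.+1) * (x - y) ^+ 2 / z k.+1) =
   (x - z k.+1) / z k.+1 * (z k.+1 - z k).
  by rewrite zx zS; ring.
have h := ler_wpM2l x0 (ln_ratio_le zk0 zk1).
have -> : (x - z k.+1) / z k.+1 * (z k.+1 - z k) =
  - (x * ((z k - z k.+1) / z k.+1)) - (z k.+1 - z k).
  by field; rewrite gt_eqF.
by move: h; lra.
Qed.

(** The left-endpoint sum of the same decreasing integrand. It exceeds the right-endpoint sum by the
    single term at [s = 0], which is of order [1/N]. *)
Lemma relent_scalar_le : relent_scalar x y <=
  N.+1%:R^-1 * \sum_(k < N) (1 - node N k.+1) * (x - y) ^+ 2 /
    (node N k.+1 * x + (1 - node N k.+1) * y) + (x - y) ^+ 2 / y / N.+1%:R.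
Proof.
have -> : (x - y) ^+ 2 / y / N.+1%:R = N.+1%:R^-1 * ((1 - node N 0) * (x - y) ^+ 2 / z 0).
  by rewrite /z /node !mul0r subr0 !mul1r add0r mulrC.
pose F (k : nat) := (1 - node N k) * (x - y) ^+ 2 / z k.
have FE : F 0 + \sum_(k < N) F k.+1 = \sum_(k < N.+1) F k by rewrite big_ord_recl.
rewrite -mulrDr addrC -/(F 0) [X in _ * X]FE /F.
rewrite telescope mulr_sumr ler_sum // => k _.
have zk0 : 0 < z k by exact: z_gt0.
have -> : N.+1%:R^-1 * ((1 - node N k) * (x - y) ^+ 2 / z k) =
   x * ((z k.+1 - z k) / z k) - (z k.+1 - z k).
  have -> : x * ((z k.+1 - z k) / z k) - (z k.+1 - z k) =
    (x - z k) / z k * (z k.+1 - z k) by field; rewrite gt_eqF.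
  by rewrite zx zS; ring.
rewrite /G; move: (x0); rewrite le0r => /orP[/eqP xz|xp]; first by rewrite xz !mul0r; lra.
have zk1 : 0 < z k.+1.
  have [kN|kN] := ltnP k.+1 N.+1; first exact: z_gt0.
  have -> : k.+1 = N.+1 by apply/eqP; rewrite eqn_leq kN ltn_ord.
  by rewrite /z /node divff ?gt_eqF // subrr mul0r addr0 mul1r.
have h := ler_wpM2l x0 (ln_ratio_le zk1 zk0).
move: h; lra.
Qed.

End RelentScalar.

End TraceInequalities.

Section RelativeEntropy.
Variable R : realType.
Implicit Types (n : nat) (s : R).

Definition relent n (X W : 'M[R]_n) : R :=
  \tr (mxfun (@xlnx R) X) - \tr (X *m mxfun (@ln R) W) - \tr X + \tr W.

(* Linear in [(X, W)] for fixed [K]: by [relent_ge] and [relent_le], [relent] is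
   up to O(1/N) a supremum of nonnegative combinations of such functions, hence
   jointly convex. *)
Definition lmix s n (K X W : 'M[R]_n) : R :=
  2 * \tr (K^T *m (X - W)) - s * \tr (K^T *m X *m K) - (1 - s) * \tr (K *m W *m K^T).

Lemma mxtrace_congr_diag m n (K : 'M[R]_(m, n)) (x : 'rV[R]_m) (K' : 'M[R]_(m, n)) :
  \tr (K^T *m (diag_mx x *m K')) = \sum_i \sum_j x 0 i * (K i j * K' i j).
Proof.
rewrite exchange_big /= /mxtrace; apply: eq_bigr => j _.
by rewrite mxE; apply: eq_bigr => i _; rewrite mul_diag_mx !mxE mulrCA.
Qed.

Section Eigenbases.
Variables (n : nat) (X W U V : 'M[R]_n) (x y : 'rV[R]_n).
Hypotheses (oU : orthogonal_mx U) (XE : X = U *m diag_mx x *m U^T).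
Hypotheses (oV : orthogonal_mx V) (WE : W = V *m diag_mx y *m V^T).

Lemma relentE :
  relent X W = \sum_i \sum_j ((U^T *m V) i j) ^+ 2 * relent_scalar (x 0 i) (y 0 j).
Proof.
have sX : X^T = X by rewrite XE diag_sym.
have sW : W^T = W by rewrite WE diag_sym.
have E f h := tr_mxfun_mul f h oU XE oV WE.
have -> : relent X W = \tr (mxfun (@xlnx R) X *m mxfun (fun=> 1) W)
   - \tr (mxfun id X *m mxfun (@ln R) W) - \tr (mxfun id X *m mxfun (fun=> 1) W)
   + \tr (mxfun (fun=> 1) X *m mxfun id W).
  by rewrite !mxfun_id // !mxfun_cst // !mulmx1 mul1mx.
rewrite !E -!sumrB -big_split /=; apply: eq_bigr => i _.
rewrite -!sumrB -big_split /=; apply: eq_bigr => j _.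
by rewrite /relent_scalar; ring.
Qed.

(** In the eigenbases [lmix] decouples into one quadratic per entry of [K]. With [P = U^T *m V] and
    [z = s x_i + (1 - s) y_j > 0], its maximum [P_ij^2 (x_i - y_j)^2 / z] is a node term of the
    scalar Riemann sum. *)
Lemma lmixE s (K : 'M[R]_n) : lmix s (U *m K *m V^T) X W =
  \sum_i \sum_j (2 * K i j * (U^T *m V) i j * (x 0 i - y 0 j)
     - (K i j) ^+ 2 * (s * x 0 i + (1 - s) * y 0 j)).
Proof.
set P := U^T *m V.
have uX : U^T *m X = diag_mx x *m U^T by rewrite XE !mulmxA oU mul1mx.
have vW : W *m V = V *m diag_mx y by rewrite WE -!mulmxA oV mulmx1.
have t1 : \tr ((U *m K *m V^T)^T *m X) = \tr (K^T *m (diag_mx x *m P)).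
  by rewrite !trmx_mul trmxK -!mulmxA uX (mxtrace_mulC V) -!mulmxA.
have t2 : \tr ((U *m K *m V^T)^T *m W) = \tr (K *m (diag_mx y *m P^T)).
  rewrite !trmx_mul trmxK WE -!mulmxA (mxtrace_mulC V) -!mulmxA oV mulmx1.
  rewrite -mxtrace_tr !trmx_mul !trmxK tr_diag_mx /P ?trmx_mul ?trmxK.
  by rewrite -!mulmxA [RHS](mxtrace_mulC K) -!mulmxA.
have t3 : \tr ((U *m K *m V^T)^T *m X *m (U *m K *m V^T)) = \tr (K^T *m (diag_mx x *m K)).
  rewrite !trmx_mul trmxK -!mulmxA (mxtrace_mulC V) -!mulmxA oV mulmx1.
  by rewrite (mulmxA U^T) uX -!mulmxA (mulmxA U^T) oU mul1mx.
have t4 : \tr ((U *m K *m V^T) *m W *m (U *m K *m V^T)^T) = \tr (K *m (diag_mx y *m K^T)).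
  rewrite !trmx_mul trmxK -!mulmxA (mxtrace_mulC U) -!mulmxA oU mulmx1.
  by rewrite (mulmxA W) vW -!mulmxA (mulmxA V^T) oV mul1mx.
rewrite /lmix mulmxBr linearB /= t1 t2 t3 t4.
rewrite -[K in \tr (K *m (diag_mx y *m P^T))]trmxK.
rewrite -[K in \tr (K *m (diag_mx y *m K^T))]trmxK !mxtrace_congr_diag.
rewrite [X in _ * (_ - X)]exchange_big [X in _ - _ * X]exchange_big /=.
rewrite mulrBr !mulr_sumr -!sumrB; apply: eq_bigr => i _.
rewrite !mulr_sumr -!sumrB; apply: eq_bigr => j _.
by rewrite !mxE; ring.
Qed.

End Eigenbases.

Variables (n : nat) (X W : 'M[R]_n).
Hypotheses (sX : X^T = X) (sW : W^T = W).
Hypotheses (X0 : forall a, eigenvalue X a -> 0 <= a).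
Hypotheses (W0 : forall a, eigenvalue W a -> 0 < a).

Let node_itv N k : (k < N)%N -> 0 < node R N k.+1 < 1.
Proof.
move=> kN; rewrite /node divr_gt0 ?ltr0n //= ltr_pdivrMr ?ltr0n //.
by rewrite mul1r ltr_nat.
Qed.

Lemma relent_ge (N : nat) (K : nat -> 'M[R]_n) :
  N.+1%:R^-1 * \sum_(k < N) (1 - node R N k.+1) * lmix (node R N k.+1) (K k) X W
    <= relent X W.
Proof.
have [U [x [oU XE]]] := spectral sX; have [V [y [oV WE]]] := spectral sW.
rewrite (relentE oU XE oV WE).
have KE k : K k = U *m (U^T *m K k *m V) *m V^T.
  by rewrite !mulmxA orthogonal_mxC // mul1mx -mulmxA orthogonal_mxC // mulmx1.
under eq_bigr do rewrite {1}KE (lmixE oU XE oV WE) mulr_sumr.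
rewrite exchange_big /= mulr_sumr; apply: ler_sum => i _.
under eq_bigr do rewrite mulr_sumr.
rewrite exchange_big /= mulr_sumr; apply: ler_sum => j _.
have xi : 0 <= x 0 i by apply: X0; apply/(eigenvalue_diag _ oU XE); exists i.
have yj : 0 < y 0 j by apply: W0; apply/(eigenvalue_diag _ oV WE); exists j.
apply: le_trans (ler_wpM2l (sqr_ge0 _) (relent_scalar_ge N xi yj)).
rewrite mulrCA ler_wpM2l ?invr_ge0 ?ler0n // mulr_sumr ler_sum // => k _.
have /andP[n0 n1] := node_itv (ltn_ord k).
set s := node R N k.+1 in n0 n1 *; set p := (U^T *m V) i j.
set q := (U^T *m K k *m V) i j.
have z0 : 0 < s * x 0 i + (1 - s) * y 0 j.
  by rewrite ltr_wpDl ?mulr_ge0 ?(ltW n0) // mulr_gt0 // subr_gt0.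
set z := s * x 0 i + _ in z0 *.
have -> : p ^+ 2 * ((1 - s) * (x 0 i - y 0 j) ^+ 2 / z) =
  (1 - s) * (p ^+ 2 * (x 0 i - y 0 j) ^+ 2 / z) by ring.
rewrite ler_wpM2l ?subr_ge0 ?(ltW n1) // ler_pdivlMr //.
(* Completing the square: an arbitrary [q] does no better than the optimal entry
   [p (x_i - y_j) / z]. *)
have := sqr_ge0 (q * z - p * (x 0 i - y 0 j)).
nra.
Qed.

(** The constant [c] is fixed before [N], so the error vanishes as [N] grows; only the matrices [K]
    follow [N]. *)
Lemma relent_le : exists c : R, forall N : nat, exists K : nat -> 'M[R]_n,
  relent X W <= N.+1%:R^-1 *
    (\sum_(k < N) (1 - node R N k.+1) * lmix (node R N k.+1) (K k) X W) + c / N.+1%:R.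
Proof.
have [U [x [oU XE]]] := spectral sX; have [V [y [oV WE]]] := spectral sW.
pose P := U^T *m V.
exists (\sum_i \sum_j P i j ^+ 2 * ((x 0 i - y 0 j) ^+ 2 / y 0 j)) => N.
pose z k i j := node R N k.+1 * x 0 i + (1 - node R N k.+1) * y 0 j.
(* The entrywise maximizers of [lmix]. *)
pose K k := \matrix_(i, j) (P i j * (x 0 i - y 0 j) / z k i j).
exists (fun k => U *m K k *m V^T).
under [X in _ <= _ * X + _]eq_bigr do rewrite (lmixE oU XE oV WE) mulr_sumr.
rewrite exchange_big /= mulr_sumr mulr_suml -big_split /= (relentE oU XE oV WE).
apply: ler_sum => i _.
under [X in _ <= _ * X + _]eq_bigr do rewrite mulr_sumr.
rewrite exchange_big /= mulr_sumr mulr_suml -big_split /=; apply: ler_sum => j _.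
have xi : 0 <= x 0 i by apply: X0; apply/(eigenvalue_diag _ oU XE); exists i.
have yj : 0 < y 0 j by apply: W0; apply/(eigenvalue_diag _ oV WE); exists j.
apply: le_trans (ler_wpM2l (sqr_ge0 _) (relent_scalar_le N xi yj)) _.
rewrite mulrDr mulrA lerD //; last by rewrite !mulrA.
rewrite mulrCA ler_wpM2l ?invr_ge0 ?ler0n // mulr_sumr ler_sum // => k _.
rewrite -/P -/(z k i j) (_ : K k i j = P i j * (x 0 i - y 0 j) / z k i j); last by rewrite mxE.
have /andP[n0 n1] := node_itv (ltn_ord k).
have z0 : 0 < z k i j.
  by rewrite ltr_wpDl ?mulr_ge0 ?(ltW n0) // mulr_gt0 // subr_gt0.
rewrite le_eqVlt; apply/orP; left; apply/eqP.
move: (z k i j) (P i j) z0 => w p z0; field; by rewrite gt_eqF.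
Qed.

End RelativeEntropy.

(** * Exponential moments of truncated random matrices *)

Section Mean.
Context d (T : measurableType d) (R : realType) (P : probability T R).
Implicit Types (f g : T -> R).

Definition L1 f : Prop := P.-integrable setT (EFin \o f).

Definition mean f : R := (\int[P]_w f w)%R.

Lemma L1_measurable f : L1 f -> measurable_fun setT f.
Proof. by move=> /measurable_int /measurable_EFinP. Qed.

Lemma L1_cst c : L1 (fun=> c).
Proof. exact: (finite_measure_integrable_cst P c). Qed.

Lemma L1D f g : L1 f -> L1 g -> L1 (fun w => f w + g w).
Proof. by move=> hf hg; exact: (integrableD measurableT hf hg). Qed.

Lemma L1Z c f : L1 f -> L1 (fun w => c * f w).
Proof. by move=> hf; exact: (integrableZl measurableT c hf). Qed.

Lemma L1B f g : L1 f -> L1 g -> L1 (fun w => f w - g w).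
Proof. by move=> hf hg; exact: (integrableB measurableT hf hg). Qed.

Lemma L1_sum (I : Type) (s : seq I) (h : I -> T -> R) :
  (forall i, L1 (h i)) -> L1 (fun w => \sum_(i <- s) h i w).
Proof.
move=> hh; elim: s => [|i s IH].
  by under eq_fun do rewrite big_nil; exact: L1_cst.
by under eq_fun do rewrite big_cons; exact: L1D.
Qed.

Lemma L1_le f g : measurable_fun setT f -> (forall w, `|f w| <= g w) -> L1 g -> L1 f.
Proof.
move=> mf fg; apply: le_integrable => //; first exact/measurable_EFinP.
by move=> w _; rewrite lee_fin (le_trans (fg w)) // ler_norm.
Qed.

Lemma mean_cst c : mean (fun=> c) = c.
Proof.
rewrite /mean Rintegral_cst // -[RHS]mulr1 -[1]/(fine 1%E); congr (_ * fine _).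
exact: probability_setT.
Qed.

Lemma meanD f g : L1 f -> L1 g -> mean (fun w => f w + g w) = mean f + mean g.
Proof. by move=> hf hg; exact: RintegralD. Qed.

Lemma meanB f g : L1 f -> L1 g -> mean (fun w => f w - g w) = mean f - mean g.
Proof. by move=> hf hg; exact: RintegralB. Qed.

Lemma meanZ c f : L1 f -> mean (fun w => c * f w) = c * mean f.
Proof. by move=> hf; exact: RintegralZl. Qed.

Lemma mean_le f g : L1 f -> L1 g -> (forall w, f w <= g w) -> mean f <= mean g.
Proof. by move=> hf hg fg; apply: le_Rintegral. Qed.

Lemma mean_sum (I : Type) (s : seq I) (h : I -> T -> R) :
  (forall i, L1 (h i)) -> mean (fun w => \sum_(i <- s) h i w) = \sum_(i <- s) mean (h i).
Proof.
move=> hh; elim: s => [|i s IH].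
  by under eq_fun do rewrite big_nil; rewrite mean_cst big_nil.
under eq_fun do rewrite big_cons; rewrite meanD //; last exact: L1_sum.
by rewrite IH big_cons.
Qed.

Lemma integral_mean f : L1 f -> (\int[P]_w (f w)%:E = (mean f)%:E)%E.
Proof. by move=> hf; rewrite /mean /Rintegral fineK //; exact: integrable_fin_num. Qed.

Definition L1mx m n (X : T -> 'M[R]_(m, n)) := forall i j, L1 (fun w => X w i j).

Definition meanmx m n (X : T -> 'M[R]_(m, n)) : 'M[R]_(m, n) :=
  \matrix_(i, j) mean (fun w => X w i j).

Lemma L1_tr n (K : 'M[R]_n) (X : T -> 'M[R]_n) : L1mx X -> L1 (fun w => \tr (K *m X w)).
Proof.
move=> hX; apply: L1_sum => i.
by under eq_fun do rewrite mxE; apply: L1_sum => j; exact: L1Z.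
Qed.

Lemma mean_tr n (K : 'M[R]_n) (X : T -> 'M[R]_n) : L1mx X ->
  mean (fun w => \tr (K *m X w)) = \tr (K *m meanmx X).
Proof.
move=> hX; rewrite mean_sum => [|i]; last first.
  by under eq_fun do rewrite mxE; apply: L1_sum => j; exact: L1Z.
apply: eq_bigr => i _; rewrite mxE.
under [in LHS]eq_fun do rewrite mxE; rewrite mean_sum => [|j]; last exact: L1Z.
by apply: eq_bigr => j _; rewrite meanZ // mxE.
Qed.

Lemma tr_dot n (u : 'cV[R]_n) (X : 'M[R]_n) : \tr (u *m u^T *m X) = dot u (X *m u).
Proof. by rewrite -mulmxA mxtrace_mulC -mulmxA dot_mx trace_mx11 mxE eqxx. Qed.

Lemma L1_dot n (u : 'cV[R]_n) (X : T -> 'M[R]_n) :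
  L1mx X -> L1 (fun w => dot u (X w *m u)).
Proof. by move=> hX; under eq_fun do rewrite -tr_dot; exact: L1_tr. Qed.

Lemma mean_dot n (u : 'cV[R]_n) (X : T -> 'M[R]_n) : L1mx X ->
  mean (fun w => dot u (X w *m u)) = dot u (meanmx X *m u).
Proof. by move=> hX; under eq_fun do rewrite -tr_dot; rewrite mean_tr // tr_dot. Qed.

Lemma meanmx_sym n (X : T -> 'M[R]_n) : (forall w, (X w)^T = X w) ->
  (meanmx X)^T = meanmx X.
Proof.
move=> sX; apply/matrixP => i j; rewrite !mxE; congr mean; apply/funext => w.
by rewrite -[in LHS]sX mxE.
Qed.

End Mean.

Section MasterInequality.
Variable R : realType.

Lemma mxtraceB n (A B : 'M[R]_n) : \tr (A - B) = \tr A - \tr B.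
Proof. exact: raddfB. Qed.

Lemma tr_le n (A B : 'M[R]_n) : lmx A B -> \tr A <= \tr B.
Proof.
move=> AB; apply: ler_sum => i _.
have E (C : 'M[R]_n) : C i i = dot (delta_mx i 0) (C *m delta_mx i 0).
  by rewrite /dot trmx_delta mulmxA -rowE -colE !mxE.
by rewrite !E.
Qed.

Lemma psd_entry_le_tr n (X : 'M[R]_n) i j : X^T = X -> lmx 0 X -> `|X i j| <= \tr X.
Proof.
move=> sX X0.
have dE k l : dot (delta_mx k 0) (X *m delta_mx l 0) = X k l.
  by rewrite /dot trmx_delta mulmxA -rowE -colE !mxE.
have X0' u : 0 <= dot u (X *m u).
  by have := X0 u; rewrite mul0mx {1}/dot mulmx0 mxE.
have D k : 0 <= X k k by rewrite -dE.
have T2 : X i i + X j j <= 2 * \tr X.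
  have T1 k : X k k <= \tr X by rewrite /mxtrace (bigD1 k) //= lerDl sumr_ge0.
  by rewrite mulr_natl mulr2n lerD.
have Xji : X j i = X i j by rewrite -[in LHS]sX mxE.
have := X0' (delta_mx i 0 + delta_mx j 0); have := X0' (delta_mx i 0 - delta_mx j 0).
rewrite mulmxBr mulmxDr !dotBr !dotBl !dotDr !dotDl !dE Xji => h1 h2.
rewrite ler_norml; apply/andP; split; lra.
Qed.

Lemma le_of_harmonic (a b c : R) : (forall N : nat, a <= b + c / N.+1%:R) -> a <= b.
Proof.
move=> h; apply/ler_addgt0Pr => e e0.
pose N := Num.bound (`|c| / e).
apply: le_trans (h N) _; rewrite lerD2l.
have bN : `|c| / e < N%:R by rewrite archi_boundP // divr_ge0 // ltW.
rewrite ler_pdivrMr ?ltr0n //; apply: le_trans (ler_norm _) _.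
move: bN; rewrite ltr_pdivrMr // => bN; apply: le_trans (ltW bN) _.
by rewrite mulrC; apply: ler_wpM2l; [exact: ltW|rewrite ler_nat].
Qed.

Definition quad2 (x : R) : R := 1 + x + x ^+ 2 / 2.

Lemma quad2_ge (x : R) : 1 / 2 <= quad2 x.
Proof. by rewrite /quad2; have := sqr_ge0 (x + 1); rewrite sqrrD; lra. Qed.

Lemma quad2_gt0 (x : R) : 0 < quad2 x.
Proof. by apply: lt_le_trans (quad2_ge x); lra. Qed.

(** For [x <= 0] the claim is [1 <= quad2 x * quad2 (- x)], and this product equals
    [1 + x^4 / 4]. *)
Lemma phi0_le (x : R) : phi0 x <= ln (quad2 x).
Proof.
rewrite /phi0 -/(quad2 x); case: ifP => // x0.
have e : 1 - x + x ^+ 2 / 2 = quad2 (- x) by rewrite /quad2 sqrrN.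
rewrite e -lnV ?posrE ?quad2_gt0 // ler_ln ?posrE ?invr_gt0 ?quad2_gt0 //.
rewrite -[leLHS]mul1r ler_pdivrMr ?quad2_gt0 // /quad2.
have := sqr_ge0 (x ^+ 2); nra.
Qed.

Context d (T : measurableType d) (P : probability T R).
Variables (n : nat) (Z : T -> 'M[R]_n) (H V : 'M[R]_n).
Hypotheses (sZ : forall w, (Z w)^T = Z w) (sH : H^T = H) (sV : V^T = V).
Hypotheses (Z1 : L1mx P Z) (Z2 : L1mx P (fun w => Z w *m Z w)).

Let X w := mxfun expR (H + mxfun (@phi0 R) (Z w)).
Hypothesis mX : forall i j, measurable_fun setT (fun w => X w i j).
Hypothesis ZV : lmx (meanmx P Z + 2^-1 *: meanmx P (fun w => Z w *m Z w)) V.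

Let W w := 1%:M + Z w + 2^-1 *: (Z w *m Z w).

Let sHZ w : (H + mxfun (@phi0 R) (Z w))^T = H + mxfun (@phi0 R) (Z w).
Proof. by rewrite linearD /= sH mxfun_sym. Qed.

Let WE w : W w = mxfun quad2 (Z w).
Proof.
have idZ := mxfun_id (sZ w).
have ZZ : Z w *m Z w = mxfun (fun x => x * x) (Z w).
  by rewrite -(mxfunM (sZ w) id id) idZ.
rewrite /W ZZ -(mxfun_cst (sZ w)) -[X in _ + X + _]idZ mxfunZ // !mxfunD //.
by apply: eq_mxfun => // a _; rewrite /quad2 mulrC expr2.
Qed.

Let sX w : (X w)^T = X w. Proof. by rewrite mxfun_sym. Qed.
Let sW w : (W w)^T = W w. Proof. by rewrite WE mxfun_sym. Qed.

Let X_eig w a : eigenvalue (X w) a -> 0 <= a.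
Proof. by move=> /(eigenvalue_mxfun (sHZ w)) [b _ ->]; exact: expR_ge0. Qed.

Let W_eig w a : eigenvalue (W w) a -> 0 < a.
Proof. by rewrite WE => /(eigenvalue_mxfun (sZ w)) [b _ ->]; exact: quad2_gt0. Qed.

Let W1 : L1mx P W.
Proof.
move=> i j; rewrite /W; under eq_fun do rewrite mxE mxE [X in _ + X]mxE.
by apply: L1D; [apply: L1D; [exact: L1_cst|exact: Z1]|apply: L1Z; exact: Z2].
Qed.

Let X_psd w : lmx 0 (X w).
Proof.
have -> : 0 = mxfun (fun=> 0) (H + mxfun (@phi0 R) (Z w)).
  by rewrite mxfun_cst // raddf0.
by apply: mxfun_le => // a _; exact: expR_ge0.
Qed.

(** The exponential undoes the logarithm in [phi0]: once [H] is bounded by a scalar, [X] is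
    dominated in trace by a quadratic polynomial of [Z]. Two moments of [Z] thus make [X]
    integrable. *)
Let trX_le : exists c, forall w, \tr (X w) <= c * \tr (W w).
Proof.
have [h Hh] : exists h, lmx H h%:M.
  have [U [l [oU HE]]] := spectral sH.
  exists (\sum_i `|l 0 i|); apply: eigenvalue_le_lmx => // a.
  move=> /(eigenvalue_diag _ oU HE) [k ->]; apply: le_trans (ler_norm _) _.
  by rewrite (bigD1 k) //= lerDl sumr_ge0.
exists (expR h) => w.
pose F := mxfun (fun x => h + phi0 x) (Z w).
have sF : F^T = F by rewrite mxfun_sym.
have FE : F = h%:M + mxfun (@phi0 R) (Z w).
  by rewrite -(mxfun_cst (sZ w)) mxfunD.
apply: (@le_trans _ _ (\tr (mxfun expR F))).
  apply: tr_exp_le => // u; rewrite FE !mulmxDl !dotDr lerD2r; exact: Hh.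
rewrite mxfun_comp // WE -linearZ /= mxfunZ //; apply/tr_le/mxfun_le => // a _ /=.
rewrite expRD ler_wpM2l ?expR_ge0 // -[leRHS]lnK ?posrE ?quad2_gt0 //.
by rewrite ler_expR phi0_le.
Qed.

Let trW1 : L1 P (fun w => \tr (W w)).
Proof. by apply: L1_sum => i; exact: W1. Qed.

Let X1 : L1mx P X.
Proof.
move=> i j; have [c hc] := trX_le.
apply: (L1_le (mX i j) _ (L1Z c trW1)) => w.
by apply: le_trans (hc w); apply: psd_entry_le_tr.
Qed.

(** The logarithm of [X] is [H + phi0(Z)], and [phi0(Z)] is at most [ln W] because both are
    functions of [Z]. The two logarithms cancel and leave a bound that is linear in [(X, W)], hence
    can be averaged. *)
Let relent_XW w : relent (X w) (W w) <= \tr ((H - 1%:M) *m X w) + \tr (W w).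
Proof.
have -> : relent (X w) (W w) = \tr (X w *m (H + mxfun (@phi0 R) (Z w)))
    - \tr (X w *m mxfun (@ln R) (W w)) - \tr (X w) + \tr (W w).
  congr (_ - _ - _ + _); congr (\tr _).
  rewrite -[H + _ in RHS](mxfun_id (sHZ w)) mxfunM // mxfun_comp //.
  by apply: eq_mxfun => // a _; rewrite /= /xlnx expRK.
have : \tr (X w *m mxfun (@phi0 R) (Z w)) <= \tr (X w *m mxfun (@ln R) (W w)).
  apply: tr_mxfun_lmx => //; rewrite WE mxfun_comp //.
  by apply: mxfun_le => // a _; exact: phi0_le.
rewrite mulmxDr mulmxBl mxtraceD mxtraceB mul1mx (mxtrace_mulC H).
lra.
Qed.

Let lmix_linear N (K : nat -> 'M[R]_n) : exists C D : 'M[R]_n, forall A B : 'M[R]_n,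
  N.+1%:R^-1 * \sum_(k < N) (1 - node R N k.+1) * lmix (node R N k.+1) (K k) A B
  = \tr (C *m A) + \tr (D *m B).
Proof.
pose c k := N.+1%:R^-1 * (1 - node R N k.+1).
exists (\sum_(k < N) c k *: (2 *: (K k)^T - node R N k.+1 *: (K k *m (K k)^T))).
exists (\sum_(k < N) c k *: (- 2 *: (K k)^T - (1 - node R N k.+1) *: ((K k)^T *m K k))).
move=> A B; rewrite !mulmx_suml !raddf_sum /= -big_split mulr_sumr /=.
apply: eq_bigr => k _; rewrite mulrA -/(c k) -!scalemxAl !mxtraceZ -mulrDr.
congr (_ * _); rewrite /lmix mulmxBr !mulmxBl -!scalemxAl !mxtraceB !mxtraceZ.
rewrite (mxtrace_mulC _ (K k)) mulmxA (mxtrace_mulC _ (K k)^T) (mulmxA (K k)^T).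
move: (\tr _) (\tr _) (\tr _) (\tr _) => t1 t2 t3 t4; ring.
Qed.

Let Xb := meanmx P X.
Let Wb := meanmx P W.
Let sXb : Xb^T = Xb. Proof. exact: meanmx_sym. Qed.
Let sWb : Wb^T = Wb. Proof. exact: meanmx_sym. Qed.

Let Xb_eig a : eigenvalue Xb a -> 0 <= a.
Proof.
apply: lmx_eigenvalue_ge => // u; rewrite mul_scalar_mx scale0r -mean_dot //.
rewrite {1}/dot mulmx0 mxE; apply: Rintegral_ge0 => w _.
by have := X_psd w u; rewrite mul0mx {1}/dot mulmx0 mxE.
Qed.

Let Wb_eig a : eigenvalue Wb a -> 0 < a.
Proof.
move=> aW; apply: (@lt_le_trans _ _ (1/2)); first by lra.
move: aW; apply: lmx_eigenvalue_ge => // u; rewrite -mean_dot //.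
rewrite -[leLHS](mean_cst P); apply: mean_le => [||w]; [exact: L1_cst|exact: L1_dot|].
rewrite WE -(mxfun_cst (sZ w)); apply: mxfun_le => // b _; exact: quad2_ge.
Qed.

(** The matrices [K] are chosen optimally for the means and then frozen. For frozen [K] the
    combination is linear, so it commutes with the mean, and for every [w] it stays below
    [relent (X w) (W w)]. *)
Let jensen : relent Xb Wb <= \tr ((H - 1%:M) *m Xb) + \tr Wb.
Proof.
have [c hc] := relent_le sXb sWb Xb_eig Wb_eig.
apply: (@le_of_harmonic _ _ c) => N; have [K hK] := hc N.
apply: le_trans hK _; rewrite lerD2r.
have [C [D CD]] := lmix_linear N K; rewrite CD -[Wb in leRHS]mul1mx -!mean_tr //.
have iX B : L1 P (fun w => \tr (B *m X w)) by exact: L1_tr.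
have iW B : L1 P (fun w => \tr (B *m W w)) by exact: L1_tr.
rewrite -!meanD //; apply: mean_le => [||w]; [exact: L1D|exact: L1D|].
rewrite -CD mul1mx; apply: le_trans (relent_XW w); apply: relent_ge => //.
  exact: X_eig.
exact: W_eig.
Qed.

(** Adding [jensen] to the Gibbs inequality at [Xb] eliminates [tr (Xb ln Xb)] and leaves [tr Xb] on
    the left. What remains to compare is [ln Wb <= Wb - 1 <= V]. *)
Lemma mean_tr_exp_le :
  (\int[P]_w (\tr (mxfun expR (H + mxfun (@phi0 R) (Z w))))%:E
     <= (\tr (mxfun expR (H + V)))%:E)%E.
Proof.
have X1' : L1 P (fun w => \tr (X w)) by apply: L1_sum => i; exact: X1.
rewrite (integral_mean X1') lee_fin.
have -> : mean P (fun w => \tr (X w)) = \tr Xb.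
  by rewrite -[Xb]mul1mx -mean_tr //; congr mean; apply/funext => w; rewrite mul1mx.
have sHV : (H + V)^T = H + V by rewrite linearD /= sH sV.
apply: le_trans (gibbs sXb sHV Xb_eig).
have WbE : Wb = 1%:M + (meanmx P Z + 2^-1 *: meanmx P (fun w => Z w *m Z w)).
  apply/matrixP => i j; rewrite [LHS]mxE [RHS]mxE [X in _ + X]mxE.
  rewrite [X in _ + (_ + X)]mxE [meanmx P Z i j]mxE [meanmx P _ i j]mxE.
  have WwE w : W w i j = (1%:M : 'M[R]_n) i j + (Z w i j + 2^-1 * (Z w *m Z w) i j).
    by rewrite /W [LHS]mxE [X in X + _]mxE [X in _ + X]mxE addrA.
  under eq_fun do rewrite WwE.
  rewrite meanD; [|exact: L1_cst|apply: L1D; [exact: Z1|apply: L1Z; exact: Z2]].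
  rewrite mean_cst meanD; [|exact: Z1|apply: L1Z; exact: Z2].
  by rewrite meanZ; last exact: Z2.
have XV : \tr (Xb *m mxfun (@ln R) Wb) <= \tr (Xb *m V).
  rewrite -[Xb](mxfun_id sXb); apply: tr_mxfun_lmx => // u.
  apply: (@le_trans _ _ (dot u ((Wb - 1%:M) *m u))).
    have -> : Wb - 1%:M = mxfun (fun x => x - 1) Wb.
      by rewrite -(mxfunD sWb id (fun=> -1)) mxfun_id // mxfun_cst // raddfN.
    by apply: mxfun_le => // b bW; rewrite ln_le_subr1 // Wb_eig.
  by rewrite WbE addrC addKr; exact: ZV.
move: jensen XV; rewrite /relent mulmxBl mulmxDr mul1mx mxtraceB mxtraceD (mxtrace_mulC H).
lra.
Qed.

End MasterInequality.

(** * Measurability of matrix functions *)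

Section BorelMatrices.
Variable R : realType.

(** The entrywise l1 distance: as a finite sum of absolute values it is measurable as soon as the
    entries are, and it dominates every entry. *)
Definition mdist m n (A B : 'M[R]_(m, n)) : R := \sum_i \sum_j `|A i j - B i j|.

Lemma mdist_entry m n (A B : 'M[R]_(m, n)) i j : `|A i j - B i j| <= mdist A B.
Proof.
rewrite /mdist (bigD1 i) //= (bigD1 j) //= -addrA lerDl addr_ge0 //.
  by rewrite sumr_ge0.
by apply: sumr_ge0 => k _; exact: sumr_ge0.
Qed.

Lemma mdist_triangle m n (B A C : 'M[R]_(m, n)) : mdist A C <= mdist A B + mdist B C.
Proof.
rewrite /mdist -big_split /=; apply: ler_sum => i _.
by rewrite -big_split /=; apply: ler_sum => j _; exact: ler_distD.
Qed.

Lemma mdistC m n (A B : 'M[R]_(m, n)) : mdist A B = mdist B A.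
Proof.
by apply: eq_bigr => i _; apply: eq_bigr => j _; rewrite distrC.
Qed.

Lemma mdist_rat m n (A : 'M[R]_(m, n)) (e : R) : 0 < e ->
  exists q : 'M[rat]_(m, n), mdist A (map_mx ratr q) < e.
Proof.
move=> e0; pose c := e / (m * n).+1%:R.
have c0 : 0 < c by rewrite divr_gt0 // ltr0n.
have ex i j : exists q : rat, `|A i j - ratr q| <= c.
  have [q] := @rat_in_itvoo R (A i j) (A i j + c) ltac:(by rewrite ltrDl).
  rewrite in_itv /= => /andP[h1 h2]; exists q.
  by rewrite distrC ger0_norm ?subr_ge0 ?ltW // ltrBlDl.
have /choice [Q hQ] : forall ij : 'I_m * 'I_n, exists q : rat, `|A ij.1 ij.2 - ratr q| <= c.
  by case=> i j; exact: ex.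
exists (\matrix_(i, j) Q (i, j)).
apply: (@le_lt_trans _ _ (\sum_(i < m) \sum_(j < n) c)).
  by apply: ler_sum => i _; apply: ler_sum => j _; rewrite !mxE; exact: (hQ (i, j)).
rewrite !sumr_const !card_ord -mulrnA -mulr_natl /c mulrCA gtr_pMr //.
by rewrite ltr_pdivrMr ?ltr0n // mul1r ltr_nat mulnC.
Qed.

Lemma mx_nbhs_mdist m n (U : set 'M[R]_(m, n)) A : open U -> U A ->
  exists2 e, 0 < e & forall B, mdist A B < e -> U B.
Proof.
move=> oU UA; have /nbhs_ballP[e /= e0 eU] : nbhs A U by exact: open_nbhs_nbhs.
exists e => // B AB; apply: eU; split => // i j.
by rewrite /ball /=; apply: le_lt_trans AB; exact: mdist_entry.
Qed.

Section Preimage.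
Context d (T : measurableType d) (m n : nat).
Variable M : T -> 'M[R]_(m, n).
Hypothesis mM : forall i j, measurable_fun setT (fun w => M w i j).

Lemma measurable_mdist Q : measurable_fun setT (fun w => mdist (M w) Q).
Proof.
apply: measurable_sum => i; apply: measurable_sum => j.
by apply: measurableT_comp => //; apply: measurable_funB => //; exact: mM.
Qed.

(** [U] is the union of the balls inside it with rational centre and radius [1/(k+1)]. There are
    countably many, so it suffices that distances to fixed matrices are measurable. *)
Lemma measurable_mx_preimage (U : set 'M[R]_(m, n)) :
  (forall A, U A -> exists2 e, 0 < e & forall B, mdist A B < e -> U B) ->
  measurable (M @^-1` U).
Proof.
move=> oU.
pose F (p : 'M[rat]_(m, n) * nat) : set T :=
  if `[< forall B, mdist (map_mx ratr p.1) B < p.2.+1%:R^-1 -> U B >]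
  then [set w | mdist (M w) (map_mx ratr p.1) < p.2.+1%:R^-1] else set0.
have -> : M @^-1` U = \bigcup_p F p.
  apply/seteqP; split => [w /= UM|w [p _]]; last first.
    rewrite /F; case: asboolP => //= h; rewrite mdistC; exact: h.
  have [e e0 he] := oU _ UM.
  pose k := Num.bound (2 / e).
  have kb : k.+1%:R^-1 < e / 2.
    have h : 2 / e < k%:R by rewrite archi_boundP // divr_ge0 // ltW.
    rewrite -[ltRHS]invrK ltf_pV2 ?posrE ?ltr0n ?invr_gt0 ?divr_gt0 //.
    by rewrite invf_div (lt_le_trans h) // ler_nat.
  have [q hq] := @mdist_rat m n (M w) k.+1%:R^-1 ltac:(by rewrite invr_gt0 ltr0n).
  exists (q, k) => //; rewrite /F /=; case: asboolP => //= h; exfalso; apply: h => B hB.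
  apply: he; apply: le_lt_trans (mdist_triangle (map_mx ratr q) _ _) _.
  by rewrite [e]splitr ltrD // (lt_trans _ kb).
apply: countable_bigcupT_measurable => [|p]; first exact: countableP.
rewrite /F; case: asboolP => // _.
rewrite (_ : [set w | _] = (fun w => mdist (M w) (map_mx ratr p.1)) @^-1` `]-oo, p.2.+1%:R^-1[%classic).
  by rewrite -[X in measurable X]setTI; apply: measurable_mdist.
by apply/seteqP; split => w /=; rewrite in_itv.
Qed.

Lemma measurable_borel_mx : measurable_fun setT (M : T -> borel_mx R m n).
Proof.
apply: (@measurability _ _ T (borel_mx R m n) setT M (@open 'M[R]_(m, n))) => // _ [U oU <-].
by rewrite setTI; apply: measurable_mx_preimage => A; exact: mx_nbhs_mdist.
Qed.

Lemma measurable_lipschitz_mx (g : 'M[R]_(m, n) -> R) (L : R) :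
  (forall A B, `|g A - g B| <= L * mdist A B) -> measurable_fun setT (g \o M).
Proof.
move=> gL; pose K := `|L| + 1.
have K0 : 0 < K by rewrite ltr_wpDl.
have md0 A B : 0 <= mdist A B by apply: sumr_ge0 => i _; exact: sumr_ge0.
have gK A B : `|g A - g B| <= K * mdist A B.
  apply: le_trans (gL A B) _; rewrite ler_wpM2r // /K.
  by apply: le_trans (ler_norm L) _; rewrite lerDl.
apply: (measurability (@RGenOInfty.G R)); first exact: RGenOInfty.measurableE.
move=> _ [_ [x ->] <-]; rewrite setTI.
rewrite comp_preimage; apply: measurable_mx_preimage => A /=.
rewrite in_itv /= andbT => xA; exists ((g A - x) / K).
  by rewrite divr_gt0 // subr_gt0.
move=> B; rewrite ltr_pdivlMr // mulrC => AB; rewrite in_itv /= andbT.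
have := le_lt_trans (le_trans (ler_norm _) (gK A B)) AB; lra.
Qed.

End Preimage.

(** A Lipschitz function need not be Lipschitz for the operator norm with the same constant, but it
    is for the Frobenius norm: the squared scalar inequality has separated variables after
    expansion, so [klein] applies with six products. *)
Lemma frobenius_lipschitz n (f : R -> R) (L : R) (A B : 'M[R]_n) :
  (forall x y, `|f x - f y| <= L * `|x - y|) -> A^T = A -> B^T = B ->
  \tr ((mxfun f A - mxfun f B) *m (mxfun f A - mxfun f B)) <=
  L ^+ 2 * \tr ((A - B) *m (A - B)).
Proof.
move=> fL sA sB.
pose F k := nth id [:: fun x => L ^+ 2 * (x * x); fun x => - 2 * L ^+ 2 * x; fun=> L ^+ 2;
  fun x => - 1 * (f x * f x); fun x => 2 * f x; fun=> -1] k.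
pose G k := nth id [:: fun=> 1; id; fun x => x * x; fun=> 1; f; fun x => f x * f x] k.
have H x y : 0 <= \sum_(k < 6) F k x * G k y.
  rewrite !big_ord_recl big_ord0 /F /G /=.
  suff : (f x - f y) ^+ 2 <= L ^+ 2 * (x - y) ^+ 2 by lra.
  rewrite -(real_normK (num_real (f x - f y))) -(real_normK (num_real (x - y))) -exprMn.
  by rewrite lerXn2r ?nnegrE // (le_trans _ (fL x y)).
have := @klein R n 'I_6 (fun k => F k) (fun k => G k) A B sA sB (fun x y _ _ => H x y).
rewrite !big_ord_recl big_ord0 /F /G /= !mxfun_cst // !mxfun_id // -!(mxfunZ sA) //.
rewrite -!(mxfunM _ f f) // -(mxfunM sA id id) -(mxfunM sB id id) !mxfun_id //.
rewrite mulmx1 mul_scalar_mx -!scalemxAl mulmx1 mul_scalar_mx !mxtraceZ.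
rewrite !mulmxBl !mulmxBr !mxtraceB (mxtrace_mulC (mxfun f B) (mxfun f A)) (mxtrace_mulC B A).
lra.
Qed.

Lemma frobeniusE n (D : 'M[R]_n) : D^T = D -> \tr (D *m D) = \sum_i \sum_j D i j ^+ 2.
Proof.
move=> sD; apply: eq_bigr => i _; rewrite mxE; apply: eq_bigr => j _.
by rewrite expr2 -[in X in _ * X]sD mxE.
Qed.

Lemma mxfun_entry_lipschitz n (f : R -> R) (L : R) (A B : 'M[R]_n) i j :
  (forall x y, `|f x - f y| <= L * `|x - y|) -> A^T = A -> B^T = B ->
  `|mxfun f A i j - mxfun f B i j| <= `|L| * mdist A B.
Proof.
move=> fL sA sB; have := frobenius_lipschitz fL sA sB.
rewrite !frobeniusE; [|by rewrite linearB /= ?mxfun_sym // ?sA ?sB..] => h.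
rewrite -[leLHS]normr_id -[leRHS]ger0_norm; last first.
  by rewrite mulr_ge0 //; apply: sumr_ge0 => k _; exact: sumr_ge0.
rewrite -ler_sqr ?nnegrE // !real_normK ?num_real // exprMn real_normK ?num_real //.
have h1 : (mxfun f A i j - mxfun f B i j) ^+ 2 <=
    \sum_i \sum_j ((mxfun f A - mxfun f B) i j) ^+ 2.
  rewrite (bigD1 i) //= (bigD1 j) //= !mxE -addrA lerDl addr_ge0 //.
    by apply: sumr_ge0 => k _; exact: sqr_ge0.
  by apply: sumr_ge0 => k _; apply: sumr_ge0 => l _; exact: sqr_ge0.
apply: le_trans h1 (le_trans h _); rewrite ler_wpM2l ?sqr_ge0 //.
rewrite expr2 /mdist mulr_suml; apply: ler_sum => k _.
rewrite mulr_suml; apply: ler_sum => l _.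
rewrite !mxE -real_normK ?num_real // expr2 ler_wpM2l //; exact: mdist_entry.
Qed.

Section MeasurableMxfun.
Context d (T : measurableType d) (n : nat) (M : T -> 'M[R]_n).
Hypotheses (mM : forall i j, measurable_fun setT (fun w => M w i j)).
Hypotheses (sM : forall w, (M w)^T = M w).

Lemma measurable_mxfun_lipschitz f L :
  (forall x y, `|f x - f y| <= L * `|x - y|) ->
  forall i j, measurable_fun setT (fun w => mxfun f (M w) i j).
Proof.
(* The symmetrization extends the map to all matrices, where a global Lipschitz bound makes sense,
   without changing it on the values of [M]. *)
move=> fL i j; pose s (A : 'M[R]_n) := 2^-1 *: (A + A^T).
have ss A : (s A)^T = s A by rewrite /s linearZ linearD /= trmxK addrC.
have sid A : A^T = A -> s A = A.
  move=> sA; rewrite /s sA; apply/matrixP => k l; rewrite !mxE; lra.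
have -> : (fun w => mxfun f (M w) i j) = (fun A => mxfun f (s A) i j) \o M.
  by apply/funext => w /=; rewrite sid.
apply: (@measurable_lipschitz_mx _ _ _ _ _ mM _ `|L|) => A B.
apply: le_trans (mxfun_entry_lipschitz i j fL (ss A) (ss B)) _; rewrite ler_wpM2l //.
apply: (@le_trans _ _ (\sum_k \sum_l (2^-1 * (`|A k l - B k l| + `|A l k - B l k|)))).
  apply: ler_sum => k _; apply: ler_sum => l _; rewrite !mxE -mulrBr normrM.
  rewrite ger0_norm ?invr_ge0 ?ler0n // ler_wpM2l ?invr_ge0 ?ler0n //.
  by rewrite opprD addrACA; exact: ler_normD.
under eq_bigr do rewrite -mulr_sumr big_split /=.
rewrite -mulr_sumr big_split /= [X in _ + X]exchange_big /= -/(mdist A B).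
lra.
Qed.

(** A matrix has finitely many eigenvalues, so pointwise eventual equality makes the approximation
    exact from some index on. This covers [expR], which is not globally Lipschitz, and [step], which
    jumps. *)
Lemma measurable_mxfun_lim (f : R -> R) (g : nat -> R -> R) (L : nat -> R) :
  (forall k x y, `|g k x - g k y| <= L k * `|x - y|) ->
  (forall x, exists k0, forall k, (k0 <= k)%N -> g k x = f x) ->
  forall i j, measurable_fun setT (fun w => mxfun f (M w) i j).
Proof.
move=> gL gf i j.
apply: (measurable_fun_cvg (h := fun k w => mxfun (g k) (M w) i j)) => [k|w _].
  exact: measurable_mxfun_lipschitz (gL k) i j.
have [U [l [oU ME]]] := spectral (sM w).
have /choice [K hK] : forall a, exists k0, forall k, (k0 <= k)%N -> g k (l 0 a) = f (l 0 a).
  by move=> a; exact: gf.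
pose k0 := (\max_a K a)%N.
apply: cvg_near_cst; exists k0 => //= k kk.
congr (fun_of_matrix _ i j); apply: eq_mxfun => // a /(eigenvalue_diag _ oU ME) [b ->].
by rewrite hK // (leq_trans _ kk) // /k0 leq_bigmax.
Qed.

End MeasurableMxfun.

End BorelMatrices.

Section LipschitzApproximation.
Variable R : realType.

Lemma phi0_ge0E (x : R) : 0 <= x -> phi0 x = ln (quad2 x).
Proof.
rewrite le0r => /orP[/eqP ->|x0]; last by rewrite /phi0 x0.
by rewrite /phi0 ltxx /quad2 expr0n /= mul0r subr0 !addr0 ln1 oppr0.
Qed.

Lemma phi0N (x : R) : phi0 (- x) = - phi0 x.
Proof.
have h (y : R) : 0 < y -> phi0 (- y) = - phi0 y.
  by move=> y0; rewrite /phi0 y0 oppr_gt0 ltNge (ltW y0) /= opprK sqrrN.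
have [x0|x0|->] := ltgtP x 0; last 2 first.
- exact: h.
- by rewrite oppr0 phi0_ge0E // /quad2 expr0n /= mul0r !addr0 ln1 oppr0.
by rewrite -[x in RHS]opprK (h (- x)) ?oppr_gt0 // opprK.
Qed.

(** For [a = b + h] with [b, h >= 0] one has [quad2 a <= quad2 b (1 + h)^2], and [ln (1 + h) <= h]
    concludes without derivatives; oddness gives the other signs. Only measurability is drawn from
    this, so the constant is immaterial. *)
Lemma phi0_lipschitz (x y : R) : `|phi0 x - phi0 y| <= 2 * `|x - y|.
Proof.
have pos (a b : R) : 0 <= b -> b <= a -> `|phi0 a - phi0 b| <= 2 * (a - b).
  move=> b0 ba; have a0 := le_trans b0 ba; rewrite !phi0_ge0E //.
  have qba : quad2 b <= quad2 a.
    by rewrite /quad2 lerD ?lerD ?ler_wpM2r ?invr_ge0 ?ler0n // lerXn2r ?nnegrE.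
  rewrite ger0_norm; last by rewrite subr_ge0 ler_ln ?posrE ?quad2_gt0.
  pose h := a - b; have h0 : 0 <= h by rewrite subr_ge0.
  have : quad2 a <= quad2 b * ((1 + h) * (1 + h)).
    have -> : a = b + h by rewrite /h addrC subrK.
    rewrite /quad2 -subr_ge0.
    have -> : (1 + b + b ^+ 2 / 2) * ((1 + h) * (1 + h)) - (1 + (b + h) + (b + h) ^+ 2 / 2)
      = h + h ^+ 2 / 2 + b * h + b * h ^+ 2 + b ^+ 2 / 2 * (2 * h + h ^+ 2) by field.
    have := mulr_ge0 b0 h0; have := mulr_ge0 b0 (sqr_ge0 h).
    have := mulr_ge0 (sqr_ge0 b) h0; have := mulr_ge0 (sqr_ge0 b) (sqr_ge0 h).
    have := sqr_ge0 h; lra.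
  rewrite -ler_ln ?posrE ?quad2_gt0 //; last by rewrite !mulr_gt0 ?quad2_gt0 // ltr_wpDr.
  rewrite lnM ?posrE ?quad2_gt0 ?mulr_gt0 ?ltr_wpDr // lnM ?posrE ?ltr_wpDr //.
  have : ln (1 + h) <= h by rewrite le_ln1Dx // (lt_le_trans _ h0) // ltrN10.
  rewrite -/h; lra.
have main (a b : R) : b <= a -> `|phi0 a - phi0 b| <= 2 * (a - b).
  move=> ba; have [b0|b0] := leP 0 b; first exact: pos.
  have [a0|a0] := leP 0 a.
    have p0 : phi0 0 = 0 :> R by have := @phi0N 0; rewrite oppr0; lra.
    have ha := pos a 0 (lexx _) a0.
    have hb := pos (- b) 0 (lexx _) ltac:(by rewrite oppr_ge0 ltW).
    rewrite phi0N in hb; move: ha hb; rewrite p0 !subr0 normrN => ha hb.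
    apply: le_trans (ler_normB _ _) _; lra.
  have := pos (- b) (- a) ltac:(by rewrite oppr_ge0 ltW) ltac:(by rewrite lerN2).
  by rewrite !phi0N !opprK (addrC (- phi0 b)) (addrC (- b)).
have [xy|/ltW xy] := leP y x.
  by rewrite [leRHS](_ : _ = 2 * (x - y)) ?main // ger0_norm ?subr_ge0.
by rewrite distrC [leRHS](_ : _ = 2 * (y - x)) ?main // distrC ger0_norm ?subr_ge0.
Qed.

Lemma min_lipschitz (c x y : R) : `|Num.min x c - Num.min y c| <= `|x - y|.
Proof.
have h (a b : R) : a <= b -> `|Num.min a c - Num.min b c| <= `|a - b|.
  move=> ab; rewrite !minEle.
  case: ifP => h1; case: ifP => h2; rewrite ?subrr ?normr0 //.
    move/negbT: h2; rewrite -ltNge => h2.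
    by rewrite !ler0_norm ?subr_le0 ?opprB ?lerB // ltW.
  move/negbT: h1; rewrite -ltNge => h1.
  by have := lt_le_trans h1 ab; rewrite ltNge h2.
by have [/h|/ltW/h] := leP x y; rewrite // distrC (distrC y).
Qed.

Lemma expR_lipschitz (c x y : R) : x <= c -> y <= c ->
  `|expR x - expR y| <= expR c * `|x - y|.
Proof.
have h (a b : R) : a <= b -> b <= c -> `|expR a - expR b| <= expR c * `|a - b|.
  move=> ab bc; rewrite ler0_norm ?subr_le0 ?ler_expR // ler0_norm ?subr_le0 // !opprB.
  have -> : expR b - expR a = expR b * (1 - expR (a - b)).
    by rewrite expRB mulrBr mulr1 mulrCA divff ?mulr1 // gt_eqF ?expR_gt0.
  apply: (@le_trans _ _ (expR b * (b - a))).
    by rewrite ler_wpM2l ?expR_ge0 //; have := expR_ge1Dx (a - b); lra.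
  by rewrite ler_wpM2r ?subr_ge0 // ler_expR.
move=> xc yc; have [xy|/ltW xy] := leP x y; first exact: h.
by rewrite distrC (distrC x); exact: h.
Qed.

(** The comparison is strict because thresholding also removes singular values equal to the
    level. *)
Definition step (t x : R) : R := if t < x then 1 else 0.

Definition ramp (t : R) (k : nat) (x : R) : R := Num.min (Num.max 0 (k%:R * (x - t))) 1.

Lemma ramp_lipschitz t k (x y : R) : `|ramp t k x - ramp t k y| <= k%:R * `|x - y|.
Proof.
apply: le_trans (min_lipschitz _ _ _) _.
have e (a : R) : Num.max 0 a = - Num.min (- a) 0 by rewrite -[0 in RHS]oppr0 -oppr_max opprK maxC.
rewrite !e opprK addrC; apply: le_trans (min_lipschitz _ _ _) _.
rewrite opprK addrC -mulrBr normrM ger0_norm ?ler0n // opprB addrA subrK.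
by [].
Qed.

Lemma ramp_step t (x : R) : exists k0, forall k, (k0 <= k)%N -> ramp t k x = step t x.
Proof.
rewrite /step; case: ltP => [tx|xt].
  exists (Num.bound (x - t)^-1) => k kk; rewrite /ramp.
  have h : 1 <= k%:R * (x - t).
    rewrite -ler_pdivrMr ?subr_gt0 // mul1r.
    apply: (@le_trans _ _ (Num.bound (x - t)^-1)%:R); last by rewrite ler_nat.
    by rewrite ltW // archi_boundP // invr_ge0 subr_ge0 ltW.
  by rewrite (max_r (le_trans ler01 h)) min_r.
exists 0%N => k _; rewrite /ramp max_l ?min_l ?ler01 //.
by rewrite mulr_ge0_le0 ?ler0n // subr_le0.
Qed.

Context d (T : measurableType d) (n : nat) (M : T -> 'M[R]_n).
Hypotheses (mM : forall i j, measurable_fun setT (fun w => M w i j)).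
Hypotheses (sM : forall w, (M w)^T = M w).

Lemma measurable_mxfun_phi0 i j : measurable_fun setT (fun w => mxfun (@phi0 R) (M w) i j).
Proof. exact: (measurable_mxfun_lipschitz mM sM phi0_lipschitz). Qed.

Lemma measurable_mxfun_step t i j : measurable_fun setT (fun w => mxfun (step t) (M w) i j).
Proof. exact: (measurable_mxfun_lim mM sM (ramp_lipschitz t) (ramp_step t)). Qed.

Lemma measurable_mxfun_expR i j : measurable_fun setT (fun w => mxfun (@expR R) (M w) i j).
Proof.
apply: (measurable_mxfun_lim mM sM (g := fun k x => expR (Num.min x k%:R))
  (L := fun k => expR k%:R)) => [k x y|x].
  apply: le_trans (expR_lipschitz (c := k%:R) _ _) _; rewrite ?ge_min ?lexx ?orbT //.
  by rewrite ler_wpM2l ?expR_ge0 //; exact: min_lipschitz.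
exists (Num.bound `|x|) => k kk; rewrite min_l //.
apply: le_trans (ler_norm _) _; apply: ltW.
by apply: lt_le_trans (archi_boundP (normr_ge0 x)) _; rewrite ler_nat.
Qed.

End LipschitzApproximation.

(** * Chains driven by independent samples *)

Section IndependentPair.
Local Open Scope ereal_scope.
Context d (T : measurableType d) (R : realType) (P : probability T R).
Context dS (S : measurableType dS) dZ (Zt : measurableType dZ).
Variables (U : T -> S) (Z : T -> Zt).
Hypotheses (mU : measurable_fun setT U) (mZ : measurable_fun setT Z).

Let U' : {mfun T >-> S} := HB.pack U (isMeasurableFun.Build _ _ _ _ _ mU).
Let Z' : {mfun T >-> Zt} := HB.pack Z (isMeasurableFun.Build _ _ _ _ _ mZ).
Let mUZ : measurable_fun setT (fun w => (U w, Z w)).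
Proof. exact: measurable_fun_pair. Qed.

Hypothesis indep : forall A B, measurable A -> measurable B ->
  P (U @^-1` A `&` Z @^-1` B) = P (U @^-1` A) * P (Z @^-1` B).

(** For fixed [E] both sides are finite measures in [D] with the same values on rectangles. Putting
    the factor [P E] on the second marginal makes those the values of one product measure, whose
    uniqueness settles all [D]. *)
Lemma independent_rect_ext (E : set T) : measurable E ->
  (forall A B, measurable A -> measurable B ->
    P (U @^-1` A `&` Z @^-1` B `&` E) = P (U @^-1` A) * P (Z @^-1` B) * P E) ->
  forall D, measurable D ->
    P ((fun w => (U w, Z w)) @^-1` D `&` E) = P ((fun w => (U w, Z w)) @^-1` D) * P E.
Proof.
move=> mE HE D mD.
have PE : P E \is a fin_num by exact: fin_num_measure.
pose c : {nonneg R} := NngNum (fine_ge0 (measure_ge0 P E)).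
have cE : c%:num%:E = P E by rewrite /= fineK.
pose m2 := mscale c (distribution P Z').
pose UZ : {mfun T >-> (S * Zt)%type} := HB.pack (fun w => (U w, Z w)) (isMeasurableFun.Build _ _ _ _ _ mUZ).
pose mE1 := pushforward (mrestr P mE) UZ.
pose mE2 := mscale c (distribution P UZ).
have e1 := @product_measure_unique _ _ S Zt R (distribution P U') m2 mE1.
have e2 := @product_measure_unique _ _ S Zt R (distribution P U') m2 mE2.
have : mE1 D = mE2 D.
  rewrite -[LHS]e1 // => [|A B mA mB].
    rewrite -[RHS]e2 // => A B mA mB.
    have h : c%:num%:E * P (U @^-1` A `&` Z @^-1` B) =
      P (U @^-1` A) * (c%:num%:E * P (Z @^-1` B)) by rewrite indep // muleCA.
    exact: h.
  have h : P (U @^-1` A `&` Z @^-1` B `&` E) = P (U @^-1` A) * (c%:num%:E * P (Z @^-1` B)).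
    by rewrite HE // cE -muleA (muleC (P (Z @^-1` B))).
  exact: h.
rewrite /mE1 /mE2 /pushforward /mrestr /mscale /distribution /pushforward => ->.
by rewrite cE muleC.
Qed.

Lemma independent_integral (f : S * Zt -> \bar R) : measurable_fun setT f ->
  (forall x, 0 <= f x) ->
  \int[P]_w f (U w, Z w) = \int[P]_w \int[P]_v f (U w, Z v).
Proof.
move=> mf f0.
pose UZ : {mfun T >-> (S * Zt)%type} := HB.pack (fun w => (U w, Z w)) (isMeasurableFun.Build _ _ _ _ _ mUZ).
transitivity (\int[distribution P UZ]_z f z).
  by rewrite ge0_integral_distribution.
transitivity (\int[distribution P U' \x distribution P Z']_z f z).
  apply: eq_measure_integral => A mA _; apply/esym.
  exact: product_measure_unique.
rewrite fubini_tonelli1 // ge0_integral_distribution //; first last.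
- by move=> s; apply: integral_ge0.
- exact: measurable_fun_fubini_tonelli_F.
apply: eq_integral => w _; rewrite /= /fubini_F ge0_integral_distribution //.
exact: measurable_fun_pair2.
Qed.

Lemma measurable_partial_integral (f : S * Zt -> \bar R) : measurable_fun setT f ->
  (forall x, 0 <= f x) -> measurable_fun setT (fun s => \int[P]_v f (s, Z v)).
Proof.
move=> mf f0; rewrite (_ : (fun s => _) = fubini_F (distribution P Z') f).
  exact: measurable_fun_fubini_tonelli_F.
apply/funext => s; rewrite /fubini_F ge0_integral_distribution //.
exact: measurable_fun_pair2.
Qed.

End IndependentPair.

Section Chain.
Local Open Scope ereal_scope.
Context d (T : measurableType d) (R : realType) (P : probability T R).
Context dS (S : measurableType dS) dZ (Zt : measurableType dZ).
Variables (n : nat) (Z : 'I_n -> T -> Zt).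
Hypothesis mZ : forall i, measurable_fun setT (Z i).
Hypothesis iZ : independent_family P Z.
Variables (F : nat -> S * Zt -> S) (s0 : S).
Hypothesis mF : forall k, measurable_fun setT (F k).

(** Time runs over [nat] to keep inductions simple; past the last sample the chain stands still. *)
Fixpoint chain (k : nat) (w : T) : S :=
  if k is k'.+1 then
    (if (insub k' : option 'I_n) is Some i then F k' (chain k' w, Z i w) else chain k' w)
  else s0.

Lemma chainS (i : 'I_n) w : chain i.+1 w = F i (chain i w, Z i w).
Proof. by rewrite /= valK. Qed.

Lemma measurable_chain k : measurable_fun setT (chain k).
Proof.
elim: k => [|k IH] /=; first exact: measurable_cst.
case: insubP => [i _ _|_] //.
apply: (measurableT_comp (mF k)); exact: measurable_fun_pair.
Qed.

Let future (k : nat) (C : 'I_n -> set Zt) : set T :=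
  \bigcap_(i in [set` ([set i : 'I_n | (k <= i)%N]%SET : {set 'I_n})]) (Z i @^-1` C i).

Let measurable_future k C : (forall i, measurable (C i)) -> measurable (future k C).
Proof.
move=> mC; apply: fin_bigcap_measurable => // i _.
by rewrite -[X in measurable X]setTI; exact: mZ.
Qed.

Let futureS (i : 'I_n) C : future i C = Z i @^-1` C i `&` future i.+1 C.
Proof.
apply/seteqP; split => [w h|w [h1 h2] j /=].
  split; first by apply: (h i); rewrite /= inE leqnn.
  by move=> j /=; rewrite inE => ij; apply: (h j); rewrite /= inE ltnW.
rewrite inE leq_eqVlt => /orP[/eqP/val_inj <-//|ij].
by apply: (h2 j); rewrite /= inE.
Qed.

Let P_futureS (i : 'I_n) C : (forall i, measurable (C i)) ->
  P (future i C) = P (Z i @^-1` C i) * P (future i.+1 C).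
Proof.
move=> mC; rewrite /future !iZ // (bigD1 i) /=; last by rewrite inE.
congr (_ * _); apply: eq_bigl => j; rewrite !inE ltn_neqAle eq_sym andbC.
by [].
Qed.

(** Independence of the next sample alone would not survive the induction, so the statement concerns
    all remaining samples jointly. A step applies [independent_rect_ext] to the pair of state and
    next sample, with the later samples as the event [E]. *)
Let chain_future k : (k <= n)%N -> forall A C, measurable A -> (forall i, measurable (C i)) ->
  P (chain k @^-1` A `&` future k C) = P (chain k @^-1` A) * P (future k C).
Proof.
elim: k => [_|k IH kn] A C mA mC.
  have [sA|sA] := pselect (A s0).
    have -> : chain 0 @^-1` A = setT by apply/seteqP; split.
    by rewrite setTI probability_setT mul1e.
  have -> : chain 0 @^-1` A = set0 by apply/seteqP; split => // w /sA.
  by rewrite set0I measure0 mul0e.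
pose i := Ordinal kn; have {}IH := IH (ltnW kn).
have C'm (B : set Zt) (C0 : 'I_n -> set Zt) : measurable B -> (forall i, measurable (C0 i)) ->
    forall j, measurable ((fun j => if j == i then B else C0 j) j).
  by move=> mB mC0 j /=; case: ifP.
(* The later samples do not see the constraint put on sample [i], so it can be prescribed freely in
   the induction hypothesis. *)
have fut B (C0 : 'I_n -> set Zt) : future i.+1 (fun j => if j == i then B else C0 j) = future i.+1 C0.
  apply: eq_bigcapr => j /=; rewrite inE => ij; case: eqP => // ji.
  by move: ij; rewrite ji ltnn.
have key (A0 : set S) (B : set Zt) (C0 : 'I_n -> set Zt) : measurable A0 -> measurable B ->
    (forall i, measurable (C0 i)) ->
    P (chain k @^-1` A0 `&` Z i @^-1` B `&` future i.+1 C0) =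
    P (chain k @^-1` A0) * P (Z i @^-1` B) * P (future i.+1 C0).
  move=> mA0 mB mC0; have m' := C'm _ _ mB mC0.
  have := IH A0 _ mA0 m'; rewrite (P_futureS i m') (futureS i) eqxx fut.
  by rewrite setIA muleA.
have futT : future i.+1 (fun=> setT) = setT.
  by apply/seteqP; split => // w _ j _.
have ind (A0 : set S) (B : set Zt) : measurable A0 -> measurable B ->
    P (chain k @^-1` A0 `&` Z i @^-1` B) = P (chain k @^-1` A0) * P (Z i @^-1` B).
  move=> mA0 mB; have := key A0 B (fun=> setT) mA0 mB (fun=> measurableT).
  by rewrite futT setIT probability_setT mule1.
have -> : chain k.+1 = F k \o (fun w => (chain k w, Z i w)).
  by apply/funext => w; exact: (chainS i).
rewrite comp_preimage.
apply: (independent_rect_ext (measurable_chain k) (mZ i) ind).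
- exact: measurable_future.
- by move=> A0 B mA0 mB; exact: key.
- by rewrite -[X in measurable X]setTI; exact: mF.
Qed.

Lemma chain_integral_le (i : 'I_n) (g h : S -> \bar R) :
  measurable_fun setT g -> (forall s, 0 <= g s) ->
  measurable_fun setT h -> (forall s, 0 <= h s) ->
  (forall s, \int[P]_w g (F i (s, Z i w)) <= h s) ->
  \int[P]_w g (chain i.+1 w) <= \int[P]_w h (chain i w).
Proof.
move=> mg g0 mh h0 gh.
under eq_integral do rewrite chainS.
have mgF : measurable_fun setT (g \o F i) by exact: measurableT_comp.
have ind (A : set S) (B : set Zt) : measurable A -> measurable B ->
    P (chain i @^-1` A `&` Z i @^-1` B) = P (chain i @^-1` A) * P (Z i @^-1` B).
  move=> mA mB.
  have := @chain_future i (ltnW (ltn_ord i)) A (fun j => if j == i then B else setT) mA.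
  have mC (j : 'I_n) : measurable (if j == i then B else setT) by case: ifP.
  have futT : future i.+1 (fun j : 'I_n => if j == i then B else setT) = setT.
    apply/seteqP; split => // w _ j /=; rewrite inE => ij; case: eqP => // ji.
    by move: ij; rewrite ji ltnn.
  move=> /(_ mC); rewrite (P_futureS i mC) (futureS i) futT eqxx setIT.
  by rewrite probability_setT mule1.
have := independent_integral (measurable_chain i) (mZ i) ind mgF (fun x => g0 _).
rewrite /= => ->.
apply: ge0_le_integral => //.
- by move=> w _; apply: integral_ge0 => v _; exact: g0.
- apply: (measurableT_comp (f := fun s => \int[P]_v (g \o F i) (s, Z i v))).
    by apply: (measurable_partial_integral _ (mZ i) mgF) => x; exact: g0.
  exact: measurable_chain.
- exact: (measurableT_comp mh (measurable_chain i)).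
Qed.

End Chain.

(** * Singular values and thresholding *)

Section SingularValues.
Variable R : realType.

Lemma gram_dot m n (A : 'M[R]_(m, n)) v : dot v (A^T *m A *m v) = dot (A *m v) (A *m v).
Proof. by rewrite -mulmxA [RHS]dot_mull. Qed.

Lemma gram_sym m n (A : 'M[R]_(m, n)) : (A^T *m A)^T = A^T *m A.
Proof. by rewrite trmx_mul trmxK. Qed.

Lemma opnorm_le m n (A : 'M[R]_(m, n)) c : 0 <= c ->
  (forall v, dot (A *m v) (A *m v) <= c ^+ 2 * dot v v) -> opnorm A <= c.
Proof.
move=> c0 hA; rewrite /opnorm.
(* Without columns there are no singular values, and the supremum takes its default value [0]. *)
have [->|/set0P ne] := eqVneq (singular_values A) set0; first by rewrite sup0.
apply: ge_sup => // _ [a /= ha <-].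
rewrite -[leRHS]ger0_norm // -sqrtr_sqr ler_wsqrtr //.
apply: (lmx_eigenvalue_le (gram_sym A)) ha => v.
by rewrite gram_dot mul_scalar_mx dotZr.
Qed.

Lemma eigenvalue_has_sup n (M : 'M[R]_n) (f : R -> R) : M^T = M ->
  has_ubound [set f a | a in [set a | eigenvalue M a]].
Proof.
move=> sM; have [U [l [oU ME]]] := spectral sM.
exists (\sum_i `|f (l 0 i)|) => _ [a /= ha <-].
move: ha => /(eigenvalue_diag _ oU ME) [k ->].
by apply: le_trans (ler_norm _) _; rewrite (bigD1 k) //= lerDl sumr_ge0.
Qed.

Lemma opnorm_bound m n (A : 'M[R]_(m, n)) c v : opnorm A <= c ->
  dot (A *m v) (A *m v) <= c ^+ 2 * dot v v.
Proof.
move=> Ac; rewrite -gram_dot.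
have -> : c ^+ 2 * dot v v = dot v ((c ^+ 2)%:M *m v) by rewrite mul_scalar_mx dotZr.
apply: eigenvalue_le_lmx; first exact: gram_sym.
move=> a ha.
have a0 : 0 <= a.
  apply: (lmx_eigenvalue_ge (gram_sym A)) ha => u.
  by rewrite mul_scalar_mx scale0r {1}/dot mulmx0 mxE gram_dot dotvv_ge0.
have sc : Num.sqrt a <= c.
  apply: le_trans Ac; apply: ub_le_sup; last by exists a.
  exact: (eigenvalue_has_sup _ (gram_sym A)).
by rewrite -(sqr_sqrtr a0) lerXn2r ?nnegrE ?sqrtr_ge0 // (le_trans _ sc) ?sqrtr_ge0.
Qed.

Lemma lmx_lambda_max n (M : 'M[R]_n) : M^T = M -> lmx M (lambda_max M)%:M.
Proof.
move=> sM; apply: eigenvalue_le_lmx => // a ha; apply: ub_le_sup => //.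
by have := eigenvalue_has_sup id sM; rewrite image_id.
Qed.

Lemma dot_le (n : nat) (x y : 'cV[R]_n) c : 0 < c -> dot x x <= c ^+ 2 -> dot y y <= 1 ->
  `|dot x y| <= c.
Proof.
move=> c0 hx hy.
have h z : dot z z <= 1 -> dot x z <= c.
  move=> hz; have := dotvv_ge0 (x - c *: z).
  rewrite !(dotBl, dotBr) !(dotZl, dotZr) (dotC z x).
  have : c ^+ 2 * dot z z <= c ^+ 2 * 1 by rewrite ler_wpM2l ?sqr_ge0.
  move=> h1 h2; suff : c * dot x z <= c * c by rewrite ler_pM2l.
  lra.
rewrite ler_norml h // andbT lerNl.
have -> : - dot x y = dot x (-1 *: y) by rewrite dotZr mulN1r.
by apply: h; rewrite dotZl dotZr mulrA mulrNN !mul1r.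
Qed.

(** The test vector with blocks [t^-1 D v] and [v] makes both off-diagonal blocks contribute
    [t^-1 |D v|^2], so an upper bound on the dilation alone controls [D]. *)
Lemma dilation_bound m n (D : 'M[R]_(m, n)) t : 0 < t -> lmx (dilation D) t%:M ->
  forall v, dot (D *m v) (D *m v) <= t ^+ 2 * dot v v.
Proof.
move=> t0 h v; have := h (col_mx (t^-1 *: (D *m v)) v).
have dot_col p q (a c : 'cV[R]_p) (b e : 'cV[R]_q) :
    dot (col_mx a b) (col_mx c e) = dot a c + dot b e.
  by rewrite /dot tr_col_mx mul_row_col mxE.
rewrite mul_scalar_mx dotZr !dot_col /dilation mul_block_col !mul0mx add0r addr0.
rewrite dot_col -scalemxAr !dotZl !dotZr -dot_mull.
set q := dot (D *m v) (D *m v); set p := dot v v => hh.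
rewrite -(ler_pM2l (_ : 0 < t^-1)) ?invr_gt0 //.
have -> : t^-1 * (t ^+ 2 * p) = t * p by field; rewrite gt_eqF.
have e : t * (t^-1 * (t^-1 * q) + p) = t^-1 * q + t * p by field; rewrite gt_eqF.
by move: hh; rewrite e; lra.
Qed.

Section Diagonal.
Variables (m n : nat) (S : 'M[R]_(m, n)).
Hypothesis dS : forall (i : 'I_m) (j : 'I_n), (i : nat) <> j -> S i j = 0.

(** The squared singular values of a rectangular diagonal matrix, indexed by all columns: those
    beyond the last row receive [0] without a case distinction. *)
Definition colsq : 'rV[R]_n := \row_j \sum_i S i j ^+ 2.

Lemma colsqE (i : 'I_m) (j : 'I_n) : (i : nat) = j -> colsq 0 j = S i j ^+ 2.
Proof.
move=> ij; rewrite mxE (bigD1 i) //= big1 ?addr0 // => k ki.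
rewrite dS ?expr0n // => kj; move/eqP: ki; apply; apply: val_inj; by rewrite /= kj -ij.
Qed.

Lemma gram_diagonal : S^T *m S = diag_mx colsq.
Proof.
apply/matrixP => j k; rewrite !mxE; have [->|jk] := eqVneq j k.
  by rewrite mulr1n; apply: eq_bigr => i _; rewrite mxE expr2.
rewrite mulr0n; apply: big1 => i _; rewrite mxE.
have [ij|/eqP ij] := eqVneq (i : nat) j; last by rewrite dS // mul0r.
rewrite (dS (i := i) (j := k)) ?mulr0 // => ik.
by move/eqP: jk; apply; apply: val_inj; rewrite /= -ij -ik.
Qed.

Lemma colsq_le t : 0 <= t -> (forall i j, `|S i j| <= t) -> forall j, colsq 0 j <= t ^+ 2.
Proof.
move=> t0 St j; have [jm|mj] := ltnP j m.
  rewrite (@colsqE (Ordinal jm)) // -(real_normK (num_real (S _ _))).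
  by rewrite lerXn2r ?nnegrE.
rewrite mxE big1 ?sqr_ge0 // => i _; rewrite dS ?expr0n // => ij.
by have := ltn_ord i; rewrite ij ltnNge mj.
Qed.

Variables (U : 'M[R]_m) (V : 'M[R]_n).
Hypotheses (oU : orthogonal_mx U) (oV : orthogonal_mx V).

Lemma gram_svd : (U *m S *m V^T)^T *m (U *m S *m V^T) = V *m diag_mx colsq *m V^T.
Proof.
by rewrite !trmx_mul trmxK -!mulmxA (mulmxA U^T) oU mul1mx (mulmxA S^T) gram_diagonal.
Qed.

Lemma diagonal_bound t : 0 <= t -> (forall i j, `|S i j| <= t) ->
  forall v, dot (U *m S *m V^T *m v) (U *m S *m V^T *m v) <= t ^+ 2 * dot v v.
Proof.
move=> t0 St v; rewrite -gram_dot gram_svd dot_diag.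
have -> : dot v v = dot (V^T *m v) (V^T *m v).
  by rewrite dot_orthogonal //; exact: orthogonal_mx_tr.
rewrite dotE mulr_sumr; apply: ler_sum => j _; rewrite -expr2 ler_wpM2r ?sqr_ge0 //.
exact: colsq_le.
Qed.

Hypothesis S0 : forall i j, 0 <= S i j.

(** The Gram matrix has eigenbasis [V] and eigenvalues the squared singular values; these being
    squares of nonnegative numbers, comparison with [t ^+ 2] is comparison with [t]. The right side
    involves the product only, so the result is the same for every SVD. *)
Lemma threshold_spectral t : 0 <= t ->
  U *m threshold t S *m V^T =
  (U *m S *m V^T) *m mxfun (step (t ^+ 2)) ((U *m S *m V^T)^T *m (U *m S *m V^T)).
Proof.
move=> t0; rewrite gram_svd (mxfunE _ oV erefl) !mulmxA.
rewrite -[in RHS](mulmxA _ V^T V) oV mulmx1 -(mulmxA U S); congr (_ *m _ *m _).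
apply/matrixP => i j; rewrite mul_mx_diag [LHS]mxE [RHS]mxE [X in _ * X]mxE.
have [ij|/eqP ij] := eqVneq (i : nat) j; last first.
  by rewrite (dS ij) mul0r; case: ifP.
rewrite (colsqE ij) /step ltr_sqr ?nnegrE // ltNge.
by case: ifP => _ /=; rewrite ?mulr0 ?mulr1.
Qed.

End Diagonal.

Lemma threshold_bound m n (S : 'M[R]_(m, n)) (U : 'M[R]_m) (V : 'M[R]_n) t :
  (forall (i : 'I_m) (j : 'I_n), (i : nat) <> j -> S i j = 0) ->
  (forall i j, 0 <= S i j) -> orthogonal_mx U -> orthogonal_mx V -> 0 <= t ->
  forall v, dot ((U *m threshold t S *m V^T - U *m S *m V^T) *m v)
    ((U *m threshold t S *m V^T - U *m S *m V^T) *m v) <= t ^+ 2 * dot v v.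
Proof.
move=> dS S0 oU oV t0 v; rewrite -mulmxBl -mulmxBr.
apply: diagonal_bound => // i j; rewrite !mxE.
  by move=> ij; rewrite (dS _ _ ij); case: ifP; rewrite subrr.
by case: ifP => [h|_]; rewrite ?subrr ?normr0 // sub0r normrN ger0_norm.
Qed.

Lemma card_support_rank n (l : 'rV[R]_n) :
  (#|[pred j | l ord0 j != 0%R]| <= \rank (diag_mx l))%N.
Proof.
set D := [pred j | _]; pose f (a : 'I_#|D|) : 'I_n := enum_val a.
pose B := \matrix_(j < n, a < #|D|) ((j == f a)%:R / l 0 j).
have : rowsub f (diag_mx l) *m B = 1%:M.
  apply/matrixP => a b; rewrite !mxE (bigD1 (f a)) //= !mxE eqxx mulr1n big1 ?addr0.
    rewrite mulrCA divff ?mulr1; last by have := enum_valP a.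
    by congr (_%:R); rewrite /f (inj_eq enum_val_inj).
  by move=> j jfa; rewrite !mxE eq_sym (negbTE jfa) mulr0n mul0r.
move=> /(congr1 mxrank); rewrite mxrank1 => <-.
apply: leq_trans (mxrankM_maxl _ _) _; apply: mxrankS; exact: rowsub_sub.
Qed.

(** The trace is expanded in an eigenbasis of [D^T *m D]. At most rank many vectors escape the
    kernel of [D], and each of them contributes at most [c] by Cauchy-Schwarz. *)
Lemma inner_le m n (D A : 'M[R]_(m, n)) k c : 0 < c -> (\rank D <= k)%N ->
  (forall v, dot (D *m v) (D *m v) <= c ^+ 2 * dot v v) ->
  (forall v, dot (A *m v) (A *m v) <= dot v v) ->
  `|inner D A| <= k%:R * c.
Proof.
move=> c0 rD hD hA; have [V [l [oV DE]]] := spectral (gram_sym D).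
have -> : inner D A = \sum_j dot (D *m col j V) (A *m col j V).
  rewrite /inner -[X in \tr X]mulmx1 -(orthogonal_mxC oV) mulmxA mxtrace_mulC.
  apply: eq_bigr => j _; rewrite dot_mull mulmxA /dot tr_col colE rowE !mulmxA.
  by rewrite -colE -!mulmxA -rowE !mxE.
have cV j : dot (col j V) (col j V) = 1.
  have <- : (V^T *m V) j j = 1 by rewrite oV mxE eqxx.
  by rewrite mxE dotE; apply: eq_bigr => i _; rewrite !mxE.
have lE j : dot (D *m col j V) (D *m col j V) = l 0 j.
  rewrite -gram_dot DE dot_diag (bigD1 j) //= big1 ?addr0.
    rewrite (_ : (V^T *m col j V) j 0 = 1) ?expr1n ?mulr1 //.
    by rewrite -(cV j) dotE mxE; apply: eq_bigr => i _; rewrite !mxE.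
  move=> i ij; rewrite (_ : (V^T *m col j V) i 0 = 0) ?expr0n ?mulr0 //.
  have <- : (V^T *m V) i j = 0 by rewrite oV mxE (negbTE ij).
  by rewrite !mxE; apply: eq_bigr => p _; rewrite !mxE.
pose S := [pred j | l ord0 j != 0%R].
have cS : (#|S| <= k)%N.
  apply: leq_trans rD; apply: leq_trans (card_support_rank l) _.
  have -> : diag_mx l = V^T *m (D^T *m D) *m V.
    by rewrite DE !mulmxA oV mul1mx -mulmxA oV mulmx1.
  apply: leq_trans (mxrankM_maxl _ _) _; apply: leq_trans (mxrankM_maxr _ _) _.
  exact: mxrankM_maxr.
apply: (@le_trans _ _ (\sum_(j in S) c)); last first.
  by rewrite sumr_const -(mulr_natl c) ler_wpM2r ?ler_nat ?ltW.
apply: le_trans (ler_norm_sum _ _ _) _.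
rewrite [leRHS]big_mkcond /=; apply: ler_sum => j _; case: ifPn => jS.
  apply: dot_le => //; first by have := hD (col j V); rewrite cV mulr1.
  by have := hA (col j V); rewrite cV.
move: jS; rewrite inE negbK => /eqP lj0.
have /dotvv_eq0 -> : dot (D *m col j V) (D *m col j V) = 0 by rewrite lE.
by rewrite /dot trmx0 mul0mx mxE normr0.
Qed.

(** If too many singular values survived, their right singular space would meet the kernel of [A].
    On a common nonzero vector [v] the matrix would stretch by more than [t], whereas [A v = 0] and
    the error bound allow at most [t]. *)
Lemma rank_threshold m n (S : 'M[R]_(m, n)) (U : 'M[R]_m) (V : 'M[R]_n) (A : 'M[R]_(m, n)) r t :
  (forall (i : 'I_m) (j : 'I_n), (i : nat) <> j -> S i j = 0) ->
  (forall i j, 0 <= S i j) -> orthogonal_mx U -> orthogonal_mx V -> 0 <= t ->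
  (\rank A <= r)%N ->
  (forall v, dot ((U *m S *m V^T - A) *m v) ((U *m S *m V^T - A) *m v) <= t ^+ 2 * dot v v) ->
  (\rank (U *m threshold t S *m V^T) <= r)%N.
Proof.
move=> dS S0 oU oV t0 rA hA; rewrite leqNgt; apply/negP => rr.
have rT : (r < \rank (threshold t S *m V^T))%N.
  by apply: leq_trans rr _; rewrite -mulmxA; exact: mxrankM_maxr.
(* Dimension count: a rank above [r] and a kernel of dimension [n - \rank A >= n - r] cannot be
   disjoint. *)
have : (threshold t S *m V^T :&: kermx A^T)%MS != 0.
  rewrite -mxrank_eq0 -lt0n -(ltn_add2l (\rank (threshold t S *m V^T + kermx A^T)%MS)).
  rewrite addn0 mxrank_sum_cap mxrank_ker mxrank_tr.
  apply: leq_ltn_trans (rank_leq_col _) _.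
  rewrite -{1}(subnKC (rank_leq_col A)) ltn_add2r.
  exact: leq_ltn_trans rA rT.
case/rowV0Pn => v; rewrite sub_capmx => /andP[/submxP [w vE] /sub_kermxP vA] v0.
pose y := (w *m threshold t S)^T.
have vy : v^T = V *m y by rewrite vE /y !trmx_mul trmxK mulmxA.
have Av : A *m v^T = 0 by rewrite -[A]trmxK -trmx_mul vA trmx0.
have := hA v^T; rewrite mulmxBl Av subr0 vy -!mulmxA (mulmxA V^T) oV mul1mx.
rewrite !dot_orthogonal // -gram_dot gram_diagonal // => h.
have y0 : y != 0 by apply: contra v0 => /eqP h0; rewrite -trmx_eq0 vy h0 mulmx0.
have /rV0Pn [j] : y^T != 0 by rewrite trmx_eq0.
rewrite mxE => yj.
have c_t k : y k 0 != 0 -> t ^+ 2 < colsq S 0 k.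
  move=> yk; have [i Tik] : exists i, threshold t S i k != 0.
    apply/existsP; rewrite -negb_forall; apply: contra yk => /forallP T0.
    by rewrite /y mxE mxE big1 // => i _; rewrite (eqP (T0 i)) mulr0.
  move: Tik; rewrite mxE; case: ifP; first by rewrite eqxx.
  move=> /negbT; rewrite -ltNge => tS _.
  have [ik|/eqP ik] := eqVneq (i : nat) k; last first.
    by move: tS; rewrite (dS _ _ ik) ltNge t0.
  by rewrite (colsqE dS ik) ltr_sqr ?nnegrE.
have term k : 0 <= (colsq S 0 k - t ^+ 2) * y k 0 ^+ 2.
  have [->|/c_t h2] := eqVneq (y k 0) 0; first by rewrite expr0n mulr0.
  by rewrite mulr_ge0 ?sqr_ge0 // subr_ge0 ltW.
have : \sum_k (colsq S 0 k - t ^+ 2) * y k 0 ^+ 2 <= 0.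
  under eq_bigr do rewrite mulrBl; rewrite sumrB subr_le0 -mulr_sumr.
  move: h; rewrite !dotE; under eq_bigr do rewrite mul_diag_mx [X in _ * X]mxE mulrCA -expr2.
  by under [X in _ * X]eq_bigr do rewrite -expr2.
rewrite leNgt => /negP; apply; rewrite (bigD1 j) //= ltr_wpDr ?sumr_ge0 //.
by rewrite mulr_gt0 ?subr_gt0 ?c_t // lt_def sqr_ge0 sqrf_eq0 yj.
Qed.

End SingularValues.

(** * Moments of a sample *)

Section SecondMoment.
Context d (T : measurableType d) (R : realType) (P : probability T R).

Lemma L1_bounded (f : T -> R) K : measurable_fun setT f -> (forall w, `|f w| <= K) -> L1 P f.
Proof. by move=> mf fK; exact: (L1_le mf fK (L1_cst P K)). Qed.

Lemma sinh_ge (u : R) : 0 <= u -> 2 * u <= expR u - expR (- u).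
Proof.
move=> u0; pose f (x : R) := expR x - expR (- x) - 2 * x.
have df (x : R) : is_derive x 1 f (expR x + expR (- x) - 2).
  rewrite /f.
  have h1 : is_derive x 1 (fun x : R => expR (- x)) (expR (- x) * -1).
    exact: (@is_derive1_comp R (@expR R) (fun x => - x)).
  have h2 : is_derive x 1 (fun x : R => 2 * x) (2 * 1) by exact: is_deriveZ.
  by apply: is_derive_eq; ring.
suff : f 0 <= f u by rewrite /f oppr0 subrr; lra.
apply: (@ger0_derive1_ndecry R f 0) => //.
  move=> x _; rewrite derive1E (@derive_val _ _ _ _ _ _ _ (df x)).
  have := expR_ge1Dx x; have := expR_ge1Dx (- x); lra.
apply: continuous_subspaceT => x; apply: differentiable_continuous.
by apply/derivable1_diffP; exact: ex_derive.
Qed.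

(** [expR x + expR (- x) - 2] is the square of [expR (x/2) - expR (- (x/2))], so [sinh_ge] suffices.
    This converts bounds on exponential moments into bounds on second moments. *)
Lemma cosh_ge (x : R) : x ^+ 2 <= expR x + expR (- x) - 2.
Proof.
have e : expR x + expR (- x) - 2 = (expR (x / 2) - expR (- (x / 2))) ^+ 2.
  rewrite sqrrB -expRD addrN expR0 !expr2 -!expRD -opprD -splitr; lra.
have h (u : R) : 0 <= u -> (2 * u) ^+ 2 <= (expR u - expR (- u)) ^+ 2.
  move=> u0; have su := sinh_ge u0.
  have u2 : 0 <= 2 * u by rewrite mulr_ge0.
  by rewrite lerXn2r ?nnegrE // (le_trans u2).
rewrite e; have [x0|/ltW x0] := leP 0 x.
  by rewrite -[X in X ^+ 2 <= _](_ : 2 * (x / 2) = x) ?h ?divr_ge0 //; lra.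
have -> : (expR (x / 2) - expR (- (x / 2))) ^+ 2 = (expR (- (x / 2)) - expR (- - (x / 2))) ^+ 2.
  by rewrite opprK -sqrrN opprB.
rewrite -sqrrN -[X in X ^+ 2 <= _](_ : 2 * (- (x / 2)) = - x); last by lra.
by apply: h; lra.
Qed.

Variables (eta : T -> R) (sigma : R).
Hypotheses (meta : measurable_fun setT eta) (sub : subgaussian P sigma eta).

Lemma subgaussian_L1_exp s : L1 P (fun w => expR (s * eta w)).
Proof.
apply/integrableP; split.
  by apply/measurable_EFinP; apply: measurableT_comp => //; exact: measurable_funM.
apply: le_lt_trans (ltry (expR (s ^+ 2 * sigma ^+ 2 / 2))).
apply: le_trans (sub s); rewrite /mmt_gen_fun unlock.
rewrite le_eqVlt; apply/orP; left; apply/eqP; apply: eq_integral => w _ /=.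
by rewrite ger0_norm ?expR_ge0 // mulrC.
Qed.

Lemma subgaussian_mean_exp s : mean P (fun w => expR (s * eta w)) <= expR (s ^+ 2 * sigma ^+ 2 / 2).
Proof.
rewrite -lee_fin -integral_mean; last exact: subgaussian_L1_exp.
apply: le_trans (sub s); rewrite /mmt_gen_fun unlock.
rewrite le_eqVlt; apply/orP; left; apply/eqP; apply: eq_integral => w _ /=.
by rewrite mulrC.
Qed.

Let expD s : L1 P (fun w => expR (s * eta w) + expR (- s * eta w)).
Proof. by apply: L1D; exact: subgaussian_L1_exp. Qed.

Lemma subgaussian_L1_sq : L1 P (fun w => eta w ^+ 2).
Proof.
apply: (L1_le _ _ (expD 1)) => [|w]; first exact: measurable_funX.
rewrite ger0_norm ?sqr_ge0 // mul1r mulN1r; have := cosh_ge (eta w); lra.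
Qed.

Lemma subgaussian_L1 : L1 P eta.
Proof.
apply: (L1_le meta _ (L1D (L1_cst P 1) subgaussian_L1_sq)) => w.
rewrite -(real_normK (num_real (eta w))).
have := sqr_ge0 (`|eta w| - 1); rewrite sqrrB1; have := normr_ge0 (eta w); nra.
Qed.

(** With [u = s^2 sigma^2 / 2], averaging [cosh_ge] gives [s^2 m <= 2 (e^u - 1) <= 2 u e^u], that is
    [m <= sigma^2 e^u]. The limit [s -> 0] is taken along [u = 1/(N+1)], where [e^u (1 - u) <= 1]
    leaves an error [m/(N+1)]. *)
Lemma subgaussian_second_moment : mean P (fun w => eta w ^+ 2) <= sigma ^+ 2.
Proof.
set m := mean _ _.
have m0 : 0 <= m by apply: Rintegral_ge0 => w _; exact: sqr_ge0.
have key s : s != 0 -> m <= sigma ^+ 2 * expR (s ^+ 2 * sigma ^+ 2 / 2).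
  move=> s0; set u := s ^+ 2 * sigma ^+ 2 / 2.
  have : s ^+ 2 * m <= 2 * expR u - 2.
    rewrite -meanZ; last exact: subgaussian_L1_sq.
    apply: (@le_trans _ _ (mean P (fun w => expR (s * eta w) + expR (- s * eta w) - 2))).
      apply: mean_le => [||w].
      - exact: L1Z subgaussian_L1_sq.
      - by apply: L1B => //; exact: L1_cst.
      - by have := cosh_ge (s * eta w); rewrite exprMn mulNr.
    rewrite meanB //; last exact: L1_cst.
    rewrite mean_cst meanD; [|exact: subgaussian_L1_exp..].
    have := subgaussian_mean_exp s; have := subgaussian_mean_exp (- s).
    rewrite sqrrN -/u; lra.
  have : 2 * expR u - 2 <= s ^+ 2 * (sigma ^+ 2 * expR u).
    have := expR_ge1Dx (- u); rewrite -(ler_pM2l (expR_gt0 u)) -expRD subrr expR0.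
    have -> : s ^+ 2 * (sigma ^+ 2 * expR u) = 2 * (u * expR u) by rewrite /u; field.
    by rewrite mulrDr mulr1 mulrN (mulrC u); lra.
  have s2 : 0 < s ^+ 2 by rewrite lt_def sqrf_eq0 s0 sqr_ge0.
  by move=> h1 h2; have := le_trans h2 h1; rewrite ler_pM2l.
have [s0|sn0] := eqVneq sigma 0.
  by have := key 1 (oner_neq0 _); rewrite s0 expr0n mul0r.
apply: (@le_of_harmonic _ _ _ m) => N.
pose u : R := N.+1%:R^-1.
have u0 : 0 < u by rewrite invr_gt0 ltr0n.
have sg : 0 < sigma ^+ 2 by rewrite lt_def sqrf_eq0 sn0 sqr_ge0.
pose s := Num.sqrt (2 * u / sigma ^+ 2).
have ss : s ^+ 2 * sigma ^+ 2 / 2 = u.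
  rewrite sqr_sqrtr; last by rewrite divr_ge0 ?sqr_ge0 // mulr_ge0 // ltW.
  by rewrite divfK ?gt_eqF // mulrAC divff ?mul1r.
have sn : s != 0 by rewrite gt_eqF // sqrtr_gt0 divr_gt0 // mulr_gt0.
have := key s sn; rewrite ss => h.
have h1 : expR u * (1 - u) <= 1.
  have := expR_ge1Dx (- u); rewrite -(ler_pM2l (expR_gt0 u)) -expRD subrr expR0.
  by [].
have u1 : 0 <= 1 - u by rewrite subr_ge0 invf_le1 ?ltr0n // ler1n.
have h2 : m * (1 - u) <= sigma ^+ 2 * expR u * (1 - u) by rewrite ler_wpM2r.
have h3 : sigma ^+ 2 * (expR u * (1 - u)) <= sigma ^+ 2 * 1 by rewrite ler_wpM2l ?sqr_ge0.
by rewrite -/u; move: h2 h3; rewrite mulrA; lra.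
Qed.

End SecondMoment.

Section IndependentMean.
Context d (T : measurableType d) (R : realType) (P : probability T R).

Lemma independent_mean_ge0 (U V : T -> R) : L1 P U -> L1 P V ->
  (forall w, 0 <= U w) -> (forall w, 0 <= V w) -> independent_pair P U V ->
  L1 P (fun w => U w * V w) /\ mean P (fun w => U w * V w) = mean P U * mean P V.
Proof.
move=> hU hV U0 V0 UV; have mU := L1_measurable hU; have mV := L1_measurable hV.
(* Tonelli asks for a function that is nonnegative everywhere; the absolute values provide this and
   change nothing on the values of [U] and [V]. *)
pose f (x : R * R) := (`|x.1| * `|x.2|)%:E.
have mf : measurable_fun setT f.
  apply/measurable_EFinP; apply: measurable_funM; apply: measurableT_comp => //.
have f0 x : (0 <= f x)%E by rewrite lee_fin mulr_ge0.
have E : (\int[P]_w (U w * V w)%:E = (mean P U * mean P V)%:E)%E.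
  have := independent_integral mU mV UV mf f0.
  rewrite /f /= => h; transitivity (\int[P]_w (`|U w| * `|V w|)%:E)%E.
    by apply: eq_integral => w _; rewrite !ger0_norm.
  rewrite h; transitivity (\int[P]_w (mean P V * U w)%:E)%E.
    apply: eq_integral => w _; transitivity (\int[P]_v (U w * V v)%:E)%E.
      by apply: eq_integral => v _; rewrite !ger0_norm.
    by rewrite (integral_mean (L1Z (U w) hV)) meanZ // mulrC.
  by rewrite integral_mean ?meanZ //; [rewrite mulrC|exact: L1Z].
have iUV : L1 P (fun w => U w * V w).
  apply/integrableP; split; first by apply/measurable_EFinP; exact: measurable_funM.
  under eq_integral do rewrite /= ger0_norm ?mulr_ge0 //.
  by rewrite E ltry.
by split => //; move: E; rewrite integral_mean // => -[].
Qed.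

Lemma independent_pair_comp dA dB dC dD (TA : measurableType dA) (TB : measurableType dB)
    (TC : measurableType dC) (TD : measurableType dD) (U : T -> TA) (V : T -> TB)
    (f : TA -> TC) (g : TB -> TD) : measurable_fun setT f -> measurable_fun setT g ->
  independent_pair P U V -> independent_pair P (f \o U) (g \o V).
Proof.
move=> mf mg UV B1 B2 mB1 mB2.
have m1 : measurable (f @^-1` B1) by rewrite -[X in measurable X]setTI; exact: mf.
have m2 : measurable (g @^-1` B2) by rewrite -[X in measurable X]setTI; exact: mg.
exact: (UV _ _ m1 m2).
Qed.

Lemma independent_mean (U V : T -> R) : L1 P U -> L1 P V -> independent_pair P U V ->
  L1 P (fun w => U w * V w) /\ mean P (fun w => U w * V w) = mean P U * mean P V.
Proof.
move=> hU hV UV.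
pose p (x : R) := Num.max x 0; pose q (x : R) : R := Num.max (- x) 0.
have mp : measurable_fun setT p by apply: measurable_maxr.
have mq : measurable_fun setT q by apply: measurable_maxr => //; exact: measurable_funN.
have p0 x : 0 <= p x by rewrite le_max lexx orbT.
have q0 x : 0 <= q x by rewrite le_max lexx orbT.
have pq x : p x - q x = x.
  rewrite /p /q !maxEle oppr_le0.
  by have [x0|x0|->] := ltgtP x 0; rewrite ?sub0r ?opprK ?subr0 ?oppr0.
have pn x : `|p x| <= `|x|.
  by rewrite ger0_norm // ge_max ler_norm normr_ge0.
have qn x : `|q x| <= `|x|.
  by rewrite ger0_norm // ge_max -normrN ler_norm normr_ge0.
have Lp W : L1 P W -> L1 P (p \o W).
  move=> hW; apply: (L1_le (g := fun w => `|W w|)) => [|w|]; last exact: integrable_norm.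
    by apply: measurableT_comp => //; exact: L1_measurable hW.
  exact: pn.
have Lq W : L1 P W -> L1 P (q \o W).
  move=> hW; apply: (L1_le (g := fun w => `|W w|)) => [|w|]; last exact: integrable_norm.
    by apply: measurableT_comp => //; exact: L1_measurable hW.
  exact: qn.
have I (f g : R -> R) : measurable_fun setT f -> measurable_fun setT g ->
    (forall x, 0 <= f x) -> (forall x, 0 <= g x) -> L1 P (f \o U) -> L1 P (g \o V) ->
    L1 P (fun w => f (U w) * g (V w)) /\
    mean P (fun w => f (U w) * g (V w)) = mean P (f \o U) * mean P (g \o V).
  move=> mf mg f0 g0 hf hg; apply: independent_mean_ge0 => //.
  exact: independent_pair_comp.
have [a1 a2] := I p p mp mp p0 p0 (Lp _ hU) (Lp _ hV).
have [b1 b2] := I p q mp mq p0 q0 (Lp _ hU) (Lq _ hV).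
have [c1 c2] := I q p mq mp q0 p0 (Lq _ hU) (Lp _ hV).
have [e1 e2] := I q q mq mq q0 q0 (Lq _ hU) (Lq _ hV).
have -> : (fun w => U w * V w) = (fun w => p (U w) * p (V w) - p (U w) * q (V w)
     - (q (U w) * p (V w) - q (U w) * q (V w))).
  by apply/funext => w; rewrite -{1}(pq (U w)) -{1}(pq (V w)); ring.
have E W : L1 P W -> mean P W = mean P (p \o W) - mean P (q \o W).
  move=> hW; rewrite -meanB; [|exact: Lp|exact: Lq].
  by congr mean; apply/funext => w /=; rewrite pq.
split; first by do 2!apply: L1B => //; exact: L1B.
by rewrite (meanB (L1B a1 b1) (L1B c1 e1)) (meanB a1 b1) (meanB c1 e1)
  (E U) // (E V) // a2 b2 c2 e2; ring.
Qed.

End IndependentMean.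

(* [seq.reshape] shadows the reshaping of the definitions. *)
Local Notation unvec := (@Defs.reshape _ _ _).

Section Vectorization.
Variables (R : realType) (d1 d2 : nat).
Implicit Types A B : 'M[R]_(d1, d2).

Lemma vecE A (k : 'I_d2) (a : 'I_d1) : vec A (mxvec_index k a) 0 = A a k.
Proof. by rewrite /vec mxE mxvecE mxE. Qed.

Lemma reshapeE (v : 'cV[R]_(d2 * d1)) a k : unvec v a k = v (mxvec_index k a) 0.
Proof. by rewrite /Defs.reshape mxE mxE mxE. Qed.

Lemma sum_mxvec (F : 'I_(d2 * d1) -> R) :
  \sum_p F p = \sum_(k < d2) \sum_(a < d1) F (mxvec_index k a).
Proof.
rewrite pair_bigA /= (reindex _ (curry_mxvec_bij d2 d1)) /=.
by apply: eq_bigr => -[k a] _.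
Qed.

Lemma inner_vec A B : inner A B = dot (vec A) (vec B).
Proof.
rewrite dotE sum_mxvec /inner; apply: eq_bigr => k _; rewrite mxE.
by apply: eq_bigr => a _; rewrite !vecE mxE.
Qed.

Lemma dilation_sym A : (dilation A)^T = dilation A.
Proof. by rewrite /dilation tr_block_mx !trmx0 trmxK. Qed.

Lemma dilationZ c A : dilation (c *: A) = c *: dilation A.
Proof. by rewrite /dilation scale_block_mx !scaler0 linearZ. Qed.

Lemma reshapeZ c (v : 'cV[R]_(d2 * d1)) : unvec (c *: v) = c *: unvec v.
Proof. by apply/matrixP => a k; rewrite [RHS]mxE !reshapeE mxE. Qed.

End Vectorization.

Section BorelEntries.
Variables (R : realType) (m n : nat).

Lemma borel_mx_open (U : set 'M[R]_(m, n)) : open U -> measurable (U : set (borel_mx R m n)).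
Proof. by move=> oU; exact: sub_sigma_algebra. Qed.

Lemma measurable_mx_entry i j :
  measurable_fun setT (fun A : borel_mx R m n => (A : 'M[R]_(m, n)) i j).
Proof.
apply: (measurability (@RGenOInfty.G R)); first exact: RGenOInfty.measurableE.
move=> _ [_ [x ->] <-]; rewrite setTI; apply: borel_mx_open.
apply: open_comp => [A _|]; first exact: coord_continuous.
exact: interval_open.
Qed.

End BorelEntries.

Section SampleMoments.
Context d (T : measurableType d) (R : realType) (P : probability T R) (d1 d2 : nat).
Variables (X : T -> borel_mx R d1 d2) (eta : T -> R).
Variables (Delta : 'M[R]_(d1, d2)) (Q : 'M[R]_(d2 * d1)) (R0 sigma : R).
Hypotheses (mX : measurable_fun setT X) (meta : measurable_fun setT eta).
Hypotheses (bX : forall w i j, `|(X w : 'M[R]_(d1, d2)) i j| <= 1).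
Hypotheses (bD : forall w, `|inner Delta (X w)| <= R0).
Hypotheses (eta0 : mean P eta = 0) (sub : subgaussian P sigma eta).
Hypothesis indep : independent_pair P X eta.
Hypotheses (uQ : Q \in unitmx) (R00 : 0 <= R0) (sigma0 : 0 < sigma).
Hypothesis QE : forall p q, mean P (fun w => vec (X w) p 0 * vec (X w) q 0) = Q p q.

(** Every factor that depends on [X] alone is of this kind, and sums and products stay within it.
    Integrability then has to be checked only against [1], [eta] and [eta ^+ 2]. *)
Let bdX (G : borel_mx R d1 d2 -> R) : Prop :=
  measurable_fun setT G /\ exists K, forall w, `|G (X w)| <= K.

Let bd_cst c : bdX (fun=> c).
Proof. by split; [exact: measurable_cst|exists `|c|]. Qed.

Let bdD G H : bdX G -> bdX H -> bdX (fun A => G A + H A).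
Proof.
move=> [mG [K hK]] [mH [L hL]]; split; first exact: measurable_funD.
by exists (K + L) => w; apply: le_trans (ler_normD _ _) _; exact: lerD.
Qed.

Let bdM G H : bdX G -> bdX H -> bdX (fun A => G A * H A).
Proof.
move=> [mG [K hK]] [mH [L hL]]; split; first exact: measurable_funM.
by exists (K * L) => w; rewrite normrM ler_pM.
Qed.

Let bd_sum (I : Type) (s : seq I) (F : I -> borel_mx R d1 d2 -> R) :
  (forall i, bdX (F i)) -> bdX (fun A => \sum_(i <- s) F i A).
Proof.
move=> hF; elim: s => [|i s IH].
  by under eq_fun do rewrite big_nil; exact: bd_cst.
by under eq_fun do rewrite big_cons; exact: bdD.
Qed.

Let bd_entry i j : bdX (fun A => (A : 'M[R]_(d1, d2)) i j).
Proof.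
split; first exact: measurable_mx_entry.
by exists 1 => w; exact: bX.
Qed.

Let bd_vec p : bdX (fun A => vec (A : 'M[R]_(d1, d2)) p 0).
Proof.
by case/mxvec_indexP: p => k a; under eq_fun do rewrite vecE; exact: bd_entry.
Qed.

Let q (A : 'M[R]_(d1, d2)) := invmx Q *m vec A.

Let bd_q p : bdX (fun A => q A p 0).
Proof.
by under eq_fun do rewrite mxE; apply: bd_sum => s; apply: bdM; [exact: bd_cst|exact: bd_vec].
Qed.

Let delta (A : borel_mx R d1 d2) := inner Delta (A : 'M[R]_(d1, d2)).

Let bd_delta : bdX delta.
Proof.
rewrite /delta; under eq_fun do rewrite inner_vec dotE; apply: bd_sum => p.
by apply: bdM; [exact: bd_cst|exact: bd_vec].
Qed.

Let Dq (A : 'M[R]_(d1, d2)) := dilation (unvec (q A)).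

Let bd_Dq i j : bdX (fun A => Dq A i j).
Proof.
rewrite /Dq /dilation; case: (split_ordP i) => k ->; case: (split_ordP j) => l ->.
- by under eq_fun do rewrite block_mxEul mxE; exact: bd_cst.
- by under eq_fun do rewrite block_mxEur reshapeE; exact: bd_q.
- by under eq_fun do rewrite block_mxEdl mxE reshapeE; exact: bd_q.
- by under eq_fun do rewrite block_mxEdr mxE; exact: bd_cst.
Qed.

Let L1_bd G : bdX G -> L1 P (fun w => G (X w)).
Proof. by move=> [mG [K hK]]; apply: (@L1_bounded _ _ _ P (G \o X) K) => //; exact: measurableT_comp. Qed.

Let mean_eta G : bdX G -> L1 P (fun w => G (X w) * eta w) /\ mean P (fun w => G (X w) * eta w) = 0.
Proof.
move=> bG; have [mG _] := bG.
have [h1 h2] := @independent_mean _ _ _ P (G \o X) eta (L1_bd bG) (subgaussian_L1 meta sub)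
  (independent_pair_comp mG (@measurable_id _ _ setT) indep).
by split; [exact: h1|rewrite h2 eta0 mulr0].
Qed.

Let m2 := mean P (fun w => eta w ^+ 2).

Let mean_eta2 G : bdX G -> L1 P (fun w => G (X w) * eta w ^+ 2) /\
  mean P (fun w => G (X w) * eta w ^+ 2) = mean P (fun w => G (X w)) * m2.
Proof.
move=> bG; have [mG _] := bG.
have msq : measurable_fun setT (fun x : R => x ^+ 2) by exact: measurable_funX.
exact: (@independent_mean _ _ _ P (G \o X) _ (L1_bd bG) (subgaussian_L1_sq meta sub)
  (independent_pair_comp mG msq indep)).
Qed.

(** The residual [Y - <Theta0, X>], for [Delta = Theta - Theta0]. *)
Let c w := delta (X w) + eta w.

Let mean_c G : bdX G -> L1 P (fun w => c w * G (X w)) /\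
  mean P (fun w => c w * G (X w)) = mean P (fun w => delta (X w) * G (X w)).
Proof.
move=> bG; have [h1 h2] := mean_eta bG.
have h3 := L1_bd (bdM bd_delta bG).
have -> : (fun w => c w * G (X w)) = (fun w => delta (X w) * G (X w) + G (X w) * eta w).
  by apply/funext => w; rewrite /c; ring.
by split; [exact: L1D|rewrite meanD // h2 addr0].
Qed.

(** The cross term vanishes because the noise is centred and independent of [X]. What is left is at
    most [R0 ^+ 2 + sigma ^+ 2] times the mean of [G], hence below the stated factor. *)
Let mean_c2 G : bdX G -> L1 P (fun w => c w ^+ 2 * G (X w)) /\
  ((forall w, 0 <= G (X w)) ->
   mean P (fun w => c w ^+ 2 * G (X w)) <= (R0 + sigma) ^+ 2 * mean P (fun w => G (X w))).
Proof.
move=> bG; have b1 := bdM (bdM bd_delta bd_delta) bG.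
have b2 := bdM (bdM (bd_cst 2) bd_delta) bG.
have [e1 e2] := mean_eta b2; have [f1 f2] := mean_eta2 bG; have g1 := L1_bd b1.
have -> : (fun w => c w ^+ 2 * G (X w)) = (fun w => delta (X w) * delta (X w) * G (X w) +
    (2 * delta (X w) * G (X w) * eta w + G (X w) * eta w ^+ 2)).
  by apply/funext => w; rewrite /c; ring.
have h := L1D e1 f1.
split => [|G0]; first exact: L1D.
rewrite meanD // meanD // e2 f2 add0r.
have Gm : 0 <= mean P (fun w => G (X w)) by apply: Rintegral_ge0 => w _; exact: G0.
have h1 : mean P (fun w => delta (X w) * delta (X w) * G (X w)) <= R0 ^+ 2 * mean P (fun w => G (X w)).
  rewrite -meanZ; last exact: L1_bd.
  apply: mean_le => // [|w]; first by apply: L1Z; exact: L1_bd.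
  rewrite ler_wpM2r // -expr2 -(real_normK (num_real (delta _))) lerXn2r ?nnegrE //.
have h2 : mean P (fun w => G (X w)) * m2 <= mean P (fun w => G (X w)) * sigma ^+ 2.
  by rewrite ler_wpM2l //; exact: subgaussian_second_moment.
have h3 : 0 <= 2 * R0 * sigma * mean P (fun w => G (X w)) by rewrite !mulr_ge0 // ltW.
have -> : (R0 + sigma) ^+ 2 * mean P (fun w => G (X w)) = R0 ^+ 2 * mean P (fun w => G (X w)) +
  2 * R0 * sigma * mean P (fun w => G (X w)) + mean P (fun w => G (X w)) * sigma ^+ 2 by ring.
lra.
Qed.

Let Qi := invmx Q.

Let sQ : Q^T = Q.
Proof.
apply/matrixP => p r; rewrite mxE -!QE; congr mean; apply/funext => w.
by rewrite mulrC.
Qed.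

Let sQi : Qi^T = Qi.
Proof. by rewrite /Qi trmx_inv sQ. Qed.

(** The vector [Q^-1 vec X] has second moment [Q^-1 Q Q^-T = Q^-1]; this is why [B(Q)] is built from
    blocks of the inverse. *)
Let mean_qq p r : mean P (fun w => q (X w) p 0 * q (X w) r 0) = Qi p r.
Proof.
have E w : q (X w) p 0 * q (X w) r 0 =
    \sum_s \sum_t (Qi p s * Qi r t) * (vec (X w) s 0 * vec (X w) t 0).
  rewrite /q !mxE big_distrlr /=; apply: eq_bigr => s _; apply: eq_bigr => t _.
  by rewrite mulrACA.
under eq_fun do rewrite E.
have Lx s t : L1 P (fun w => vec (X w) s 0 * vec (X w) t 0) by exact: (L1_bd (bdM (bd_vec s) (bd_vec t))).
rewrite mean_sum => [|s]; last by apply: L1_sum => t; exact: L1Z.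
have -> : Qi p r = (Qi *m Q *m Qi^T) p r by rewrite /Qi mulVmx // mul1mx -/Qi sQi.
rewrite -mulmxA mxE; apply: eq_bigr => s _.
rewrite mean_sum => [|t]; last exact: L1Z.
rewrite mxE mulr_sumr; apply: eq_bigr => t _.
by rewrite meanZ // QE mxE; ring.
Qed.

(** Unbiasedness of the one-sample estimator: [Q^-1] cancels the second moment [Q] of [vec X]. *)
Let mean_deltaq p : mean P (fun w => delta (X w) * q (X w) p 0) = vec Delta p 0.
Proof.
have E w : delta (X w) * q (X w) p 0 =
    \sum_s \sum_t (Qi p s * vec Delta t 0) * (vec (X w) s 0 * vec (X w) t 0).
  rewrite /delta inner_vec dotE /q mxE mulrC big_distrlr /=.
  by apply: eq_bigr => s _; apply: eq_bigr => t _; rewrite -/Qi; ring.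
under eq_fun do rewrite E.
have Lx s t : L1 P (fun w => vec (X w) s 0 * vec (X w) t 0) by exact: (L1_bd (bdM (bd_vec s) (bd_vec t))).
rewrite mean_sum => [|s]; last by apply: L1_sum => t; exact: L1Z.
have -> : vec Delta p 0 = (Qi *m (Q *m vec Delta)) p 0 by rewrite mulmxA /Qi mulVmx // mul1mx.
rewrite mxE; apply: eq_bigr => s _.
rewrite mean_sum => [|t]; last exact: L1Z.
rewrite mxE mulr_sumr; apply: eq_bigr => t _.
by rewrite meanZ // QE; ring.
Qed.

Let Z w := dilation (unvec (c w *: q (X w))).

Let ZE w : Z w = c w *: Dq (X w).
Proof. by rewrite /Z reshapeZ dilationZ. Qed.

Let L1mx_Z : L1mx P Z.
Proof.
move=> i j; under eq_fun do rewrite ZE mxE.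
exact: (mean_c (bd_Dq i j)).1.
Qed.

Let meanmx_Z : meanmx P Z = dilation Delta.
Proof.
apply/matrixP => i j; rewrite mxE; under eq_fun do rewrite ZE mxE.
rewrite (mean_c (bd_Dq i j)).2 /Dq /dilation.
case: (split_ordP i) => k ->; case: (split_ordP j) => l ->.
- by under eq_fun do rewrite block_mxEul mxE mulr0; rewrite mean_cst block_mxEul mxE.
- under eq_fun do rewrite block_mxEur reshapeE.
  by rewrite mean_deltaq vecE block_mxEur.
- under eq_fun do rewrite block_mxEdl mxE reshapeE.
  by rewrite mean_deltaq vecE block_mxEdl mxE.
- by under eq_fun do rewrite block_mxEdr mxE mulr0; rewrite mean_cst block_mxEdr mxE.
Qed.

Let bd_DqDq i j : bdX (fun A => (Dq A *m Dq A) i j).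
Proof. by under eq_fun do rewrite mxE; apply: bd_sum => k; exact: bdM. Qed.

Let ZZE w : Z w *m Z w = c w ^+ 2 *: (Dq (X w) *m Dq (X w)).
Proof. by rewrite ZE -scalemxAl -scalemxAr scalerA expr2. Qed.

Let L1mx_ZZ : L1mx P (fun w => Z w *m Z w).
Proof.
move=> i j; under eq_fun do rewrite ZZE mxE.
exact: (mean_c2 (bd_DqDq i j)).1.
Qed.

(** The second moment of the k-th column of the reshaped vector is the block [Dcol Q k]; summing
    over columns produces the first matrix in [B(Q)]. *)
Let mean_col (a : 'cV[R]_d1) :
  mean P (fun w => dot ((unvec (q (X w)))^T *m a) ((unvec (q (X w)))^T *m a)) <= BQ Q * dot a a.
Proof.
have tE (M : 'M[R]_(d1, d2)) i j : M^T i j = M j i by rewrite mxE.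
have E w : dot ((unvec (q (X w)))^T *m a) ((unvec (q (X w)))^T *m a) =
    \sum_k \sum_i \sum_j (a i 0 * a j 0) *
      (q (X w) (mxvec_index k i) 0 * q (X w) (mxvec_index k j) 0).
  rewrite dotE; apply: eq_bigr => k _; rewrite mxE big_distrlr /=.
  by apply: eq_bigr => i _; apply: eq_bigr => j _; rewrite !tE !reshapeE; ring.
under eq_fun do rewrite E.
have Lq s t : L1 P (fun w => q (X w) s 0 * q (X w) t 0) by exact: (L1_bd (bdM (bd_q s) (bd_q t))).
rewrite mean_sum => [|k]; last first.
  by apply: L1_sum => i; apply: L1_sum => j; exact: L1Z.
have -> : \sum_k mean P (fun w => \sum_i \sum_j (a i 0 * a j 0) *
      (q (X w) (mxvec_index k i) 0 * q (X w) (mxvec_index k j) 0)) =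
    dot a ((\sum_k Dcol Q k) *m a).
  rewrite mulmx_suml dotE; under [RHS]eq_bigr do rewrite summxE mulr_sumr.
  rewrite exchange_big /=; apply: eq_bigr => k _.
  rewrite mean_sum => [|i]; last by apply: L1_sum => j; exact: L1Z.
  apply: eq_bigr => i _; rewrite mean_sum => [|j]; last exact: L1Z.
  rewrite mxE mulr_sumr; apply: eq_bigr => j _.
  by rewrite meanZ // mean_qq mxE -/Qi; ring.
have sD : (\sum_k Dcol Q k)^T = \sum_k Dcol Q k.
  rewrite linear_sum /=; apply: eq_bigr => k _; apply/matrixP => i j.
  by rewrite !mxE -/Qi -[in LHS]sQi mxE.
apply: le_trans (lmx_lambda_max sD a) _; rewrite mul_scalar_mx dotZr.
by rewrite ler_wpM2r ?dotvv_ge0 // le_max lexx.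
Qed.

Let mean_row (b : 'cV[R]_d2) :
  mean P (fun w => dot (unvec (q (X w)) *m b) (unvec (q (X w)) *m b)) <= BQ Q * dot b b.
Proof.
have E w : dot (unvec (q (X w)) *m b) (unvec (q (X w)) *m b) =
    \sum_i \sum_k \sum_l (b k 0 * b l 0) *
      (q (X w) (mxvec_index k i) 0 * q (X w) (mxvec_index l i) 0).
  rewrite dotE; apply: eq_bigr => k _; rewrite mxE big_distrlr /=.
  by apply: eq_bigr => i _; apply: eq_bigr => j _; rewrite !reshapeE; ring.
under eq_fun do rewrite E.
have Lq s t : L1 P (fun w => q (X w) s 0 * q (X w) t 0) by exact: (L1_bd (bdM (bd_q s) (bd_q t))).
rewrite mean_sum => [|k]; last first.
  by apply: L1_sum => i; apply: L1_sum => j; exact: L1Z.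
have -> : \sum_i mean P (fun w => \sum_k \sum_l (b k 0 * b l 0) *
      (q (X w) (mxvec_index k i) 0 * q (X w) (mxvec_index l i) 0)) =
    dot b ((\sum_i Drow Q i) *m b).
  rewrite mulmx_suml dotE; under [RHS]eq_bigr do rewrite summxE mulr_sumr.
  rewrite exchange_big /=; apply: eq_bigr => k _.
  rewrite mean_sum => [|i]; last by apply: L1_sum => j; exact: L1Z.
  apply: eq_bigr => i _; rewrite mean_sum => [|j]; last exact: L1Z.
  rewrite mxE mulr_sumr; apply: eq_bigr => j _.
  by rewrite meanZ // mean_qq mxE -/Qi; ring.
have sD : (\sum_k Drow Q k)^T = \sum_k Drow Q k.
  rewrite linear_sum /=; apply: eq_bigr => k _; apply/matrixP => i j.
  by rewrite !mxE -/Qi -[in LHS]sQi mxE.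
apply: le_trans (lmx_lambda_max sD b) _; rewrite mul_scalar_mx dotZr.
by rewrite ler_wpM2r ?dotvv_ge0 // le_max lexx orbT.
Qed.

(** The square of a dilation is block diagonal, so its quadratic form splits into a part for each
    half of [u]. The two halves are governed by the two matrices whose maximum is [B(Q)]. *)
Let second_moment : lmx (meanmx P (fun w => Z w *m Z w)) ((R0 + sigma) ^+ 2 * BQ Q)%:M.
Proof.
move=> u; rewrite -mean_dot // mul_scalar_mx dotZr.
pose G (A : borel_mx R d1 d2) := dot u (Dq A *m Dq A *m u).
have bG : bdX G.
  rewrite /G; under eq_fun do rewrite dotE; apply: bd_sum => i; apply: bdM; first exact: bd_cst.
  by under eq_fun do rewrite mxE; apply: bd_sum => j; apply: bdM => //; exact: bd_cst.
have -> : (fun w => dot u (Z w *m Z w *m u)) = (fun w => c w ^+ 2 * G (X w)).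
  by apply/funext => w; rewrite ZZE -scalemxAl dotZr.
have GE w : G (X w) = dot (unvec (q (X w)) *m dsubmx u) (unvec (q (X w)) *m dsubmx u) +
    dot ((unvec (q (X w)))^T *m usubmx u) ((unvec (q (X w)))^T *m usubmx u).
  have sDq : (Dq (X w))^T = Dq (X w) by exact: dilation_sym.
  rewrite /G -mulmxA -{1}sDq -dot_mull.
  rewrite -[u in Dq _ *m u]vsubmxK /Dq /dilation mul_block_col !mul0mx add0r addr0.
  by rewrite /dot tr_col_mx mul_row_col mxE.
have G0 w : 0 <= G (X w) by rewrite GE addr_ge0 ?dotvv_ge0.
apply: le_trans ((mean_c2 bG).2 G0) _; rewrite -mulrA ler_wpM2l ?sqr_ge0 //.
have -> : dot u u = dot (dsubmx u) (dsubmx u) + dot (usubmx u) (usubmx u).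
  rewrite -{1 2}[u]vsubmxK /dot tr_col_mx mul_row_col mxE addrC.
  by [].
have bdot k (F : 'M[R]_(d1, d2) -> 'cV[R]_k) : (forall i, bdX (fun A => F A i 0)) ->
    L1 P (fun w => dot (F (X w)) (F (X w))).
  move=> bF; apply: (L1_bd (G := fun A => dot (F A) (F A))).
  by under eq_fun do rewrite dotE; apply: bd_sum => i; exact: bdM.
under eq_fun do rewrite GE.
rewrite meanD; last 2 first.
- apply: (bdot _ (fun A => unvec (q A) *m dsubmx u)) => i.
  under eq_fun do rewrite mxE; apply: bd_sum => j; apply: bdM; last exact: bd_cst.
  by under eq_fun do rewrite reshapeE; exact: bd_q.
- apply: (bdot _ (fun A => (unvec (q A))^T *m usubmx u)) => i.
  under eq_fun do rewrite mxE; apply: bd_sum => j; apply: bdM; last exact: bd_cst.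
  by under eq_fun do rewrite mxE reshapeE; exact: bd_q.
by rewrite mulrDr lerD // ?mean_row ?mean_col.
Qed.

Variable nu : R.

Lemma sample_step (H : 'M[R]_(d1 + d2)) : H^T = H ->
  (\int[P]_w (\tr (mxfun expR (H + mxfun (@phi0 R) (nu *: Z w))))%:E <=
   (\tr (mxfun expR (H + (nu *: dilation Delta +
      (nu ^+ 2 * ((R0 + sigma) ^+ 2 * BQ Q) / 2)%:M))))%:E)%E.
Proof.
move=> sH.
have sZ w : (nu *: Z w)^T = nu *: Z w by rewrite linearZ /= dilation_sym.
have mZ i j : measurable_fun setT (fun w => (nu *: Z w) i j).
  by under eq_fun do rewrite mxE; apply: measurable_funM => //; exact: L1_measurable (L1mx_Z i j).
have nuZ : L1mx P (fun w => nu *: Z w).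
  by move=> i j; under eq_fun do rewrite mxE; apply: L1Z; exact: L1mx_Z.
have nuZZE w : (nu *: Z w) *m (nu *: Z w) = nu ^+ 2 *: (Z w *m Z w).
  by rewrite -scalemxAl -scalemxAr scalerA expr2.
have nuZZ : L1mx P (fun w => (nu *: Z w) *m (nu *: Z w)).
  by move=> i j; under eq_fun do rewrite nuZZE mxE; apply: L1Z; exact: L1mx_ZZ.
apply: mean_tr_exp_le => //.
- by rewrite linearD linearZ /= dilation_sym tr_scalar_mx.
- have mA := measurable_mxfun_phi0 mZ sZ.
  move=> i j; apply: measurable_mxfun_expR => [k l|w].
    by under eq_fun do rewrite mxE; apply: measurable_funD => //; exact: mA.
  by rewrite linearD /= sH mxfun_sym.
- have -> : meanmx P (fun w => nu *: Z w) = nu *: dilation Delta.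
    rewrite -meanmx_Z; apply/matrixP => i j; rewrite !mxE.
    by under eq_fun do rewrite mxE; rewrite meanZ //; exact: L1mx_Z.
  have -> : meanmx P (fun w => (nu *: Z w) *m (nu *: Z w)) = nu ^+ 2 *: meanmx P (fun w => Z w *m Z w).
    apply/matrixP => i j; rewrite [RHS]mxE [LHS]mxE [meanmx _ _ _ _]mxE.
    by under eq_fun do rewrite nuZZE mxE; rewrite meanZ //; exact: L1mx_ZZ.
  move=> u; rewrite !mulmxDl !dotDr lerD2l -!scalemxAl !dotZr.
  rewrite mul_scalar_mx dotZr.
  have := second_moment u; rewrite mul_scalar_mx dotZr => h.
  have := ler_wpM2l (sqr_ge0 nu) h; lra.
Qed.

End SampleMoments.

Section PositiveDefinite.
Variable R : realType.

(** The entry is the form of [Q] at [v = Q^-1 e_p]. If it vanished, positivity of all eigenvalues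
    would force [v = 0], against [Q v = e_p]. It serves to show [B(Q) > 0], since [nu] divides by
    [B(Q)]. *)
Lemma invmx_diag_gt0 n (Q : 'M[R]_n) p : Q^T = Q -> Q \in unitmx ->
  (forall u, 0 <= dot u (Q *m u)) -> 0 < invmx Q p p.
Proof.
move=> sQ uQ Q0; pose e : 'cV[R]_n := delta_mx p 0; pose v := invmx Q *m e.
have Qv : Q *m v = e by rewrite /v mulKVmx.
have -> : invmx Q p p = dot v (Q *m v).
  by rewrite Qv dotC /v /dot trmx_delta mulmxA -rowE -colE !mxE.
rewrite lt_def Q0 andbT; apply/negP => /eqP; have [U [l [oU QE]]] := spectral sQ.
have l0 i : 0 < l 0 i.
  have li : eigenvalue Q (l 0 i) by apply/(eigenvalue_diag _ oU QE); exists i.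
  rewrite lt_def; apply/andP; split; last first.
    apply: (lmx_eigenvalue_ge sQ) li => u.
    by rewrite mul_scalar_mx scale0r {1}/dot mulmx0 mxE.
  apply/eqP => li0; have [u /eqP u0] := eigenvector sQ li.
  rewrite li0 scale0r => Qu; apply: u0.
  have -> : u = 0 by rewrite -[u](mulKmx uQ) Qu mulmx0.
  by rewrite /dot mulmx0 mxE.
rewrite {1}QE dot_diag => /eqP; rewrite psumr_eq0 => [/allP h|i _]; last first.
  by rewrite mulr_ge0 ?sqr_ge0 // ltW.
have w0 : U^T *m v = 0.
  apply/colP => i; rewrite [RHS]mxE; apply/eqP.
  have := h i (mem_index_enum i); rewrite /= mulf_eq0 sqrf_eq0.
  by rewrite gt_eqF.
have v0 : v = 0 by rewrite -[v]mul1mx -(orthogonal_mxC oU) -mulmxA w0 mulmx0.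
have /colP/(_ p) : e = 0 by rewrite -Qv v0 mulmx0.
by rewrite !mxE !eqxx => /eqP; rewrite oner_eq0.
Qed.

Lemma BQ_gt0_of_diag d1 d2 (Q : 'M[R]_(d2 * d1)) : (0 < d1)%N -> (0 < d2)%N -> Q^T = Q ->
  (forall p, 0 < invmx Q p p) -> 0 < BQ Q.
Proof.
move=> d10 d20 sQ Qp; rewrite /BQ lt_max; apply/orP; left.
have sD : (\sum_k Dcol Q k)^T = \sum_k Dcol Q k.
  rewrite linear_sum /=; apply: eq_bigr => k _; apply/matrixP => i j.
  by rewrite !mxE -[X in invmx X _ _ = _]sQ -trmx_inv mxE.
have := lmx_lambda_max sD (delta_mx (Ordinal d10) 0).
rewrite mul_scalar_mx dotZr /dot trmx_delta mulmxA -rowE -colE mul_delta_mx !mxE /= mulr1.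
apply: lt_le_trans; rewrite summxE (bigD1 (Ordinal d20)) //= ltr_wpDr //.
  by apply: sumr_ge0 => k _; rewrite mxE ltW.
by rewrite mxE.
Qed.

End PositiveDefinite.

Definition update (R : realType) n1 n2 (Qi : 'M[R]_(n2 * n1)) (nu : R) (H : 'M[R]_(n1 + n2))
    (c : R) (a : 'M[R]_(n1, n2)) : 'M[R]_(n1 + n2) :=
  H + mxfun (@phi0 R) (nu *: dilation (unvec (c *: (Qi *m vec a)))).

Section MeasurableUpdate.
Context d (T : measurableType d) (R : realType) (d1 d2 : nat).
Variables (Qi : 'M[R]_(d2 * d1)) (nu : R).
Variables (H : T -> 'M[R]_(d1 + d2)) (c : T -> R) (X : T -> 'M[R]_(d1, d2)).
Hypotheses (mH : forall i j, measurable_fun setT (fun w => H w i j)).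
Hypotheses (mc : measurable_fun setT c) (mX : forall i j, measurable_fun setT (fun w => X w i j)).

Lemma measurable_update i j : measurable_fun setT (fun w => update Qi nu (H w) (c w) (X w) i j).
Proof.
rewrite /update; under eq_fun do rewrite mxE; apply: measurable_funD => //.
have mv p : measurable_fun setT (fun w => (c w *: (Qi *m vec (X w))) p 0).
  under eq_fun do rewrite mxE; apply: measurable_funM => //.
  under eq_fun do rewrite mxE; apply: measurable_sum => s; apply: measurable_funM => //.
  by case/mxvec_indexP: s => k a; under eq_fun do rewrite vecE; exact: mX.
apply: measurable_mxfun_phi0 => [k l|w]; last by rewrite linearZ /= dilation_sym.
under eq_fun do rewrite mxE; apply: measurable_funM => //.
rewrite /dilation; case: (split_ordP k) => a ->; case: (split_ordP l) => b ->.
- by under eq_fun do rewrite block_mxEul mxE; exact: measurable_cst.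
- by under eq_fun do rewrite block_mxEur reshapeE; exact: mv.
- by under eq_fun do rewrite block_mxEdl mxE reshapeE; exact: mv.
- by under eq_fun do rewrite block_mxEdr mxE; exact: measurable_cst.
Qed.

Hypothesis sH : forall w, (H w)^T = H w.

Lemma update_sym w : (update Qi nu (H w) (c w) (X w))^T = update Qi nu (H w) (c w) (X w).
Proof. by rewrite /update linearD /= sH mxfun_sym // linearZ /= dilation_sym. Qed.

Lemma measurable_tr_exp_update :
  measurable_fun setT (fun w => \tr (mxfun expR (update Qi nu (H w) (c w) (X w)))).
Proof.
apply: measurable_sum => i; apply: measurable_mxfun_expR => [k l|w].
  exact: measurable_update.
exact: update_sym.
Qed.

End MeasurableUpdate.

Section OneStep.
Context d (T : measurableType d) (R : realType) (P : probability T R) (d1 d2 : nat).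
Variables (A : set 'M[R]_(d1, d2)) (pi : probability (borel_mx R d1 d2) R).
Variables (X : {RV P >-> borel_mx R d1 d2}) (eta : {RV P >-> R}).
Variables (Delta : 'M[R]_(d1, d2)) (R0 sigma : R).
Hypotheses (piA : carried_by pi A) (uQ : covmx pi \in unitmx).
Hypothesis XE : forall B : set (borel_mx R d1 d2), measurable B -> distribution P X B = pi B.
Hypotheses (eta0 : ('E_P[eta] = 0)%E) (sub : subgaussian P sigma eta).
Hypothesis indep : independent_pair P X eta.
Hypothesis opA : forall a, A a -> opnorm a <= 1.
Hypothesis DA : forall a, A a -> `|inner Delta a| <= R0.
Hypotheses (R00 : 0 <= R0) (sigma0 : 0 < sigma).

Let K : set (borel_mx R d1 d2) := [set a : 'M[R]_(d1, d2) |
  (forall i j, `|a i j| <= 1) /\ `|inner Delta a| <= R0].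

Let AK : A `<=` K.
Proof.
move=> a Aa; split; last exact: DA.
move=> i j; have := opnorm_bound (delta_mx j 0) (opA Aa).
rewrite expr1n mul1r {2}/dot trmx_delta mul_delta_mx !mxE eqxx -colE dotE => h.
rewrite -ler_sqr ?nnegrE // expr1n real_normK ?num_real //; apply: le_trans h.
rewrite (bigD1 i) //= !mxE -expr2 lerDl; apply: sumr_ge0 => k _.
by rewrite -expr2 sqr_ge0.
Qed.

Let m_inner : measurable_fun setT (fun a : borel_mx R d1 d2 => inner Delta (a : 'M[R]_(d1, d2))).
Proof.
under eq_fun do rewrite inner_vec dotE; apply: measurable_sum => p.
apply: measurable_funM => //; case/mxvec_indexP: p => k a.
by under eq_fun do rewrite vecE; exact: measurable_mx_entry.
Qed.

Let le_measurable (f : borel_mx R d1 d2 -> R) c : measurable_fun setT f ->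
  measurable [set a | `|f a| <= c].
Proof.
move=> mf; have mnf : measurable_fun setT (fun a => `|f a|) by exact: measurableT_comp.
rewrite (_ : [set a | _] = (fun a => `|f a|) @^-1` `]-oo, c]%classic).
  by rewrite -[X in measurable X]setTI; exact: mnf.
by apply/seteqP; split => a /=; rewrite in_itv.
Qed.

Let mK : measurable K.
Proof.
have -> : K = (\bigcap_i \bigcap_j [set a : borel_mx R d1 d2 | `|(a : 'M[R]_(d1, d2)) i j| <= 1]) `&`
    [set a : borel_mx R d1 d2 | `|inner Delta (a : 'M[R]_(d1, d2))| <= R0].
  apply/seteqP; split => [a [h1 h2]|a [h1 h2]].
    by split => // i _ j _; exact: h1.
  by split => // i j; exact: h1.
apply: measurableI; last exact: le_measurable.
apply: fin_bigcap_measurable => // i _; apply: fin_bigcap_measurable => // j _.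
by apply: le_measurable; exact: measurable_mx_entry.
Qed.

Let piK : pi K = 1%E. Proof. exact: piA. Qed.

(* [X] is in [A] only almost surely and [A] need not be measurable; [psi] fixes
   the measurable superset [K] of [A] and kills the rest, so that bounds on
   [psi (X w)] hold for every [w]. *)
Let psi (a : borel_mx R d1 d2) : borel_mx R d1 d2 := \1_K a *: (a : 'M[R]_(d1, d2)).

Let psiK a : K a -> psi a = a.
Proof. by move=> Ka; rewrite /psi indicE mem_set // scale1r. Qed.

Let psiNK a : ~ K a -> psi a = (0 : 'M[R]_(d1, d2)).
Proof. by move=> Ka; rewrite /psi indicE memNset // scale0r. Qed.

Let m_psi : measurable_fun setT psi.
Proof.
apply: measurable_borel_mx => i j; rewrite /psi; under eq_fun do rewrite mxE.
apply: measurable_funM; last exact: measurable_mx_entry.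
exact: measurable_indic.
Qed.

Let psi_le a i j : `|(psi a : 'M[R]_(d1, d2)) i j| <= 1.
Proof.
by have [/[dup] [[h _] /psiK ->]|/psiNK ->] := pselect (K a); rewrite ?h // mxE normr0.
Qed.

Let psi_inner a : `|inner Delta (psi a)| <= R0.
Proof.
have [/[dup] [[_ h] /psiK ->]|/psiNK ->] := pselect (K a); rewrite ?h //.
by rewrite /inner mulmx0 mxtrace0 normr0.
Qed.

Let ae_psi : {ae pi, forall a, K a}.
Proof.
exists (~` K); split => //; first exact: measurableC.
by rewrite probability_setC // piK subee.
Qed.

Let X' w := psi (X w).

Let mX' : measurable_fun setT X'.
Proof. exact: (measurableT_comp m_psi). Qed.

Let aeX : {ae P, forall w, X w = X' w}.
Proof.
exists (X @^-1` (~` K)); split.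
- by rewrite -[X in measurable X]setTI; apply: measurable_funP => //; exact: measurableC.
- have := XE (measurableC mK); rewrite /distribution /pushforward => ->.
  by rewrite probability_setC // piK subee.
- by move=> w /=; apply: contra_not => Kx; rewrite /X' psiK.
Qed.

Let m_vec p : measurable_fun setT (fun a : borel_mx R d1 d2 => vec (a : 'M[R]_(d1, d2)) p 0).
Proof.
by case/mxvec_indexP: p => k a; under eq_fun do rewrite vecE; exact: measurable_mx_entry.
Qed.

Let vec_le a p : `|vec (psi a) p 0| <= 1.
Proof. by case/mxvec_indexP: p => k i; rewrite vecE; exact: psi_le. Qed.

Let covE p q : mean P (fun w => vec (X' w) p 0 * vec (X' w) q 0) = covmx pi p q.
Proof.
pose f (a : borel_mx R d1 d2) : R := vec a p 0 * vec a q 0.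
have mf : measurable_fun setT f by exact: measurable_funM.
have mfpsi : measurable_fun setT (f \o psi) by exact: measurableT_comp.
rewrite /covmx mxE unlock /mean /Rintegral; congr fine.
have b w : `|f (psi w)| <= 1 by rewrite /f normrM -[leRHS]mulr1 ler_pM.
transitivity (\int[pi]_a (f (psi a))%:E)%E; last first.
  apply: ae_eq_integral => //; [exact/measurable_EFinP|exact/measurable_EFinP|].
  by apply: filterS ae_psi => a Ka _; rewrite psiK.
transitivity (\int[distribution P X]_a (f (psi a))%:E)%E; last first.
  by apply: eq_measure_integral => B mB _; exact: XE.
rewrite integral_distribution //; first exact/measurable_EFinP.
by apply: (@L1_bounded _ _ _ P (f \o psi \o X) 1) => [|w]; [exact: (measurableT_comp mfpsi)|exact: b].
Qed.

Let mean_eta0 : mean P eta = 0.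
Proof. by move: eta0; rewrite unlock /mean /Rintegral => ->. Qed.

Let indep' : independent_pair P X' eta.
Proof. exact: (independent_pair_comp m_psi (@measurable_id _ _ setT) indep). Qed.

Lemma one_step_BQ_gt0 : (0 < d1)%N -> (0 < d2)%N -> 0 < BQ (covmx pi).
Proof.
move=> d10 d20.
have sQ : (covmx pi)^T = covmx pi.
  apply/matrixP => p q; rewrite mxE -!covE; congr mean; apply/funext => w.
  by rewrite mulrC.
apply: BQ_gt0_of_diag => // p; apply: invmx_diag_gt0 => // u.
have L s t : L1 P (fun w => vec (X' w) s 0 * vec (X' w) t 0).
  apply: (@L1_bounded _ _ _ P _ 1) => [|w]; last first.
    by rewrite normrM -[leRHS]mulr1; apply: ler_pM => //; exact: vec_le.
  by apply: measurable_funM; [exact: (measurableT_comp (m_vec s))|exact: (measurableT_comp (m_vec t))].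
have -> : dot u (covmx pi *m u) = mean P (fun w => dot u (vec (X' w)) ^+ 2).
  have E w : dot u (vec (X' w)) ^+ 2 =
      \sum_s \sum_t (u s 0 * u t 0) * (vec (X' w) s 0 * vec (X' w) t 0).
    rewrite expr2 dotE big_distrlr /=; apply: eq_bigr => s _; apply: eq_bigr => t _.
    by rewrite mulrACA.
  under [in RHS]eq_fun do rewrite E.
  rewrite mean_sum => [|s]; last by apply: L1_sum => t; exact: L1Z.
  rewrite dotE; apply: eq_bigr => s _.
  rewrite mean_sum => [|t]; last exact: L1Z.
  rewrite mxE mulr_sumr; apply: eq_bigr => t _.
  by rewrite meanZ // covE; ring.
by apply: Rintegral_ge0 => w _; exact: sqr_ge0.
Qed.

Lemma one_step nu (H : 'M[R]_(d1 + d2)) : H^T = H ->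
  (\int[P]_w (\tr (mxfun expR
     (update (invmx (covmx pi)) nu H (inner Delta (X w) + eta w) (X w))))%:E <=
   (\tr (mxfun expR (H + (nu *: dilation Delta +
      (nu ^+ 2 * ((R0 + sigma) ^+ 2 * BQ (covmx pi)) / 2)%:M))))%:E)%E.
Proof.
move=> sH.
have mentry (Y : T -> borel_mx R d1 d2) : measurable_fun setT Y ->
    forall i j, measurable_fun setT (fun w => (Y w : 'M[R]_(d1, d2)) i j).
  by move=> mY i j; exact: (measurableT_comp (measurable_mx_entry i j)).
have mc (Y : T -> borel_mx R d1 d2) : measurable_fun setT Y ->
    measurable_fun setT (fun w => inner Delta (Y w) + eta w).
  by move=> mY; apply: measurable_funD => //; exact: (measurableT_comp m_inner).
have mf (Y : T -> borel_mx R d1 d2) (mY : measurable_fun setT Y) :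
    measurable_fun setT (fun w => (\tr (mxfun expR (update (invmx (covmx pi)) nu H
      (inner Delta (Y w) + eta w) (Y w))))%:E).
  apply/measurable_EFinP; apply: (@measurable_tr_exp_update _ T R d1 d2 _ nu (fun=> H)) => //.
    exact: mc.
  exact: mentry.
have mX : measurable_fun setT (X : T -> borel_mx R d1 d2) by exact: measurable_funP.
pose F (Y : T -> borel_mx R d1 d2) w := (\tr (mxfun expR (update (invmx (covmx pi)) nu H
      (inner Delta (Y w) + eta w) (Y w))))%:E.
have -> : (\int[P]_w F X w = \int[P]_w F X' w)%E.
  apply: ae_eq_integral => //; [exact: mf|exact: mf|].
  by apply: filterS aeX => w XX' _; rewrite /F XX'.
by apply: (sample_step (R0 := R0) (Q := covmx pi)) => // w *; [exact: psi_le|exact: psi_inner].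
Qed.

End OneStep.

(** * Error of one run *)

Section RunError.
Variables (R : realType) (d1 d2 : nat).

Lemma dilationD (A B : 'M[R]_(d1, d2)) : dilation (A + B) = dilation A + dilation B.
Proof. by rewrite /dilation add_block_mx !addr0 linearD. Qed.

Lemma dilationN (A : 'M[R]_(d1, d2)) : dilation (- A) = - dilation A.
Proof. by rewrite -(scaleN1r A) dilationZ scaleN1r. Qed.

Lemma htD (M N : 'M[R]_(d1 + d2)) : ht (M + N) = ht M + ht N.
Proof. by apply/matrixP => i j; rewrite !mxE. Qed.

Lemma htZ c (M : 'M[R]_(d1 + d2)) : ht (c *: M) = c *: ht M.
Proof. by apply/matrixP => i j; rewrite !mxE. Qed.

(* Conjugation by diag(1, -1) negates a dilation, so odd functions map
   dilations to dilations. *)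
Lemma mxfun_phi0_dilation (A : 'M[R]_(d1, d2)) :
  mxfun (@phi0 R) (dilation A) = dilation (ht (mxfun (@phi0 R) (dilation A))).
Proof.
set M := mxfun _ _; pose J : 'M[R]_(d1 + d2) := block_mx 1%:M 0 0 (- 1%:M).
have JT : J^T = J by rewrite /J tr_block_mx !trmx0 linearN /= !trmx1.
have Jconj a b c e : J *m block_mx a b c e *m J^T = block_mx a (- b) (- c) e.
  rewrite JT /J !mulmx_block !(mulmx0, mul0mx, mul1mx, mulNmx, mulmxN, oppr0, addr0, add0r).
  by rewrite !(mulmx1, mul1mx, opprK).
have oJ : orthogonal_mx J.
  by rewrite /orthogonal_mx JT -{2}JT -[X in X *m _]mulmx1 (@scalar_mx_block _ d1 d2) Jconj !oppr0.
have JD : J *m dilation A *m J^T = - dilation A.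
  by rewrite /dilation Jconj opp_block_mx !oppr0.
have sM : M^T = M by rewrite mxfun_sym // dilation_sym.
have JM : J *m M *m J^T = - M.
  rewrite -(mxfun_conj (dilation_sym A)) // JD mxfunN ?dilation_sym //.
  rewrite -scaleN1r mxfunZ ?dilation_sym //; apply: eq_mxfun; first exact: dilation_sym.
  by move=> a _; rewrite phi0N mulN1r.
move: JM; rewrite -{1}[M]submxK Jconj -{5}[M]submxK opp_block_mx.
move=> /eq_block_mx [e1 _ _ e4].
have z1 : ulsubmx M = 0.
  by apply/matrixP => i j; move/matrixP/(_ i j): e1; rewrite !mxE; lra.
have z4 : drsubmx M = 0.
  by apply/matrixP => i j; move/matrixP/(_ i j): e4; rewrite !mxE; lra.
rewrite -[LHS]submxK z1 z4 /dilation /ht; congr block_mx.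
by rewrite -[in LHS]sM trmx_ursub.
Qed.

Variables (sigma R0 delta : R) (Q : 'M[R]_(d2 * d1)) (s : seq ('M[R]_(d1, d2) * R)).
Variables (theta Theta : 'M[R]_(d1, d2)).
Hypotheses (B0 : 0 < BQ Q) (m0 : (0 < size s)%N) (L0 : 0 < logterm d1 d2 delta).
Hypothesis sR0 : 0 < sigma + R0.

Let L := logterm d1 d2 delta.
Let m : R := (size s)%:R.
Let nu := lowpopart_nu sigma R0 delta Q (size s).

Definition center (nu sigma R0 : R) (Q : 'M[R]_(d2 * d1)) (D : 'M[R]_(d1, d2)) : 'M[R]_(d1 + d2) :=
  nu *: dilation D + (nu ^+ 2 * ((R0 + sigma) ^+ 2 * BQ Q) / 2)%:M.

Hypothesis small : \tr (mxfun expR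
  (\sum_(z <- s) mxfun (@phi0 R) (nu *: dilation (unvec (one_sample Q theta z)))
    - m *: center nu sigma R0 Q (Theta - theta))) < expR L.

Let mp : 0 < m. Proof. by rewrite ltr0n. Qed.

Let nu2 : nu ^+ 2 = 2 * L / (BQ Q * m * (sigma + R0) ^+ 2).
Proof.
rewrite /nu /lowpopart_nu exprMn sqr_sqrtr; last first.
  by apply: ltW; rewrite mulr_gt0 // divr_gt0 // mulr_gt0.
rewrite -/L -/m; field; rewrite !gt_eqF //.
Qed.

Let nu0 : 0 < nu.
Proof.
by rewrite /nu /lowpopart_nu mulr_gt0 ?invr_gt0 // sqrtr_gt0 mulr_gt0 // divr_gt0 // mulr_gt0.
Qed.

Lemma tr_exp_lt_lmx n (H : 'M[R]_n) a : H^T = H -> \tr (mxfun expR H) < expR a -> lmx H a%:M.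
Proof.
move=> sH tH; apply: eigenvalue_le_lmx => // b hb; rewrite -ler_expR; apply: ltW.
apply: le_lt_trans tH; have sE := mxfun_sym sH (@expR R).
have : eigenvalue (mxfun expR H) (expR b) by apply/(eigenvalue_mxfun sH); exists b.
have [U [l [oU EE]]] := spectral sE.
move=> /(eigenvalue_diag _ oU EE) [k ->].
rewrite {1}EE -mulmxA mxtrace_mulC -mulmxA oU mulmx1 mxtrace_diag (bigD1 k) //= lerDl.
apply: sumr_ge0 => i _.
have : eigenvalue (mxfun expR H) (l 0 i) by apply/(eigenvalue_diag _ oU EE); exists i.
by move=> /(eigenvalue_mxfun sH) [c _ ->]; exact: expR_ge0.
Qed.

Let D := lowpopart_Theta1 sigma s Q theta R0 delta - Theta.

(** The choice of [nu] makes the second-order term [m nu^2 (R0 + sigma)^2 B(Q) / 2] equal to the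
    exponential level [L]. The error is then at most [t = 2 L / (m nu)], and [t^2] is half the
    squared threshold, which leaves a factor of sqrt 2 to spare. *)
Lemma run_error v :
  dot (D *m v) (D *m v) <= lowpopart_threshold sigma R0 delta Q (size s) ^+ 2 * dot v v.
Proof.
move: small; set H := (X in mxfun expR X) => hH.
pose Phi := \sum_(z <- s) mxfun (@phi0 R) (nu *: dilation (unvec (one_sample Q theta z))).
have PhiE : Phi = dilation (ht Phi).
  rewrite /Phi; move: nu => u; elim: s => [|z t IH].
    rewrite big_nil (_ : ht 0 = 0); last by apply/matrixP => i j; rewrite !mxE.
    by rewrite /dilation trmx0 block_mx0.
  rewrite big_cons htD dilationD -IH; congr (_ + _).
  by rewrite -dilationZ; exact: mxfun_phi0_dilation.
have DE : D = (m * nu)^-1 *: (ht Phi - (m * nu) *: (Theta - theta)).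
  have mnu : m * nu != 0 by rewrite gt_eqF // mulr_gt0.
  rewrite (scalerBr (m * nu)^-1) (scalerA (m * nu)^-1) mulVf // scale1r.
  rewrite /D /lowpopart_Theta1 htZ -/m -/nu -/Phi opprB addrA.
  by rewrite (addrC theta).
have HE : H = (m * nu) *: dilation D - (m * (nu ^+ 2 * ((R0 + sigma) ^+ 2 * BQ Q) / 2))%:M.
  have mnu : m * nu != 0 by rewrite gt_eqF // mulr_gt0.
  have DE2 : (m * nu) *: D = ht Phi - (m * nu) *: (Theta - theta).
    by rewrite DE (scalerA (m * nu)) mulfV // scale1r.
  rewrite -dilationZ DE2 dilationD dilationN.
  rewrite -PhiE /H -/Phi /center scalerDr opprD addrA scale_scalar_mx.
  by rewrite dilationZ scalerA.
have sH : H^T = H by rewrite HE linearB linearZ /= dilation_sym tr_scalar_mx.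
have e1 : m * (nu ^+ 2 * ((R0 + sigma) ^+ 2 * BQ Q) / 2) = L.
  by rewrite nu2 [R0 + _]addrC; field; rewrite !gt_eqF.
pose t := 2 * L / (m * nu).
have t0 : 0 < t by rewrite /t; apply: divr_gt0; apply: mulr_gt0.
have hD : lmx (dilation D) t%:M.
  move=> u; have := tr_exp_lt_lmx sH hH u.
  rewrite HE e1 mulmxBl -scalemxAl dotBr dotZr !mul_scalar_mx !dotZr => h.
  have mnu : 0 < m * nu by exact: mulr_gt0.
  rewrite /t mulrAC ler_pdivlMr // [leLHS]mulrC; lra.
apply: le_trans (dilation_bound t0 hD v) _; rewrite ler_wpM2r ?dotvv_ge0 //.
have -> : t ^+ 2 = 2 * L * BQ Q * (sigma + R0) ^+ 2 / m.
  have -> : t ^+ 2 = (2 * L) ^+ 2 / (m ^+ 2 * nu ^+ 2).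
    by rewrite /t expr_div_n [(m * nu) ^+ 2]exprMn.
  rewrite nu2; field; by rewrite !gt_eqF.
rewrite /lowpopart_threshold exprMn sqr_sqrtr; last first.
  by rewrite divr_ge0 ?mulr_ge0 ?ltW.
rewrite -/L -/m [R0 + _]addrC.
have -> : (2 * (sigma + R0)) ^+ 2 * (BQ Q * L / m) =
   2 * (2 * L * BQ Q * (sigma + R0) ^+ 2 / m) by ring.
have : 0 <= 2 * L * BQ Q * (sigma + R0) ^+ 2 / m.
  by rewrite divr_ge0 ?ltW // !mulr_gt0 // exprn_gt0.
lra.
Qed.

Lemma threshold_gt0 : 0 < lowpopart_threshold sigma R0 delta Q (size s).
Proof.
rewrite /lowpopart_threshold mulr_gt0 ?sqrtr_gt0 ?divr_gt0 ?mulr_gt0 //.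
by rewrite addrC.
Qed.

Lemma lowpopart_error out r : (\rank Theta <= r)%N -> lowpopart sigma s Q theta R0 delta out ->
  (\rank out <= r)%N /\ forall v, dot ((out - Theta) *m v) ((out - Theta) *m v) <=
    (2 * lowpopart_threshold sigma R0 delta Q (size s)) ^+ 2 * dot v v.
Proof.
move=> rT [U [S [V [[oU oV dS S0 E] ->]]]]; set tau := lowpopart_threshold _ _ _ _ _.
have t0 : 0 <= tau by rewrite ltW // threshold_gt0.
have err := run_error; split.
  apply: (rank_threshold dS S0 oU oV t0 rT) => v; rewrite -E; exact: err.
move=> v.
have h1 := threshold_bound dS S0 oU oV t0 v; rewrite -E in h1.
have h2 := err v; rewrite /= -/tau in h2.
set A := U *m threshold tau S *m V^T in h1 *.
set T1 := lowpopart_Theta1 _ _ _ _ _ _ in h1 h2.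
have -> : (A - Theta) *m v = (A - T1) *m v + (T1 - Theta) *m v.
  by rewrite -mulmxDl addrA subrK.
move: h1 h2; set x := (A - T1) *m v; set y := (T1 - Theta) *m v => h1 h2.
(* [|x + y|^2 <= 2 |x|^2 + 2 |y|^2], for the thresholding error [x] and the estimation error [y]. *)
have := dotvv_ge0 (x - y); rewrite !dotBl !dotBr !dotDl !dotDr (dotC y x).
rewrite exprMn; lra.
Qed.

End RunError.

(** * The two runs as a single chain *)

Section StateSpace.
Variables (R : realType) (d1 d2 : nat).
Notation state := (borel_mx R d1 d2 * borel_mx R (d1 + d2) (d1 + d2))%type.
Notation sample := (borel_mx R d1 d2 * R)%type.
Variables (Q : 'M[R]_(d2 * d1)) (Theta : 'M[R]_(d1, d2)) (sigma : R).

(* The states have arbitrary matrices as second component, although only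
   symmetric ones are reached; [symm] makes the spectral calculus available on
   all of them. *)
Definition symm n (H : 'M[R]_n) : 'M[R]_n := 2^-1 *: (H + H^T).

Lemma symm_sym n (H : 'M[R]_n) : (symm H)^T = symm H.
Proof. by rewrite /symm linearZ linearD /= trmxK addrC. Qed.

Lemma symm_id n (H : 'M[R]_n) : H^T = H -> symm H = H.
Proof. by move=> sH; rewrite /symm sH; apply/matrixP => i j; rewrite !mxE; lra. Qed.

Lemma center_sym nu R0 (D : 'M[R]_(d1, d2)) : (center nu sigma R0 Q D)^T = center nu sigma R0 Q D.
Proof. by rewrite /center linearD linearZ /= dilation_sym tr_scalar_mx. Qed.

Definition advance (R0 nu : R) (p : state * sample) : state :=
  (p.1.1, update (invmx Q) nu (symm p.1.2) (p.2.2 - inner p.1.1 p.2.1) p.2.1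
          - center nu sigma R0 Q (Theta - p.1.1)).

Section Measurability.
Context d (T : measurableType d).

Lemma measurable_entries m n (M : T -> borel_mx R m n) : measurable_fun setT M ->
  forall i j, measurable_fun setT (fun w => (M w : 'M[R]_(m, n)) i j).
Proof. by move=> mM i j; exact: (measurableT_comp (measurable_mx_entry i j)). Qed.

Lemma measurable_inner (M N : T -> borel_mx R d1 d2) :
  measurable_fun setT M -> measurable_fun setT N ->
  measurable_fun setT (fun w => inner (M w : 'M[R]_(d1, d2)) (N w)).
Proof.
move=> mM mN; under eq_fun do rewrite inner_vec dotE; apply: measurable_sum => p.
case/mxvec_indexP: p => k a; under eq_fun do rewrite !vecE.
by apply: measurable_funM; exact: measurable_entries.
Qed.

Lemma measurable_symm n (H : T -> borel_mx R n n) : measurable_fun setT H ->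
  forall i j, measurable_fun setT (fun w => symm (H w : 'M[R]_n) i j).
Proof.
move=> mH i j; rewrite /symm; under eq_fun do rewrite !mxE.
by apply: measurable_funM => //; apply: measurable_funD; exact: measurable_entries.
Qed.

Lemma measurable_tr_exp (H : T -> borel_mx R (d1 + d2) (d1 + d2)) : measurable_fun setT H ->
  measurable_fun setT (fun w => \tr (mxfun expR (symm (H w : 'M[R]_(d1 + d2))))).
Proof.
move=> mH; apply: measurable_sum => i; apply: measurable_mxfun_expR => [k l|w].
  exact: measurable_symm.
exact: symm_sym.
Qed.

End Measurability.

Lemma measurable_advance R0 nu : measurable_fun setT (advance R0 nu).
Proof.
have m1 : measurable_fun setT (fun p : state * sample => p.1.1) by exact: measurableT_comp.
have m2 : measurable_fun setT (fun p : state * sample => p.1.2) by exact: measurableT_comp.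
have m3 : measurable_fun setT (fun p : state * sample => p.2.1) by exact: measurableT_comp.
have m4 : measurable_fun setT (fun p : state * sample => p.2.2) by exact: measurableT_comp.
apply: measurable_fun_pair => //; apply: measurable_borel_mx => i j.
under eq_fun do rewrite mxE.
apply: measurable_funD.
  apply: measurable_update => [k l||]; [exact: measurable_symm| |exact: measurable_entries].
  by apply: measurable_funB => //; exact: measurable_inner.
under eq_fun do rewrite mxE /center [X in - X]mxE [X in - (X + _)]mxE [X in - (_ + X)]mxE.
apply: measurable_funN; apply: measurable_funD => //; apply: measurable_funM => //.
have mD (k : 'I_d1) (l : 'I_d2) : measurable_fun setT
    (fun p : state * sample => (Theta - (p.1.1 : 'M[R]_(d1, d2))) k l).
  under eq_fun do rewrite !mxE; apply: measurable_funB => //; exact: measurable_entries.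
rewrite /dilation; case: (split_ordP i) => a ->; case: (split_ordP j) => b ->.
- by under eq_fun do rewrite block_mxEul mxE; exact: measurable_cst.
- by under eq_fun do rewrite block_mxEur; exact: mD.
- by under eq_fun do rewrite block_mxEdl mxE; exact: mD.
- by under eq_fun do rewrite block_mxEdr mxE; exact: measurable_cst.
Qed.

(* [c *: (symm H + V)] recovers the average of the truncated samples from the
   centred sum [H], and right multiplication by the spectral projection of
   [B^T *m B] thresholds the singular values of [B] without choosing an SVD. *)
Definition first_estimate (tau c : R) (V H : 'M[R]_(d1 + d2)) : 'M[R]_(d1, d2) :=
  let B := ht (c *: (symm H + V)) in B *m mxfun (step (tau ^+ 2)) (B^T *m B).

Definition restart tau c V (p : state) : state :=
  (first_estimate tau c V p.2, (0 : 'M[R]_(d1 + d2))).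

Lemma measurable_restart tau c V : measurable_fun setT (restart tau c V).
Proof.
apply: measurable_fun_pair; last exact: measurable_cst.
apply: measurable_borel_mx => i j; rewrite /first_estimate.
have mB k l : measurable_fun setT (fun p : state => ht (c *: (symm (p.2 : 'M[R]_(d1 + d2)) + V)) k l).
  under eq_fun do rewrite /ht mxE mxE mxE mxE; apply: measurable_funM => //.
  by apply: measurable_funD => //; exact: measurable_symm.
under eq_fun do rewrite mxE; apply: measurable_sum => k; apply: measurable_funM => //.
apply: measurable_mxfun_step => [a b|p]; last exact: gram_sym.
under eq_fun do rewrite mxE; apply: measurable_sum => l; apply: measurable_funM => //.
by under eq_fun do rewrite mxE; exact: mB.
Qed.

Variable A : set 'M[R]_(d1, d2).

Definition accurate (R0 : R) : set (borel_mx R d1 d2) :=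
  [set t : 'M[R]_(d1, d2) | forall a, A a -> `|inner (Theta - t) a| <= R0].

Lemma inner_mdist (t u a : 'M[R]_(d1, d2)) :
  `|inner t a - inner u a| <= (\sum_k \sum_i `|a i k|) * mdist t u.
Proof.
have E : inner t a - inner u a = \sum_k \sum_i (t i k - u i k) * a i k.
  rewrite /inner /mxtrace -sumrB; apply: eq_bigr => k _; rewrite !mxE -sumrB.
  by apply: eq_bigr => i _; rewrite !mxE mulrBl.
rewrite E mulr_suml; apply: le_trans (ler_norm_sum _ _ _) _; apply: ler_sum => k _.
rewrite mulr_suml; apply: le_trans (ler_norm_sum _ _ _) _; apply: ler_sum => i _.
by rewrite normrM mulrC ler_wpM2l // mdist_entry.
Qed.

(** The set [A] is arbitrary, so an intersection over [A] gives no measurability. The complement is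
    open instead: a violation at one [a] survives a small change of the pilot. *)
Lemma measurable_accurate R0 : measurable (accurate R0).
Proof.
rewrite -[accurate R0]setCK; apply: measurableC.
apply: (@measurable_mx_preimage R _ (borel_mx R d1 d2) d1 d2 (fun t => t)
  (fun i j => measurable_mx_entry i j) (~` accurate R0)).
move=> t /existsNP [a /not_implyP [Aa /negP]]; rewrite -ltNge => h.
set K := \sum_k \sum_i `|a i k|.
have K0 : 0 < K + 1 by rewrite ltr_wpDl // sumr_ge0 // => k _; exact: sumr_ge0.
exists ((`|inner (Theta - t) a| - R0) / (K + 1)); first by rewrite divr_gt0 // subr_gt0.
move=> u; rewrite ltr_pdivlMr // => tu /(_ _ Aa).
apply/negP; rewrite -ltNge.
have md0 : 0 <= mdist t u by apply: sumr_ge0 => i _; exact: sumr_ge0.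
have h1 : `|inner (Theta - t) a - inner (Theta - u) a| <= K * mdist t u.
  have e v : inner (Theta - v) a = inner Theta a - inner v a.
    by rewrite /inner linearB mulmxBl mxtraceB.
  by rewrite !e opprB addrC addrA subrK distrC; exact: inner_mdist.
have := ler_dist_dist (inner (Theta - t) a) (inner (Theta - u) a).
have := ler_norm (`|inner (Theta - t) a| - `|inner (Theta - u) a|).
lra.
Qed.

(* A pilot that is not accurate invalidates the one-step bound; its contribution
   is discarded, which costs nothing because a run never changes its pilot. *)
Definition potential (R0 : R) (s : state) : R :=
  \1_(accurate R0) s.1 * \tr (mxfun expR (symm (s.2 : 'M[R]_(d1 + d2)))).

Lemma tr_exp_ge0 n (H : 'M[R]_n) : H^T = H -> 0 <= \tr (mxfun expR H).
Proof.
move=> sH; have : \tr (mxfun (fun=> 0) H) <= \tr (mxfun expR H).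
  by apply/tr_le/mxfun_le => // a _; exact: expR_ge0.
by rewrite mxfun_cst // mxtrace_scalar mul0rn.
Qed.

Lemma potential_ge0 R0 s : 0 <= potential R0 s.
Proof. by rewrite mulr_ge0 ?indicE ?ler0n // tr_exp_ge0 // symm_sym. Qed.

Lemma measurable_potential R0 : measurable_fun setT (potential R0).
Proof.
have mi : measurable_fun setT (\1_(accurate R0) : borel_mx R d1 d2 -> R).
  exact: measurable_indic (measurable_accurate R0).
apply: measurable_funM; first exact: (measurableT_comp mi measurable_fst).
exact: (measurable_tr_exp measurable_snd).
Qed.

Lemma potential0 R0 (t : 'M[R]_(d1, d2)) : potential R0 (t, 0 : 'M[R]_(d1 + d2)) <= (d1 + d2)%:R.
Proof.
have s0 : (0 : 'M[R]_(d1 + d2))^T = 0 by rewrite trmx0.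
rewrite /potential /= symm_id //.
have -> : mxfun expR (0 : 'M[R]_(d1 + d2)) = 1%:M.
  rewrite -(mxfun_cst s0); apply: eq_mxfun => // a /eigenvalueP [v].
  rewrite mulmx0 => /esym/eqP; rewrite scaler_eq0 => /orP[/eqP -> _|-> //].
  by rewrite expR0.
by rewrite mxtrace1 -[leRHS]mul1r ler_wpM2r // indicE lern1; case: (_ \in _).
Qed.

End StateSpace.

Lemma markov_lt d (T : measurableType d) (R : realType) (P : probability T R)
    (g : T -> R) (a b : R) : measurable_fun setT g -> (forall w, 0 <= g w) -> 0 < b ->
  (\int[P]_w (g w)%:E <= a%:E)%E ->
  measurable [set w | (g w < b)%R] /\ ((1 - a / b)%:E <= P [set w | (g w < b)%R])%E.
Proof.
move=> mg g0 b0 ga.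
have mlt : measurable [set w | (g w < b)%R].
  rewrite -[X in measurable X]setTI (_ : [set w | _] = g @^-1` `]-oo, b[%classic).
    exact: mg.
  by apply/seteqP; split => w /=; rewrite in_itv.
split => //; have mge : measurable (~` [set w | (g w < b)%R]) by exact: measurableC.
rewrite -[X in P X]setCK probability_setC //.
suff : (P (~` [set w | (g w < b)%R]) <= (a / b)%:E)%E.
  rewrite -(@fineK _ (P (~` _))) ?fin_num_measure // lee_fin => h.
  by rewrite -EFinB lee_fin lerB.
rewrite EFinM lee_pdivlMr //; apply: le_trans ga.
apply: le_trans (_ : (\int[P]_(w in ~` [set w | (g w < b)%R]) (g w)%:E <= _)%E); last first.
  apply: ge0_subset_integral => //; first exact/measurable_EFinP.
  by move=> w _; rewrite lee_fin.
rewrite muleC -integral_cst //; apply: ge0_le_integral => //.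
- by move=> w _; rewrite lee_fin ltW.
- by apply/measurable_EFinP; exact: measurable_funTS.
- by move=> w /=; rewrite lee_fin => /negP; rewrite -leNgt.
Qed.

Section Run.
Variables (R : realType) (d1 d2 : nat) (Q : 'M[R]_(d2 * d1)) (Theta : 'M[R]_(d1, d2)).
Variable sigma : R.
Implicit Types (theta : 'M[R]_(d1, d2)) (s : seq ('M[R]_(d1, d2) * R)).

Definition run theta R0 nu s : 'M[R]_(d1 + d2) :=
  \sum_(z <- s) mxfun (@phi0 R) (nu *: dilation (unvec (one_sample Q theta z)))
  - (size s)%:R *: center nu sigma R0 Q (Theta - theta).

Lemma run_nil theta R0 nu : run theta R0 nu [::] = 0.
Proof. by rewrite /run big_nil scale0r subrr. Qed.

Lemma run_sym theta R0 nu s : (run theta R0 nu s)^T = run theta R0 nu s.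
Proof.
rewrite /run linearB linearZ /= center_sym linear_sum /=; congr (_ - _).
by apply: eq_bigr => z _; rewrite mxfun_sym // linearZ /= dilation_sym.
Qed.

Lemma advance_run theta R0 nu s z :
  advance Q Theta sigma R0 nu ((theta, run theta R0 nu s), z) =
  (theta, run theta R0 nu (rcons s z)).
Proof.
congr pair; rewrite symm_id ?run_sym // /update /run size_rcons -cats1 big_cat big_seq1 /=.
rewrite -/(one_sample Q theta z); move: (center _ _ _ _ _) => V.
by rewrite -[(size s).+1]addn1 natrD scalerDl scale1r opprD addrA (addrAC _ (- _)).
Qed.

Lemma first_estimate_run R0 delta s out : 0 <= R0 + sigma ->
  let nu := lowpopart_nu sigma R0 delta Q (size s) in
  lowpopart sigma s Q 0 R0 delta out ->
  first_estimate (lowpopart_threshold sigma R0 delta Q (size s)) ((size s)%:R * nu)^-1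
    ((size s)%:R *: center nu sigma R0 Q (Theta - 0)) (run 0 R0 nu s) = out.
Proof.
move=> R0s nu [U [S [V [[oU oV dS S0 E] ->]]]].
have t0 : 0 <= lowpopart_threshold sigma R0 delta Q (size s).
  by rewrite /lowpopart_threshold mulr_ge0 ?sqrtr_ge0 // mulr_ge0.
rewrite (threshold_spectral dS oU oV S0 t0) -E /first_estimate symm_id ?run_sym //.
by rewrite /run subrK /lowpopart_Theta1 add0r.
Qed.

End Run.

Section PotentialStep.
Context d (T : measurableType d) (R : realType) (P : probability T R) (d1 d2 : nat).
Variables (A : set 'M[R]_(d1, d2)) (pi : probability (borel_mx R d1 d2) R).
Variables (X : {RV P >-> borel_mx R d1 d2}) (eta : {RV P >-> R}) (Y : T -> R).
Variables (Theta : 'M[R]_(d1, d2)) (sigma : R).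
Hypotheses (piA : carried_by pi A) (uQ : covmx pi \in unitmx).
Hypothesis XE : forall B : set (borel_mx R d1 d2), measurable B -> distribution P X B = pi B.
Hypotheses (eta0 : ('E_P[eta] = 0)%E) (sub : subgaussian P sigma eta).
Hypothesis indep : independent_pair P X eta.
Hypothesis opA : forall a, A a -> opnorm a <= 1.
Hypothesis YE : forall w, Y w = inner Theta (X w) + eta w.
Hypothesis sigma0 : 0 < sigma.

(** The compensator [V] is deterministic given the pilot, so it can be subtracted from [H] in
    advance; [one_step] then gives it back and the potential does not grow. *)
Lemma potential_advance_le R0 nu (s : borel_mx R d1 d2 * borel_mx R (d1 + d2) (d1 + d2)) :
  0 <= R0 ->
  (\int[P]_w (potential Theta A R0
     (advance (covmx pi) Theta sigma R0 nu (s, (X w, Y w))))%:E <=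
   (potential Theta A R0 s)%:E)%E.
Proof.
move=> R00; case: s => theta H; rewrite /potential /=.
have [acc|nacc] := pselect (accurate Theta A R0 theta); last first.
  by rewrite indicE memNset // mul0r; under eq_integral do rewrite mul0r; rewrite integral0.
rewrite indicE mem_set // mul1r; under eq_integral do rewrite mul1r.
pose V := center nu sigma R0 (covmx pi) (Theta - theta).
pose H' := symm (H : 'M[R]_(d1 + d2)) - V.
have sH' : H'^T = H' by rewrite /H' linearB /= symm_sym center_sym.
have := one_step piA uQ XE eta0 sub indep opA acc R00 sigma0 nu sH'.
rewrite -/(center _ _ _ _ _) -/V subrK; apply: le_trans.
rewrite le_eqVlt; apply/orP; left; apply/eqP; apply: eq_integral => w _.
congr (\tr (mxfun expR _))%:E.
have -> : Y w - inner theta (X w) = inner (Theta - theta) (X w) + eta w.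
  by rewrite YE /inner linearB mulmxBl mxtraceB addrAC.
rewrite symm_id /update /H'; first by rewrite addrAC.
by rewrite linearB linearD /= symm_sym center_sym mxfun_sym // linearZ /= dilation_sym.
Qed.

End PotentialStep.

Section WarmChain.
Context d (T : measurableType d) (R : realType) (P : probability T R).
Variables (d1 d2 n m : nat).
Variables (A : set 'M[R]_(d1, d2)) (pi : probability (borel_mx R d1 d2) R).
Variables (X : 'I_n -> {RV P >-> borel_mx R d1 d2}) (eta : 'I_n -> {RV P >-> R}).
Variables (Y : 'I_n -> T -> R) (Theta : 'M[R]_(d1, d2)) (sigma Rmax : R).
Hypotheses (piA : carried_by pi A) (uQ : covmx pi \in unitmx).
Hypothesis YE : forall i w, Y i w = inner Theta (X i w) + eta i w.
Let Z i w : borel_mx R d1 d2 * R := (X i w, Y i w).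
Hypothesis iZ : independent_family P Z.
Hypothesis XE : forall i (B : set (borel_mx R d1 d2)), measurable B ->
  distribution P (X i) B = pi B.
Hypothesis eta0 : forall i, ('E_P[eta i] = 0)%E.
Hypothesis sub : forall i, subgaussian P sigma (eta i).
Hypothesis indep : forall i, independent_pair P (X i) (eta i).
Hypothesis opA : forall a, A a -> opnorm a <= 1.
Hypothesis sigma0 : 0 < sigma.
Hypothesis Rmax0 : 0 <= Rmax.
Hypothesis nE : n = (m + m)%N.
Variables (nu1 nu2 tau c : R) (V : 'M[R]_(d1 + d2)).

Notation state := (borel_mx R d1 d2 * borel_mx R (d1 + d2) (d1 + d2))%type.

(** At time [m] the restart acts before the sample is consumed. The state at time [m] still belongs
    to the first run, and the second run is visible only from [m.+1] on; hence the indices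
    [(m + k).+1]. *)
Definition warm_advance (k : nat) (p : state * (borel_mx R d1 d2 * R)) : state :=
  if (k < m)%N then advance (covmx pi) Theta sigma Rmax nu1 p
  else advance (covmx pi) Theta sigma sigma nu2
         (if k == m then restart tau c V p.1 else p.1, p.2).

Definition warm_chain : nat -> T -> state :=
  chain Z warm_advance ((0 : 'M[R]_(d1, d2)), (0 : 'M[R]_(d1 + d2))).

Let mZ i : measurable_fun setT (Z i).
Proof.
have mX : measurable_fun setT (X i : T -> borel_mx R d1 d2) by exact: measurable_funP.
have -> : Z i = fun w => (X i w, inner Theta (X i w) + eta i w).
  by apply/funext => w; rewrite /Z YE.
apply: measurable_fun_pair => //.
apply: measurable_funD => //.
by apply: (measurable_inner (M := fun=> (Theta : borel_mx R d1 d2))).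
Qed.

Let mF k : measurable_fun setT (warm_advance k).
Proof.
rewrite /warm_advance; case: (k < m)%N; first exact: measurable_advance.
apply: (measurableT_comp (measurable_advance _ _ _ _ _)).
apply: measurable_fun_pair; last exact: measurable_snd.
case: (k == m); last exact: measurable_fst.
exact: (measurableT_comp (measurable_restart tau c V) measurable_fst).
Qed.

Lemma measurable_warm_chain k : measurable_fun setT (warm_chain k).
Proof. exact: measurable_chain. Qed.

Let mpot R0 : measurable_fun setT (EFin \o potential Theta A R0).
Proof. by apply/measurable_EFinP; exact: measurable_potential. Qed.

Lemma potential_warm_chain1 k : (k <= m)%N ->
  (\int[P]_w (potential Theta A Rmax (warm_chain k w))%:E <= (d1 + d2)%:R%:E)%E.
Proof.
elim: k => [_|k IH km].
  rewrite [leLHS](integral_cst P measurableT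
    (potential Theta A Rmax ((0 : 'M[R]_(d1, d2)), (0 : 'M[R]_(d1 + d2))))%:E).
  by rewrite [X in (_ * X)%E](@probability_setT _ _ _ P) mule1 lee_fin; exact: potential0.
apply: le_trans (IH (ltnW km)).
have kn : (k < n)%N by rewrite nE ltn_addr.
apply: (chain_integral_le mZ iZ _ mF (i := Ordinal kn) (mpot _) _ (mpot _)) => [s|s|s].
- by rewrite lee_fin potential_ge0.
- by rewrite lee_fin potential_ge0.
rewrite /warm_advance /= km.
exact: (potential_advance_le piA uQ (XE _) (eta0 _) (sub _) (indep _) opA (YE _) sigma0 _ _ Rmax0).
Qed.

Lemma potential_warm_chain2 k : (k < m)%N ->
  (\int[P]_w (potential Theta A sigma (warm_chain (m + k).+1 w))%:E <= (d1 + d2)%:R%:E)%E.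
Proof.
have sig0 : 0 <= sigma by exact: ltW.
have h0 s : (0 <= (potential Theta A sigma s)%:E)%E by rewrite lee_fin potential_ge0.
elim: k => [km|k IH km].
  have kn : (m < n)%N by rewrite nE -{1}[m]addn0 ltn_add2l.
  rewrite addn0.
  (* The restart clears the matrix, so the second potential starts below [d1 + d2] whatever the
     first run produced; the comparison function is therefore a constant. *)
  apply: le_trans (_ : (\int[P]_w (cst (d1 + d2)%:R%:E : state -> \bar R)
    (warm_chain m w) <= _)%E); last first.
    by rewrite integral_cst // [X in (_ * X)%E](@probability_setT _ _ _ P) mule1.
  apply: (chain_integral_le mZ iZ _ mF (i := Ordinal kn) (mpot _)) => // s.
    by rewrite lee_fin.
  rewrite /warm_advance /= ltnn eqxx.
  apply: le_trans (potential_advance_le piA uQ (XE _) (eta0 _) (sub _) (indep _) opA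
    (YE _) sigma0 _ _ sig0) _.
  by rewrite lee_fin; exact: potential0.
apply: le_trans (IH (ltnW km)).
have kn : (m + k.+1 < n)%N by rewrite nE ltn_add2l.
rewrite -[(m + k).+1]addnS.
have step s : (\int[P]_w (potential Theta A sigma (warm_advance (m + k.+1) (s, Z (Ordinal kn) w)))%:E <=
    (potential Theta A sigma s)%:E)%E.
  rewrite /warm_advance ltnNge leq_addr /= -{2}[m]addn0 eqn_add2l /=.
  exact: (potential_advance_le piA uQ (XE _) (eta0 _) (sub _) (indep _) opA (YE _) sigma0 _ _ sig0).
exact: (chain_integral_le mZ iZ _ mF (i := Ordinal kn) (mpot _) h0 (mpot _) h0 step).
Qed.

Lemma warm_chain_likely (b : R) : (0 < m)%N -> 0 < b ->
  let E := [set w | potential Theta A Rmax (warm_chain m w) < b] `&`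
           [set w | potential Theta A sigma (warm_chain n w) < b] in
  measurable E /\ ((1 - 2 * ((d1 + d2)%:R / b))%:E <= P E)%E.
Proof.
move=> m0 b0 E.
have mg R0 k : measurable_fun setT (fun w => potential Theta A R0 (warm_chain k w)).
  exact: (measurableT_comp (measurable_potential _ _ _) (measurable_warm_chain k)).
have [mE1 hE1] := markov_lt (mg Rmax m) (fun w => potential_ge0 _ _ _ _) b0
  (potential_warm_chain1 (leqnn m)).
have [mE2 hE2] : measurable [set w | potential Theta A sigma (warm_chain n w) < b] /\
    ((1 - (d1 + d2)%:R / b)%:E <= P [set w | (potential Theta A sigma (warm_chain n w) < b)%R])%E.
  apply: markov_lt => //; first by move=> w; exact: potential_ge0.
  have e : (m + m.-1).+1 = n by rewrite -addnS prednK // nE.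
  by rewrite -{1}e; apply: potential_warm_chain2; rewrite ltn_predL.
have mE : measurable E by exact: measurableI.
split => //.
have : (P (~` E) <= P (~` [set w | (potential Theta A Rmax (warm_chain m w) < b)%R]) +
    P (~` [set w | (potential Theta A sigma (warm_chain n w) < b)%R]))%E.
  by rewrite /E setCI; apply: measureU2; exact: measurableC.
rewrite !probability_setC //.
move: hE1 hE2.
rewrite -(@fineK _ (P E)) ?fin_num_measure //.
rewrite -(@fineK _ (P [set w | _])) ?fin_num_measure //.
rewrite -(@fineK _ (P [set w | (potential _ _ sigma _ < _)%R])) ?fin_num_measure //.
by rewrite -!EFinB -!EFinD !lee_fin; lra.
Qed.

End WarmChain.

Section WarmRun.
Context d (T : measurableType d) (R : realType) (P : probability T R).
Variables (d1 d2 n m : nat) (pi : probability (borel_mx R d1 d2) R).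
Variables (X : 'I_n -> {RV P >-> borel_mx R d1 d2}) (Y : 'I_n -> T -> R).
Variables (Theta : 'M[R]_(d1, d2)) (sigma Rmax : R).
Hypothesis nE : n = (m + m)%N.
Variables (nu1 nu2 tau c : R) (V : 'M[R]_(d1 + d2)) (w : T).

Let C k := warm_chain m pi X Y Theta sigma Rmax nu1 nu2 tau c V k w.
Let s : seq ('M[R]_(d1, d2) * R) := [seq (X i w : 'M[R]_(d1, d2), Y i w) | i : 'I_n].

Lemma size_data : size s = n.
Proof. by rewrite size_map size_enum_ord. Qed.

Let z0 : 'M[R]_(d1, d2) * R := (0, 0).

Let nth_data (i : 'I_n) : nth z0 s i = (X i w : 'M[R]_(d1, d2), Y i w).
Proof. by rewrite (nth_map i) ?size_enum_ord // nth_ord_enum. Qed.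

Let CS (i : 'I_n) : C i.+1 =
  warm_advance m pi Theta sigma Rmax nu1 nu2 tau c V i (C i, (X i w, Y i w)).
Proof. exact: chainS. Qed.

Lemma warm_chain_first k : (k <= m)%N ->
  C k = ((0 : 'M[R]_(d1, d2)), run (covmx pi) Theta sigma 0 Rmax nu1 (take k s)).
Proof.
elim: k => [_|k IH km]; first by rewrite take0 run_nil.
have kn : (k < n)%N by rewrite nE ltn_addr.
rewrite (CS (Ordinal kn)) /warm_advance [nat_of_ord _]/= km (IH (ltnW km)).
rewrite (take_nth z0) ?size_data // -advance_run.
by rewrite (nth_data (Ordinal kn)).
Qed.

Let theta0 := first_estimate tau c V (C m).2.

Lemma warm_chain_second k : (k < m)%N ->
  C (m + k).+1 =
  (theta0, run (covmx pi) Theta sigma theta0 sigma nu2 (take k.+1 (drop m s))).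
Proof.
have sd : size (drop m s) = m by rewrite size_drop size_data nE addnK.
elim: k => [|k IH] km.
  have kn : (m < n)%N by rewrite nE -{1}[m]addn0 ltn_add2l.
  rewrite addn0 (CS (Ordinal kn)) /warm_advance [nat_of_ord _]/= ltnn eqxx /restart -/theta0.
  rewrite (take_nth z0) ?sd // -advance_run take0 run_nil nth_drop addn0.
  by rewrite (nth_data (Ordinal kn)).
have kn : (m + k.+1 < n)%N by rewrite nE ltn_add2l.
have mk : (m + k.+1 == m)%N = false by rewrite -{2}[m]addn0 eqn_add2l.
rewrite (CS (Ordinal kn)) /warm_advance [nat_of_ord _]/= ltnNge leq_addr /= mk.
have IH' := IH (ltnW km); rewrite -addnS in IH'; rewrite IH'.
rewrite [in RHS](take_nth z0) ?sd // -advance_run nth_drop.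
by rewrite (nth_data (Ordinal kn)).
Qed.

End WarmRun.

(** * Accuracy of the pilot, constants and the final bound *)

Section PilotAccuracy.
Variables (R : realType) (d1 d2 : nat) (A : set 'M[R]_(d1, d2)).
Hypothesis opA : forall a, A a -> opnorm a <= 1.

Lemma pilot_accurate (Theta out : 'M[R]_(d1, d2)) r t sigma : 0 < t ->
  (\rank Theta <= r)%N -> (\rank out <= r)%N ->
  (forall v, dot ((out - Theta) *m v) ((out - Theta) *m v) <= t ^+ 2 * dot v v) ->
  (r + r)%:R * t <= sigma -> accurate Theta A sigma out.
Proof.
move=> t0 rT ro err h a Aa; apply: le_trans h; apply: inner_le => // [|v|v].
- apply: leq_trans (leq_add rT ro); rewrite -(mxrank_opp out); exact: mxrank_add.
- have -> : (Theta - out) *m v = - ((out - Theta) *m v) by rewrite -mulNmx opprB.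
  have -> (x : 'cV[R]_d1) : dot (- x) (- x) = dot x x.
    by rewrite -(scaleN1r x) dotZl dotZr mulrA mulrNN !mul1r.
  exact: err.
- by rewrite -[leRHS]mul1r -[X in X * _](expr1n _ 2); exact: opnorm_bound (opA Aa).
Qed.

End PilotAccuracy.

(** Halving the failure rate replaces [x = 2 d / delta] by [2 x]. Since [x >= 2], this is at most
    [x^2], so the logarithm at most doubles. *)
Lemma logterm_half (R : realType) d1 d2 (delta : R) : (0 < d1)%N -> 0 < delta < 1 ->
  [/\ 0 < logterm d1 d2 delta, 0 < logterm d1 d2 (delta / 2),
    logterm d1 d2 (delta / 2) <= 2 * logterm d1 d2 delta
    & expR (logterm d1 d2 (delta / 2)) = 4 * (maxn d1 d2)%:R / delta].
Proof.
move=> d10 /andP[p0 p1]; rewrite /logterm; set D : R := (maxn d1 d2)%:R.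
have D1 : 1 <= D by rewrite ler1n leq_max d10.
have D0 : 0 < D by exact: lt_le_trans D1.
have -> : 2 * D / (delta / 2) = 4 * D / delta by field; rewrite gt_eqF.
have x1 : 1 < 2 * D / delta by rewrite ltr_pdivlMr //; lra.
have x2 : 1 < 4 * D / delta by rewrite ltr_pdivlMr //; lra.
split; [by rewrite ln_gt0|by rewrite ln_gt0| |by rewrite lnK // posrE; lra].
have -> : 2 * ln (2 * D / delta) = ln ((2 * D / delta) ^+ 2).
  by rewrite lnXn ?mulr_natl //; lra.
rewrite ler_ln ?posrE; [|lra|by rewrite exprn_gt0 //; lra].
have -> : 4 * D / delta = 2 * (2 * D / delta) by field; rewrite gt_eqF.
rewrite expr2 ler_wpM2r //; first by lra.
by rewrite ler_pdivlMr //; nra.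
Qed.

Theorem theorem3p4 (R : realType) :
  exists C0 C : R, [/\ 0 < C0, 0 < C &
    forall (d1 d2 r n0 : nat) (A : set 'M[R]_(d1, d2))
      (pi : probability (borel_mx R d1 d2) R)
      (Theta : 'M[R]_(d1, d2)) (sigma Rmax delta : R)
      (disp : measure_display) (T : measurableType disp) (P : probability T R)
      (X : 'I_n0 -> {RV P >-> borel_mx R d1 d2}) (eta : 'I_n0 -> {RV P >-> R})
      (Y : 'I_n0 -> T -> R) (Thetahat : T -> 'M[R]_(d1, d2)),
    (0 < d1)%N -> (0 < d2)%N -> (0 < r)%N -> ~~ odd n0 -> 0 < sigma ->
    spans A -> carried_by pi A -> covmx pi \in unitmx ->
    (\rank Theta <= r)%N ->
    (forall i w, Y i w = inner Theta (X i w) + eta i w) ->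
    iid P (fun i w => (X i w, Y i w) : borel_mx R d1 d2 * R) ->
    (forall i (B : set (borel_mx R d1 d2)), measurable B ->
       distribution P (X i) B = pi B) ->
    (forall i, ('E_P[eta i] = 0)%E) ->
    (forall i, subgaussian P sigma (eta i)) ->
    (forall i, independent_pair P (X i) (eta i)) ->
    (forall a, A a -> opnorm a <= 1) ->
    (forall a, A a -> `|inner Theta a| <= Rmax) ->
    0 < delta < 1 ->
    C0 * r%:R ^+ 2 * BQ (covmx pi) * ((sigma + Rmax) / sigma) ^+ 2
      * ln (2 * (maxn d1 d2)%:R / delta) <= n0%:R ->
    (forall w, warm_lowpopart sigma Rmax [seq (X i w, Y i w) | i : 'I_n0]
                 (covmx pi) delta (Thetahat w)) ->
    (* the event need not be measurable a priori *)
    exists E : set T,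
      [/\ measurable E, ((1 - delta)%:E <= P E)%E &
        forall w, E w ->
          (\rank (Thetahat w) <= r)%N /\
          opnorm (Thetahat w - Theta) <=
            C * sigma * Num.sqrt (2 * BQ (covmx pi) / n0%:R
                                  * ln (2 * (maxn d1 d2)%:R / delta))]].
Proof.
(* [256 = 64 * 2 * 2]: the pilot condition [8 r (sigma + Rmax) sqrt (B L' / m) <= sigma] squares to
   a factor [64], and [L' <= 2 L] and [n = 2 m] double it twice. [16 = 8 * 2]: the final error is
   [8 sigma sqrt (B L' / m)], and that root is at most twice the one in the claim. *)
exists 256, 16; split => // d1 d2 r n A pi Theta sigma Rmax delta disp T P X eta Y Thetahat.
move=> d10 d20 r0 even_n sigma0 spA piA uQ rT YE [iZ _] XE eta0 sub indep opA bd delta01 n_ge out.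
set Q := covmx pi in n_ge out *; set B := BQ Q in n_ge *.
set L := ln _ in n_ge *; have [L0 L'0 L'L expL'] := logterm_half d2 d10 delta01.
rewrite -[logterm d1 d2 delta]/L in L0 L'L; set L' := logterm d1 d2 (delta / 2) in L'0 L'L expL'.
(* A set spanning a nonzero space has an element, and the bound there forces [Rmax] to be
   nonnegative. *)
have Rmax0 : 0 <= Rmax.
  have [[|a s] [sA]] := spA (const_mx 1).
    rewrite span_nil memv0 => /eqP/matrixP/(_ (Ordinal d10) (Ordinal d20)).
    by rewrite !mxE => /eqP; rewrite oner_eq0.
  by move=> _; apply: le_trans (bd a (sA a _)); rewrite ?mem_head.
have B0 : 0 < B.
  (* The identity is a random matrix of law [pi] on the space of [pi] itself. Positivity of [B(Q)]
     is thus obtained without any sample, as it must be, since [n > 0] is deduced from it. *)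
  pose I : {mfun borel_mx R d1 d2 >-> borel_mx R d1 d2} :=
    HB.pack (fun a : borel_mx R d1 d2 => a)
      (isMeasurableFun.Build _ _ _ _ _ (@measurable_id _ (borel_mx R d1 d2) setT)).
  apply: (@one_step_BQ_gt0 _ _ R pi d1 d2 A pi I 0 0) => // a _.
  by rewrite /inner trmx0 mul0mx mxtrace0 normr0.
have n0 : (0 < n)%N.
  rewrite -(@ltr0n R); apply: lt_le_trans n_ge.
  by rewrite !mulr_gt0 ?exprn_gt0 ?ltr0n ?invr_gt0 ?(ltr_wpDr Rmax0) .
pose m := n./2; have nE : n = (m + m)%N by rewrite addnn -[LHS]odd_double_half (negbTE even_n).
have m0 : (0 < m)%N by move: n0; rewrite nE; case: (m).
have mp : 0 < m%:R :> R by rewrite ltr0n.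
pose nu1 := lowpopart_nu sigma Rmax (delta / 2) Q m.
pose nu2 := lowpopart_nu sigma sigma (delta / 2) Q m.
pose tau1 := lowpopart_threshold sigma Rmax (delta / 2) Q m.
pose tau2 := lowpopart_threshold sigma sigma (delta / 2) Q m.
pose c := (m%:R * nu1)^-1.
pose V := m%:R *: center nu1 sigma Rmax Q (Theta - 0).
have e0 : 0 < expR L' by exact: expR_gt0.
have [mE PE] := warm_chain_likely piA uQ YE iZ XE eta0 sub indep opA sigma0 Rmax0 nE
  nu1 nu2 tau1 c V m0 e0.
eexists; split; [exact: mE| |].
  (* As [d1 + d2] is at most twice the maximum and [expR L'] is four times the maximum over [delta],
     each run fails with probability at most [delta / 2]. *)
  apply: le_trans PE; rewrite lee_fin lerB // expL'.
  have D0 : 0 < (maxn d1 d2)%:R :> R by rewrite ltr0n leq_max d10.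
  have [p0 _] := andP delta01.
  have -> : 2 * ((d1 + d2)%:R / (4 * (maxn d1 d2)%:R / delta)) =
            delta * ((d1 + d2)%:R / (2 * (maxn d1 d2)%:R)) :> R by field; rewrite !gt_eqF.
  rewrite ger_pMr // ler_pdivrMr ?mul1r ?mulr_gt0 //.
  by rewrite -natrM ler_nat mul2n -addnn leq_add // leq_max leqnn ?orbT.
move=> w [/= g1 g2].
pose s : seq ('M[R]_(d1, d2) * R) := [seq (X i w : 'M[R]_(d1, d2), Y i w) | i : 'I_n].
have : warm_lowpopart sigma Rmax s Q delta (Thetahat w) by exact: out.
have ss : size s = n by exact: size_data.
case=> Theta0; rewrite ss -/m => -[out1 out2].
have s1 : size (take m s) = m by rewrite size_takel // ss nE leq_addr.
have s2 : size (drop m s) = m by rewrite size_drop ss nE addnK.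
have sum1 : 0 < sigma + Rmax by rewrite ltr_wpDr.
have sum2 : 0 < sigma + sigma by rewrite addr_gt0.
have acc0 : accurate Theta A Rmax 0 by move=> a Aa /=; rewrite subr0; exact: bd.
move: g1; rewrite (warm_chain_first _ _ _ _ _ _ nE _ _ _ _ _ _ (leqnn m)) -/s /potential /=.
rewrite indicE mem_set // mul1r symm_id ?run_sym // => g1.
have t1 : 0 < tau1.
  by have := threshold_gt0 (s := take m s) B0 _ L'0 sum1; rewrite s1; apply.
have [r1 err1] : (\rank Theta0 <= r)%N /\ forall v,
    dot ((Theta0 - Theta) *m v) ((Theta0 - Theta) *m v) <=
    (2 * tau1) ^+ 2 * dot v v.
  have := lowpopart_error B0 _ L'0 sum1 _ rT out1; rewrite s1; apply=> //.
  by move: g1; rewrite /run s1.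
(* The chain computed its own pilot; it coincides with [Theta0] whichever SVD produced the
   latter. *)
have th0 : first_estimate tau1 c V (warm_chain m pi X Y Theta sigma Rmax nu1 nu2 tau1 c V m w).2 = Theta0.
  rewrite (warm_chain_first _ _ _ _ _ _ nE _ _ _ _ _ _ (leqnn m)) /=.
  have := first_estimate_run Theta _ out1; rewrite /= s1 => h; apply: h.
  by rewrite addrC ltW.
(* The constant 256 is what makes [4 r tau1 <= sigma] below. *)
have sBm : Num.sqrt (B * L' / m%:R) <= sigma / (8 * r%:R * (sigma + Rmax)).
  have rp : 0 < r%:R :> R by rewrite ltr0n.
  set y := sigma / _; have y0 : 0 <= y by rewrite divr_ge0 ?mulr_ge0 ?ltW.
  rewrite -[leRHS](ger0_norm y0) -sqrtr_sqr ler_wsqrtr //.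
  have -> : y ^+ 2 = (64 * r%:R ^+ 2 * ((sigma + Rmax) / sigma) ^+ 2)^-1.
    by rewrite /y; field; rewrite !gt_eqF.
  set q := (sigma + Rmax) / sigma in n_ge *; have q0 : 0 < q by rewrite divr_gt0.
  have k0 : 0 < 64 * r%:R ^+ 2 * q ^+ 2.
    by apply: mulr_gt0; [apply: mulr_gt0 => //|]; exact: exprn_gt0.
  rewrite ler_pdivrMr // ler_pdivlMl //.
  have x0 : 0 <= r%:R ^+ 2 * q ^+ 2 * B by apply: mulr_ge0 (ltW B0); exact: mulr_ge0 (sqr_ge0 _) (sqr_ge0 _).
  have := ler_wpM2l x0 L'L; move: n_ge; rewrite nE natrD; lra.
have acc : accurate Theta A sigma Theta0.
  apply: (pilot_accurate opA (t := 2 * tau1) _ rT r1 err1); first by rewrite mulr_gt0.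
  have rp : 0 < r%:R :> R by rewrite ltr0n.
  have h := ler_wpM2l (ltW (mulr_gt0 (mulr_gt0 (ltr0n R 8) rp) sum1)) sBm.
  rewrite /tau1 /lowpopart_threshold -/B -/L' natrD.
  apply: le_trans (_ : 8 * r%:R * (sigma + Rmax) * (sigma / (8 * r%:R * (sigma + Rmax))) <= _).
    by apply: le_trans h; rewrite le_eqVlt; apply/orP; left; apply/eqP; ring.
  by rewrite mulrCA divff ?mulr1 // gt_eqF // !mulr_gt0.
have lastE : (m + m.-1).+1 = n by rewrite -addnS prednK.
have := @warm_chain_second _ _ _ P d1 d2 n m pi X Y Theta sigma Rmax nE nu1 nu2 tau1 c V w m.-1.
rewrite lastE ltn_predL m0 => /(_ isT) cn.
(* Accuracy of [Theta0] turns the indicator in the second potential into [1], so the event bounds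
   the trace itself. *)
move: g2; rewrite cn th0 prednK // -/s take_oversize ?s2 // /potential /=.
rewrite indicE mem_set // mul1r symm_id ?run_sym // => g2.
have [r2 err2] : (\rank (Thetahat w) <= r)%N /\ forall v,
    dot ((Thetahat w - Theta) *m v) ((Thetahat w - Theta) *m v) <=
    (2 * tau2) ^+ 2 * dot v v.
  have := lowpopart_error B0 _ L'0 sum2 _ rT out2; rewrite s2; apply=> //.
  by move: g2; rewrite /run s2.
have t2 : 0 < tau2.
  by have := threshold_gt0 (s := take m s) B0 _ L'0 sum2; rewrite s1; apply.
split=> //; apply: le_trans (opnorm_le _ err2) _; first by rewrite mulr_ge0 // ltW.
rewrite /tau2 /lowpopart_threshold -/B -/L'.
have : Num.sqrt (B * L' / m%:R) <= 2 * Num.sqrt (2 * B / n%:R * L).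
  have two : 0 <= 2 :> R by [].
  rewrite -{1}(ger0_norm two) -sqrtr_sqr -sqrtrM ?exprn_ge0 // ler_wsqrtr //.
  have -> : 2 ^+ 2 * (2 * B / n%:R * L) = 2 * (B * (2 * L) / m%:R).
    by rewrite nE natrD; field; rewrite !gt_eqF ?addr_gt0.
  have h1 : B * L' / m%:R <= B * (2 * L) / m%:R.
    by rewrite ler_wpM2r ?invr_ge0 // ler_wpM2l // ltW.
  have h2 : 0 <= B * L' / m%:R by rewrite divr_ge0 ?mulr_ge0 // ltW.
  lra.
move: (Num.sqrt _) (Num.sqrt _) => x y xy.
have := ler_wpM2l (ltW sigma0) xy; lra.
Qed.
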